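(* Let $s>0$ and assume that $\mathbf E[Z^{s+1}]<+\infty$. Let $g:\mathbb R_+\to\mathbb R_+$ be concave and bounded, assume that there are constants $\kappa_1,\kappa_2>0$ such that for all $x>0$ $$\frac{x}{(1+\kappa_1x^s)^{1/s}}\le g(x)\le\frac{x}{(1+\kappa_2x^s)^{1/s}},$$ and assume that the following limit exists: $$\kappa_g:=\lim_{x\downarrow0}\frac{1}{x^{s+1}}\,(x-g(x))\in(0,+\infty).$$ Let $(R_n)$ be a sequence of positive numbers and, for each $n$, define $(B_n(u))_{u\in T_n}$ by $B_n(u)=+\infty$ for $u\in\partial T_n$ and $B_n(u)=R_n\sum_{v\leftarrow u}g(B_n(v))$ for $u\in T_n\setminus\partial T_n$; set $B_n:=B_n(\rho)$ and $a_n:=\sum_{k=1}^n(mR_n)^{-ks}$. If $\lim_{n\to\infty}mR_n=\vartheta\in(0,1]$, then $$\mathbf E[B_n]\sim\alpha_s(\vartheta)\,(a_n)^{-1/s}\qquad\text{as }n\to\infty,$$ for some constant $\alpha_s(\vartheta)$, with $\alpha_s(1)=\big(s\,\kappa_g\,\mathbf E[W^{s+1}]\big)^{-1/s}$ in the case $\lim_{n\to\infty}mR_n=1$.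
   Context: $\mu$ is a probability distribution on $\{0,1,2,\dots\}$ with $\mu(0)=0$, $\mu(1)<1$; $Z\sim\mu$ and $m:=\mathbf E[Z]<\infty$ (so $m>1$). $T$ is the Galton--Watson tree with offspring law $\mu$ and root $\rho$; $T_n$ is the subtree of vertices at distance at most $n$ from the root, $\partial T_n$ is the set of vertices at distance exactly $n$, and $Z_n=|\partial T_n|$. $W:=\lim_{n\to\infty}m^{-n}Z_n$ is the almost sure limit of the martingale of the branching process. The notation $v\leftarrow u$ means that $v$ is a child of $u$. $\mathbf E$ refers to the randomness of the tree. The convention $g(+\infty):=\lim_{x\to\infty}g(x)$ is used. The number $R_n$ is deterministic, fixed along $T_n$, but may depend on $n$. $x_n\sim y_n$ means $x_n/y_n\to1$. *)

(* Defs.v *)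
From HB Require Import structures.
From mathcomp Require Import all_boot all_order all_algebra finmap.
From mathcomp Require Import all_classical all_reals all_analysis.
Set Implicit Arguments.
Unset Strict Implicit.
Unset Printing Implicit Defensive.
Import Order.TTheory GRing.Theory Num.Theory.
Import numFieldNormedType.Exports.
Local Open Scope classical_set_scope.
Local Open Scope ring_scope.

(* The tree is encoded by Ulam-Harris labels: a vertex is a word in [seq nat]
   (the root being [::]), and [N u w] is the number of children that the vertex
   [u] has in the outcome [w], namely rcons u 0, ..., rcons u (N u w).-1.  The
   variables N u are given for all words; only the vertices of the tree matter. *)

Definition mutually_independent d (Omega : measurableType d) (R : realType)
    (P : probability Omega R) (I : choiceType) d' (E : measurableType d')
    (X : I -> {RV P >-> E}) : Prop :=
  forall (J : {fset I}) (A : I -> set E), (forall i, measurable (A i)) ->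
    P (\bigcap_(i in [set` J]) (X i @^-1` A i)) =
    (\prod_(i <- J) P (X i @^-1` A i))%E.

Definition galton_watson d (Omega : measurableType d) (R : realType)
    (P : probability Omega R) (mu : probability nat R)
    (N : seq nat -> {RV P >-> nat}) : Prop :=
  mutually_independent N /\
  forall (u : seq nat) (A : set nat), distribution P (N u) A = mu A.

(* E[Z^p] for Z of law mu. *)
Definition offspring_moment (R : realType) (mu : probability nat R) (p : R) :
    \bar R :=
  (\int[mu]_k ((k%:R `^ p)%:E))%E.

Definition offspring_mean (R : realType) (mu : probability nat R) : \bar R :=
  (\int[mu]_k (k%:R%:E))%E.

Section Tree.
Context (Omega : Type) (N : seq nat -> Omega -> nat).

Definition children (w : Omega) (u : seq nat) : seq (seq nat) :=
  [seq rcons u i | i <- iota 0 (N u w)].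

Fixpoint generation (w : Omega) (n : nat) : seq (seq nat) :=
  if n is n'.+1 then flatten [seq children w u | u <- generation w n']
  else [:: [::]].

Definition generation_size (n : nat) (w : Omega) : nat :=
  size (generation w n).

(* The a.s. limit of m^-n Z_n; [limn] has a junk value on the null set where
   the sequence does not converge. *)
Definition martingale_limit (R : realType) (m : R) (w : Omega) : R :=
  limn (fun n : nat => (generation_size n w)%:R / m ^+ n).

Lemma size_generation (w : Omega) (n : nat) (u : seq nat) :
  u \in generation w n -> size u = n.
Proof.
elim: n u => [|n IH] u; first by rewrite inE => /eqP ->.
by move=> /flatten_mapP[v vn] /mapP[i _ ->]; rewrite size_rcons IH.
Qed.

Section Recursion.
Context (R : realType) (g : R -> R).

(* The value at -oo is never used. *)
Definition extend_to_infty (x : \bar R) : R :=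
  match x with
  | r%:E => g r
  | +oo%E => lim (g x @[x --> +oo])
  | -oo%E => g 0
  end.

Fixpoint tree_rec (r : R) (w : Omega) (h : nat) (u : seq nat) : \bar R :=
  if h is h'.+1 then
    (r * \sum_(v <- children w u) extend_to_infty (tree_rec r w h' v))%:E
  else +oo%E.

(* B_n(u), for u in T_n; see [B_leaf] and [B_node]. *)
Definition B (r : nat -> R) (n : nat) (u : seq nat) (w : Omega) : \bar R :=
  tree_rec (r n) w (n - size u) u.

Lemma B_leaf (r : nat -> R) (n : nat) (u : seq nat) (w : Omega) :
  u \in generation w n -> B r n u w = +oo%E.
Proof. by move=> /size_generation su; rewrite /B su subnn. Qed.

Lemma B_node (r : nat -> R) (n k : nat) (u : seq nat) (w : Omega) :
  (k < n)%N -> u \in generation w k ->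
  B r n u w =
  (r n * \sum_(v <- children w u) extend_to_infty (B r n v w))%:E.
Proof.
move=> kn /size_generation su.
rewrite {1}/B su -subSS subSn//=; congr (_ * _)%:E.
by rewrite !big_map; apply: eq_bigr => i _; rewrite /B size_rcons su.
Qed.

End Recursion.
End Tree.

Definition concave_on_nonneg (R : realType) (g : R -> R) : Prop :=
  convex_function [set x : R^o | 0 <= x] (fun x : R^o => - g x).

Definition a_seq (R : realType) (m s : R) (r : nat -> R) (n : nat) : R :=
  \sum_(1 <= k < n.+1) (m * r n) `^ (- (k%:R * s)).

(* x_n ~ y_n, i.e. x_n / y_n --> 1. *)
Definition asymp_equiv (R : realType) (x : nat -> \bar R) (y : nat -> R) : Prop :=
  (x n / (y n)%:E)%E @[n --> \oo] --> 1%E.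

(* Main.v *)
Require Import Defs.
From HB Require Import structures.
From mathcomp Require Import all_boot all_order all_algebra finmap.
From mathcomp Require Import all_classical all_reals all_analysis.
From mathcomp Require Import measurable_realfun ring lra.
Import Order.TTheory GRing.Theory Num.Theory.
Import numFieldNormedType.Exports.
Set Implicit Arguments.
Unset Strict Implicit.
Unset Printing Implicit Defensive.
Local Open Scope classical_set_scope.
Local Open Scope ring_scope.

(** The heart of the matter is the critical case m R_n -> 1, in which the mean
    value b_k of the solution on a tree of height k + 1 satisfies
      b_(k+1) = m R (1 - loss_k) b_k,
    where loss_k b_k = E[B - g B] for the solution B on that tree.  Hence
      b_(k+1)^(-s) = (m R)^(-s) (b_k^(-s) + rate_k),
    with rate_k close to s loss_k b_k^(-s), and unrolling this linear recursion
    shows that b_n^(-s) / a_n is a weighted average of the rates, with geometric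
    weights whose ratio tends to 1 ([mean_value_powRN], [weighted_average_cvg]).
    It remains to see that the rates tend to s kappa_g E[W^(s+1)], uniformly
    for R close to 1 / m ([defect_ratio_cvg], [rate_cvg]).  As
    x - g x ~ kappa_g x^(s+1) near 0 and b_k is small, this amounts to the
    convergence of the (s+1)-st moment of the normalized solution Y_k = B / b_k
    to that of W.

    This convergence is obtained from stochastic comparison.  For the convex
    order, a concave g with g 0 = 0 makes a normalized variable less spread out
    ([cx_le_concave_image]), and summing independent copies over the children
    respects the order ([cx_le_child_sum]).  The recursion for Y_k alternates
    these two operations, while W_k uses the second one only.  Therefore Y_k is
    less spread out than W_(k+1), which bounds its (s+1)-st moment by that of W
    ([unit_value_moment]).  Conversely g is almost linear at the small values
    met far from the leaves: the L^1-distance between Y_k before and after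
    applying g is of the order of loss_k, which tends to 0, so that W_j is less
    spread out than Y_(k+j) up to a small error ([W_cx_le_unit_value]).  Testing
    this against p-th powers continued by tangents, which are convex and
    Lipschitz, gives the lower bound on the moment ([unit_value_trunc_ge]).  The
    order is only ever used through test functions of bounded slope, and the
    error is measured by that slope ([cx_le]).

    What is needed of the branching martingale is its boundedness in L^p for
    p = s + 1 and its convergence almost surely and in L^1.  The latter follows
    from the geometric decay of E|W_(n+1) - W_n| ([increment_bound]), and the
    former from an inequality for (x + y)^p in which the coefficient of y^p is
    close to 1 ([powR_add_le], [W_moment_bounded]).

    For theta < 1 the losses decay geometrically, because b_k does.  The
    quotient of b_k by (m R)^(k+1) then decreases to a positive limit, uniformly
    in R near theta / m, and a_n is equivalent to its largest term up to the
    factor 1 / (1 - theta^s) ([scaled_mean_diag_cvg], [subcritical_equiv]). *)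

(** * Inequalities for powers *)

Section PowerInequalities.
Context {R : realType}.
Implicit Types a b x y p s : R.

(** Young's inequality for the conjugate exponents p and p / (p - 1). *)
Lemma powR_tangent_le p a b : 1 < p -> 0 <= a -> 0 <= b ->
  a `^ p + p * a `^ (p - 1) * (b - a) <= b `^ p.
Proof.
move=> p1 a0 b0.
have p0 : 0 < p by apply: lt_trans p1.
have q0 : 0 < p - 1 by rewrite subr_gt0.
have cq : p^-1 + (p / (p - 1))^-1 = 1.
  by rewrite invf_div -{1}(mul1r p^-1) -mulrDl addrC subrK divff// gt_eqF.
have := conjugate_powR b0 (powR_ge0 a (p - 1)) p0 (divr_gt0 p0 q0) cq.
rewrite -powRrM [(p - 1) * _]mulrC divfK ?gt_eqF// => H.
have ap : a `^ p = a * a `^ (p - 1) by rewrite mulr_powRB1.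
have := ler_wpM2l (ltW p0) H.
rewrite mulrDr [p * (b `^ p / p)]mulrC divfK ?gt_eqF//.
have -> : p * (a `^ p / (p / (p - 1))) = (p - 1) * a `^ p.
  by field; rewrite !gt_eqF.
move=> H2; rewrite -subr_ge0.
have -> : b `^ p - (a `^ p + p * a `^ (p - 1) * (b - a)) =
  b `^ p + (p - 1) * a `^ p - p * (b * a `^ (p - 1)).
  by rewrite ap; ring.
by rewrite subr_ge0.
Qed.

Lemma powR_le p a b : 0 <= p -> 0 <= a -> a <= b -> a `^ p <= b `^ p.
Proof.
move=> p0 a0 ab; apply: ge0_ler_powR => //; rewrite nnegrE //.
exact: le_trans ab.
Qed.

Lemma powRN_le p a b : 0 <= p -> 0 < a -> a <= b -> b `^ (- p) <= a `^ (- p).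
Proof.
move=> p0 a0 ab; have b0 := lt_le_trans a0 ab.
by rewrite !powRN lef_pV2 ?posrE ?powR_gt0//; apply: powR_le => //; exact: ltW.
Qed.

(** Lower powers are absorbed into the p-th one, at the price of a constant. *)
Lemma powR_pred_le p (dlt : R) : 0 < p - 1 -> 0 < dlt ->
  exists2 C, 0 <= C & forall a, 0 <= a -> a `^ (p - 1) <= dlt * a `^ p + C.
Proof.
move=> p1 d0; exists (dlt^-1 `^ (p - 1)); first exact: powR_ge0.
have p0 : 0 < p by lra.
move=> a a0; have [ad|ad] := leP a dlt^-1.
  apply: ler_wpDl; first by rewrite mulr_ge0 ?powR_ge0 ?ltW.
  by apply: powR_le; rewrite // ltW.
apply: ler_wpDr; first exact: powR_ge0.
rewrite -(mulr_powRB1 a0 p0) mulrA ler_peMl ?powR_ge0//.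
by rewrite mulrC -ler_pdivrMr// mul1r ltW.
Qed.

(** The coefficient of y^p can be taken arbitrarily close to 1: if y is much
    larger than x then x + y is almost y, and otherwise the tangent to the p-th
    power at x + y is controlled by x^(p-1). *)
Lemma powR_add_le p (eps : R) : 1 < p -> 0 < eps ->
  exists2 C, 0 <= C & forall x y, 0 <= x -> 0 <= y ->
    (x + y) `^ p <= x `^ p + (1 + eps) * y `^ p + C * (x `^ (p - 1) * y).
Proof.
move=> p1 e0; have p0 : 0 < p by lra.
have q0 : 0 < p - 1 by lra.
set c := (1 + eps) `^ p^-1 - 1.
have c0 : 0 < c.
  rewrite subr_gt0 -[ltLHS](powRr0 (1 + eps)) /powR gt_eqF; last by lra.
  by rewrite ltr_expR mul0r mulr_gt0 ?invr_gt0// ln_gt0//; lra.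
have cp : (1 + c) `^ p = 1 + eps.
  by rewrite addrC subrK -powRrM mulVf ?gt_eqF// powRr1//; lra.
exists (p * (1 + c^-1) `^ (p - 1)); first by rewrite mulr_ge0 ?powR_ge0 ?ltW.
move=> x y x0 y0; have [xy|xy] := leP x (c * y).
  apply: ler_wpDr; first by rewrite !mulr_ge0 ?powR_ge0 // ltW.
  apply: ler_wpDl; first exact: powR_ge0.
  rewrite -cp -powRM; [|by lra|exact: y0].
  by apply: powR_le; [exact: ltW|exact: addr_ge0|lra].
have yx : y <= c^-1 * x by rewrite mulrC ler_pdivlMr// mulrC ltW.
rewrite -subr_ge0; have xy0 : 0 <= x + y by exact: addr_ge0.
have := powR_tangent_le p1 xy0 x0.
have H : (x + y) `^ (p - 1) <= (1 + c^-1) `^ (p - 1) * x `^ (p - 1).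
  rewrite -powRM//; last by rewrite addr_ge0// invr_ge0 ltW.
  by apply: powR_le; [exact: ltW|exact: xy0|lra].
have := ler_wpM2l (mulr_ge0 (ltW p0) y0) H.
have : 0 <= (1 + eps) * y `^ p by rewrite mulr_ge0 ?powR_ge0//; lra.
by rewrite opprD addNKr; lra.
Qed.

Lemma powR_inv1D_ge s y : 0 < s -> 0 <= y -> 1 - y / s <= ((1 + y) `^ s^-1)^-1.
Proof.
move=> s0 y0; rewrite -powRN /powR gt_eqF; last by lra.
apply: le_trans (expR_ge1Dx _); rewrite lerD2l mulNr lerN2 mulrC.
by rewrite ler_pM2r ?invr_gt0// le_ln1Dx//; lra.
Qed.

(** The tangents at 0 and at del of the convex function t |-> (1 - t)^(-s). *)
Lemma powRN_1B_bounds s (del : R) : 0 < s -> 0 <= del -> del < 1 ->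
  s * del <= (1 - del) `^ (- s) - 1 <= s * del * (1 - del) `^ (- (s + 1)).
Proof.
move=> s0 d0 d1; have d2 : 0 < 1 - del by lra.
have pE t : (1 - del) `^ (- t) = expR (- (t * ln (1 - del))).
  by rewrite /powR gt_eqF// mulNr.
have lnle : ln (1 - del) <= - del by apply: le_ln1Dx; lra.
have lnge : - ln (1 - del) <= del / (1 - del).
  rewrite -lnV ?posrE//.
  rewrite [X in ln X](_ : _ = 1 + del / (1 - del)); last by field; rewrite gt_eqF.
  have := divr_ge0 d0 (ltW d2) => h; rewrite le_ln1Dx//; lra.
have sl : s * del <= - (s * ln (1 - del)).
  by rewrite -mulrN ler_pM2l//; lra.
have -> : (1 - del) `^ (- (s + 1)) = (1 - del) `^ (- s) / (1 - del).
  by rewrite opprD powRD ?(gt_eqF d2) ?implybT// (powR_inv1 (ltW d2)).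
apply/andP; split.
  by rewrite pE; have := expR_ge1Dx (- (s * ln (1 - del))); lra.
have h : 1 - (1 - del) `^ s <= s * del / (1 - del).
  have := expR_ge1Dx (s * ln (1 - del)).
  rewrite /powR (gt_eqF d2).
  have := ler_wpM2l (ltW s0) lnge; rewrite mulrA; lra.
have := ler_wpM2r (powR_ge0 (1 - del) (- s)) h.
rewrite mulrBl mul1r -powRD; last by rewrite (gt_eqF d2) implybT.
rewrite subrr powRr0 => h2.
by apply: le_trans h2 _; rewrite mulrAC mulrA.
Qed.

End PowerInequalities.

(** * Convex Lipschitz functions *)

(** A nonnegative function on the half-line, convex with slopes in [0, L].  A
    subgradient is asked for at every point because it is all that Jensen's
    inequality and the comparison of laws below use of convexity. *)
Definition convex_lip {R : realType} (L : R) (phi : R -> R) :=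
  (forall a, 0 <= phi a) /\
  exists dphi : R -> R, forall a, 0 <= a ->
    0 <= dphi a <= L /\
    forall b, 0 <= b -> phi a + dphi a * (b - a) <= phi b.

Section ConvexLip.
Context {R : realType}.
Implicit Types (L a b c x p : R) (phi : R -> R).

Lemma convex_lip_shift L phi x : 0 <= x -> convex_lip L phi ->
  convex_lip L (fun y => phi (x + y)).
Proof.
move=> x0 [phi0 [dphi h]]; split=> [a|]; first exact: phi0.
exists (fun a => dphi (x + a)) => a a0.
have [hL hb] := h _ (addr_ge0 x0 a0); split=> // b b0.
by have := hb _ (addr_ge0 x0 b0); rewrite opprD addrACA subrr add0r.
Qed.

Lemma convex_lip_scale L phi c : 0 <= c -> convex_lip L phi ->
  convex_lip (c * L) (fun y => phi (c * y)).
Proof.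
move=> c0 [phi0 [dphi h]]; split=> [a|]; first exact: phi0.
exists (fun a => c * dphi (c * a)) => a a0.
have [/andP[h0 hL] hb] := h _ (mulr_ge0 c0 a0); split.
  by rewrite mulr_ge0// ler_wpM2l.
move=> b b0; have := hb _ (mulr_ge0 c0 b0).
by rewrite -mulrBr mulrCA mulrA.
Qed.

Lemma convex_lip_ge0 L phi : convex_lip L phi -> 0 <= L.
Proof.
move=> [_ [dphi h]]; have [/andP[h0 hL] _] := h 0 (lexx 0).
exact: le_trans hL.
Qed.

Lemma convex_lip_lip L phi a b : convex_lip L phi -> 0 <= a -> 0 <= b ->
  phi a <= phi b + L * `|a - b|.
Proof.
move=> [_ [dphi h]] a0 b0.
have [/andP[h0 hL] hb] := h _ a0; have := hb _ b0.
rewrite -opprB mulrN => H.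
suff : dphi a * (a - b) <= L * `|a - b| by lra.
by apply: le_trans (ler_wpM2l h0 (ler_norm _)) _; rewrite ler_wpM2r.
Qed.

(** The p-th power up to L, continued by its tangent at L: a convex function of
    bounded slope, which approximates the p-th power from below. *)
Definition powR_trunc p L x :=
  let t := Num.min `|x| L in t `^ p + p * t `^ (p - 1) * (`|x| - t).

Lemma powR_trunc_small p L x : 0 <= x -> x <= L -> powR_trunc p L x = x `^ p.
Proof.
by move=> x0 xL; rewrite /powR_trunc ger0_norm// min_l// subrr mulr0 addr0.
Qed.

Lemma powR_trunc_le p L x : 1 < p -> 0 <= L -> 0 <= x ->
  powR_trunc p L x <= x `^ p.
Proof.
move=> p1 L0 x0; rewrite /powR_trunc ger0_norm//.
by apply: powR_tangent_le => //; rewrite le_min x0.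
Qed.

Lemma powR_trunc_homo p L L' x : 1 < p -> 0 <= L -> L <= L' ->
  powR_trunc p L x <= powR_trunc p L' x.
Proof.
move=> p1 L0 LL; have p0 : 0 <= p by lra.
rewrite /powR_trunc; move: `|x| (normr_ge0 x) => {}x x0.
set t := Num.min x L; set t' := Num.min x L'.
have t0 : 0 <= t by rewrite le_min x0.
have tt : t <= t' by rewrite le_min !ge_min lexx/= LL orbT.
have tx : t' <= x by rewrite ge_min lexx.
have := powR_tangent_le p1 t0 (le_trans t0 tt).
have h : p * t `^ (p - 1) <= p * t' `^ (p - 1).
  by rewrite ler_wpM2l//; apply: powR_le => //; lra.
have xt : 0 <= x - t' by lra.
have := ler_wpM2r xt h; lra.
Qed.

Lemma convex_lip_powR_trunc p L : 1 < p -> 0 <= L ->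
  convex_lip (p * L `^ (p - 1)) (powR_trunc p L).
Proof.
move=> p1 L0; have p0 : 0 <= p by lra.
have t0 x : 0 <= Num.min `|x| L by rewrite le_min normr_ge0.
split=> [a|].
  rewrite /powR_trunc addr_ge0 ?powR_ge0// !mulr_ge0 ?powR_ge0//.
  by rewrite subr_ge0 ge_min lexx.
exists (fun a => p * (Num.min `|a| L) `^ (p - 1)) => a a0; split.
  rewrite mulr_ge0 ?powR_ge0//= ler_wpM2l//.
  by apply: powR_le => //; [lra|rewrite ge_min lexx orbT].
move=> b b0; rewrite /powR_trunc.
have := t0 a; have : Num.min `|a| L <= L by rewrite ge_min lexx orbT.
rewrite (ger0_norm a0) (ger0_norm b0); move: (Num.min a L) => t tL tge0.
have -> : t `^ p + p * t `^ (p - 1) * (a - t) + p * t `^ (p - 1) * (b - a) =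
  t `^ p + p * t `^ (p - 1) * (b - t) by ring.
have [bL|Lb] := leP b L; first by rewrite subrr mulr0 addr0; exact: powR_tangent_le.
have := powR_tangent_le p1 tge0 L0.
have h1 : p * t `^ (p - 1) <= p * L `^ (p - 1).
  by rewrite ler_wpM2l//; apply: powR_le => //; lra.
have bL0 : 0 <= b - L by lra.
have := ler_wpM2r bL0 h1.
lra.
Qed.

(** Beyond a fixed multiple of L the truncated power is at most half of the
    p-th power, so that the difference of the two controls the tail. *)
Lemma powR_tail_le p : 1 < p -> exists2 Lam, 0 < Lam &
  forall L x, 0 <= L -> 0 <= x -> Lam * L <= x ->
    x `^ p <= 2 * (x `^ p - powR_trunc p L x).
Proof.
move=> p1; have p0 : 0 < p by lra.
have q0 : 0 < p - 1 by lra.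
exists ((2 * p) `^ (p - 1)^-1); first by rewrite powR_gt0//; lra.
move=> L x L0 x0 h.
have Lx : L <= x.
  apply: le_trans h; rewrite ler_peMl// -[leLHS](powRr0 (2 * p)).
  by apply: ler_powR; [lra|rewrite invr_ge0 ltW].
rewrite /powR_trunc ger0_norm// min_r//.
have h2 : 2 * p * L `^ (p - 1) <= x `^ (p - 1).
  have -> : 2 * p * L `^ (p - 1) = ((2 * p) `^ (p - 1)^-1 * L) `^ (p - 1).
    rewrite powRM ?powR_ge0// -powRrM mulVf ?gt_eqF// powRr1//; lra.
  by apply: powR_le => //; [exact: ltW|rewrite mulr_ge0 ?powR_ge0].
have := ler_wpM2r x0 h2.
rewrite [x `^ _ * x]mulrC mulr_powRB1//.
have hL : L `^ p = L * L `^ (p - 1) by rewrite mulr_powRB1.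
have : 0 <= (p - 1) * (L * L `^ (p - 1)) by rewrite !mulr_ge0 ?powR_ge0// ltW.
rewrite hL; lra.
Qed.

End ConvexLip.

(** * The conductance function *)

Section ConductanceFunction.
Context {R : realType} (g : R -> R) (s kappa1 kappa2 : R).
Hypotheses (s_gt0 : 0 < s) (g_ge0 : forall x, 0 <= x -> 0 <= g x).
Hypothesis g_concave : concave_on_nonneg g.
Hypotheses (kappa1_gt0 : 0 < kappa1) (kappa2_gt0 : 0 < kappa2).
Hypothesis g_bounds : forall x, 0 < x ->
    x / (1 + kappa1 * x `^ s) `^ (s^-1) <= g x <=
    x / (1 + kappa2 * x `^ s) `^ (s^-1).
Implicit Types a b x y t lam : R.

Lemma concave_le t x y : 0 <= t <= 1 -> 0 <= x -> 0 <= y ->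
  t * g x + (1 - t) * g y <= g (t * x + (1 - t) * y).
Proof.
move=> t01 x0 y0.
have t01' : Itv.spec (@Itv.num_sem R) (Itv.Real `[Posz 0, Posz 1]) t.
  by rewrite /Itv.spec/= /Itv.num_sem/= num_real/= in_itv/=.
have := g_concave (Itv.mk t01') (mem_set x0) (mem_set y0).
rewrite !convRE/= /unstable.onem; lra.
Qed.

(** The inequality between the slopes of g on [a, b] and on [b, x]. *)
Lemma concave_slopes a b x : 0 <= a -> a < b -> b < x ->
  (g x - g b) * (b - a) <= (g b - g a) * (x - b).
Proof.
move=> a0 ab bx.
have xa : 0 < x - a by lra.
set t := (b - a) / (x - a).
have t01 : 0 <= t <= 1.
  by rewrite divr_ge0 ?ler_pdivrMr ?mul1r//; lra.
have x0 : 0 <= x by lra.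
have := concave_le t01 x0 a0.
have -> : t * x + (1 - t) * a = b by rewrite /t; field; rewrite gt_eqF.
move=> /(ler_wpM2r (ltW xa)).
have -> : (t * g x + (1 - t) * g a) * (x - a) =
  (b - a) * g x + (x - b) * g a by rewrite /t; field; rewrite gt_eqF.
lra.
Qed.

Lemma g_gt0 x : 0 < x -> 0 < g x.
Proof.
move=> x0; have /andP[h _] := g_bounds x0; apply: lt_le_trans h.
by rewrite divr_gt0// powR_gt0// ltr_wpDr// mulr_ge0 ?powR_ge0 ?ltW.
Qed.

Lemma g_lt x : 0 < x -> g x < x.
Proof.
move=> x0; have /andP[_ h] := g_bounds x0; apply: le_lt_trans h _.
rewrite ltr_pdivrMr; last first.
  by rewrite powR_gt0// ltr_wpDr// mulr_ge0 ?powR_ge0 ?ltW.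
rewrite ltr_pMr// -[ltLHS](_ : 1 `^ s^-1 = 1); last by rewrite powR1.
apply: gt0_ltr_powR.
- by rewrite invr_gt0.
- by rewrite nnegrE.
- by rewrite nnegrE addr_ge0// mulr_ge0 ?powR_ge0 ?ltW.
- by rewrite ltrDl mulr_gt0// powR_gt0.
Qed.

Lemma g0 : g 0 = 0.
Proof.
apply/eqP; rewrite eq_le g_ge0// andbT; apply/ler_addgt0Pl => e e0.
have e2 : 0 < e / 2 by rewrite divr_gt0.
have h1 := g_lt e2.
have h2 := g_gt0 e0.
have t01 : 0 <= (2^-1 : R) <= 1 by apply/andP; split; lra.
have := concave_le t01 (ltW e0) (lexx 0).
have -> : 2^-1 * e + (1 - 2^-1) * 0 = e / 2 by field.
rewrite addr0; lra.
Qed.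

Lemma g_le x : 0 <= x -> g x <= x.
Proof. by rewrite le0r => /predU1P[->|/g_lt/ltW//]; rewrite g0. Qed.

Lemma g_mono x y : 0 <= x -> x <= y -> g x <= g y.
Proof.
move=> x0; rewrite le_eqVlt => /predU1P[->//|xy].
rewrite leNgt; apply/negP => gyx.
(* a strictly negative slope would eventually force g below 0 *)
set z := y + (y - x) * (g y + 1) / (g x - g y).
have gy0 : 0 <= g y by apply: g_ge0; lra.
have yz : y < z.
  by rewrite ltrDl !mulr_gt0// ?invr_gt0; lra.
have := concave_slopes x0 xy yz.
have -> : (g y - g x) * (z - y) = - ((y - x) * (g y + 1)).
  by rewrite /z; field; rewrite gt_eqF//; lra.
have gz0 : 0 <= g z by apply: g_ge0; lra.
have : 0 <= g z * (y - x) by rewrite mulr_ge0//; lra.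
lra.
Qed.

Lemma g_scale lam x : 1 <= lam -> 0 <= x -> g (lam * x) <= lam * g x.
Proof.
move=> l1 x0; have l0 : 0 < lam by lra.
have t01 : 0 <= lam^-1 <= 1 by rewrite invr_ge0 ltW//= invf_le1.
have := concave_le t01 (mulr_ge0 (ltW l0) x0) (lexx 0).
rewrite mulr0 addr0 mulrA mulVf ?gt_eqF// mul1r g0 mulr0 addr0.
by rewrite ler_pdivrMl.
Qed.

Lemma g_ratio x y : 0 < x -> x <= y -> g y / y <= g x / x.
Proof.
move=> x0 xy; have y0 : 0 < y by lra.
have l1 : 1 <= y / x by rewrite ler_pdivlMr// mul1r.
have := g_scale l1 (ltW x0); rewrite divfK ?gt_eqF// => h.
by rewrite ler_pdivrMr//; apply: le_trans h _; rewrite mulrC mulrCA mulrC.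
Qed.

(** The slopes of the concave function g lie in [0, 1], since g is nondecreasing
    and g x <= x.  The absolute values only make the function nonnegative on
    the whole line. *)
Lemma convex_lip_defect : convex_lip 1 (fun x => `|x| - g `|x|).
Proof.
split=> [a|]; first by rewrite subr_ge0 g_le.
pose S a := [set (g x - g a) / (x - a) | x in [set x | a < x]].
exists (fun a => if a == 0 then 0 else 1 - sup (S a)) => a a0.
have [->|a1] := eqVneq a 0.
  split=> [|b b0]; first by rewrite lexx ler01.
  by rewrite normr0 g0 subrr mul0r addr0 ger0_norm// subr_ge0 g_le.
have {a0 a1} a0 : 0 < a by rewrite lt_neqAle eq_sym a1.
have S0 : S a !=set0.
  by exists ((g (a + 1) - g a) / (a + 1 - a)); exists (a + 1) => //=; lra.
have Sle y : 0 <= y -> y < a -> ubound (S a) ((g a - g y) / (a - y)).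
  move=> y0 ya _ [x /= ax <-].
  have := concave_slopes y0 ya ax => h.
  by rewrite ler_pdivrMr ?subr_gt0// mulrAC ler_pdivlMr ?subr_gt0.
have Sub : has_ubound (S a) by exists ((g a - g 0) / (a - 0)); exact: Sle.
have supge0 : 0 <= sup (S a).
  have a1 : a <= a + 1 by lra.
  apply: (@le_trans _ _ ((g (a + 1) - g a) / (a + 1 - a))).
    by rewrite divr_ge0 ?subr_ge0// g_mono// ltW.
  by apply: sup_ubound => //; exists (a + 1) => //=; rewrite ltrDl.
have suple1 : sup (S a) <= 1.
  apply: le_trans (sup_le_ub S0 (Sle 0 (lexx 0) a0)) _.
  by rewrite g0 !subr0 ler_pdivrMr// mul1r g_le// ltW.
split; first by lra.
move=> b b0; rewrite (ger0_norm (ltW a0)) (ger0_norm b0).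
suff : g b <= g a + sup (S a) * (b - a) by lra.
have [ab|] := ltP a b.
  have : (g b - g a) / (b - a) <= sup (S a) by apply: sup_ubound => //; exists b.
  by rewrite ler_pdivrMr ?subr_gt0// => h; lra.
rewrite le_eqVlt => /predU1P[->|ba]; first by rewrite subrr mulr0 addr0.
have := sup_le_ub S0 (Sle b b0 ba).
rewrite ler_pdivlMr; last by lra.
lra.
Qed.

Lemma defect_le x : 0 <= x -> x - g x <= kappa1 / s * x `^ (s + 1).
Proof.
rewrite le0r => /predU1P[->|x0]; first by rewrite g0 subrr mulr_ge0 ?powR_ge0// divr_ge0// ltW.
have /andP[h _] := g_bounds x0.
have k0 : 0 <= kappa1 * x `^ s by rewrite mulr_ge0 ?powR_ge0 ?ltW.
have := ler_wpM2l (ltW x0) (powR_inv1D_ge s_gt0 k0).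
have xs : x `^ (s + 1) = x * x `^ s.
  by rewrite -(mulr_powRB1 (ltW x0) (addr_gt0 s_gt0 ltr01)) addrK.
rewrite xs; lra.
Qed.

End ConductanceFunction.

(** * Independence in the tree *)

Section TreeCodes.
Context {Omega : Type} (N : seq nat -> Omega -> nat).

Definition cylinder (J : seq (seq nat * nat)) : set Omega :=
  [set w | all (fun p => N p.1 w == p.2) J].

Lemma cylinder_cat J J' : cylinder (J ++ J') = cylinder J `&` cylinder J'.
Proof. by apply/seteqP; split=> w; rewrite /cylinder/= all_cat => /andP. Qed.

(** A number encoding the subtree above u cut at height h.  Its fibres are
    cylinders, so that independence can be read off the product rule for
    finitely many vertices. *)
Fixpoint code (h : nat) (u : seq nat) (w : Omega) : nat :=
  if h is h'.+1 then choice.pickle [seq code h' (rcons u i) w | i <- iota 0 (N u w)]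
  else 0%N.

Definition shift_cyl (u : seq nat) (J : seq (seq nat * nat)) :=
  [seq (u ++ p.1, p.2) | p <- J].

(** Each fibre of [F], a family of functions indexed by a base vertex u, is empty or
    a cylinder on vertices u ++ v with v in D, in a way that depends on u by
    translation only. *)
Definition local_family (D : pred (seq nat)) (C : Type)
    (F : seq nat -> Omega -> C) : Prop :=
  forall c, (forall u w, F u w <> c) \/
    exists2 J, uniq (unzip1 J) /\ all D (unzip1 J) &
      forall u w, F u w = c <-> cylinder (shift_cyl u J) w.

Lemma local_familyW (D D' : pred (seq nat)) (C : Type)
    (F : seq nat -> Omega -> C) :
  {subset D <= D'} -> local_family D F -> local_family D' F.
Proof.
move=> DD' lF c; have [|[J [uJ DJ] HJ]] := lF c; [by left|right].
by exists J => //; split=> //; apply/allP => v /(allP DJ) /DD'.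
Qed.

(** Two conditions on disjoint sets of vertices can be imposed by a single cylinder. *)
Lemma local_family_pair (D D' : pred (seq nat)) (C C' : Type)
    (F : seq nat -> Omega -> C) (F' : seq nat -> Omega -> C') :
  (forall v, D v -> ~~ D' v) -> local_family D F -> local_family D' F' ->
  local_family (predU D D') (fun u w => (F u w, F' u w)).
Proof.
move=> DD' lF lF' [c c'].
have [nF|[J [uJ DJ] HJ]] := lF c; first by left=> u w [/nF].
have [nF|[J' [uJ' DJ'] HJ']] := lF' c'; first by left=> u w [_ /nF].
right; exists (J ++ J').
  rewrite /unzip1 map_cat cat_uniq all_cat; split.
    apply/and3P; split=> //; apply/hasPn => v /(allP DJ')/= D'v.
    by apply/negP => /(allP DJ)/= /DD'; rewrite D'v.
  apply/andP; split.
    by apply: sub_all DJ => v Dv /=; rewrite Dv.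
  by apply: sub_all DJ' => v Dv /=; rewrite Dv orbT.
move=> u w; rewrite /shift_cyl map_cat cylinder_cat; split.
  by case=> /HJ ? /HJ' ?; split.
by case=> /HJ -> /HJ' ->.
Qed.

Lemma local_family_inj (D : pred (seq nat)) (C C' : Type) (e : C -> C')
    (F : seq nat -> Omega -> C) :
  injective e -> local_family D F -> local_family D (fun u w => e (F u w)).
Proof.
move=> ei lF c'; have [[c <-]|h] := pselect (exists c, e c = c'); last first.
  by left=> u w ec; apply: h; exists (F u w).
have [nF|[J uJ HJ]] := lF c; first by left=> u w /ei/nF.
by right; exists J => // u w; rewrite -HJ; split=> [/ei|->].
Qed.

Lemma local_family_offspring : local_family (pred1 [::]) N.
Proof.
move=> k; right; exists [:: ([::], k)] => // u w.
by rewrite /cylinder/= cats0 andbT; split=> /eqP.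
Qed.

Lemma local_family_child (D : pred (seq nat)) (C : Type) (i : nat)
    (F : seq nat -> Omega -> C) :
  local_family D F ->
  local_family [pred v | if v is j :: v' then (j == i) && D v' else false]
    (fun u => F (rcons u i)).
Proof.
move=> lF c; have [nF|[J [uJ DJ] HJ]] := lF c; first by left=> u w; exact: nF.
right; exists (shift_cyl [:: i] J).
  split.
    rewrite /unzip1 -map_comp (_ : _ \o _ = cons i \o fst)//.
    by rewrite map_comp map_inj_uniq// => x y [].
  rewrite /unzip1 -map_comp all_map; apply/allP => p pJ /=; rewrite eqxx/=.
  by apply: (allP DJ); exact: map_f.
move=> u w; rewrite HJ (_ : shift_cyl (rcons u i) J = shift_cyl u (shift_cyl [:: i] J))//.
by rewrite /shift_cyl -map_comp; apply: eq_map => p /=; rewrite cat_rcons.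
Qed.

Definition below_child (i n : nat) : pred (seq nat) :=
  [pred v | if v is j :: _ then (i <= j < i + n)%N else false].

(** The subtrees above distinct children involve disjoint sets of vertices. *)
Lemma local_family_children (C : eqType) (F : seq nat -> Omega -> C) :
  local_family predT F -> forall n i,
  local_family (below_child i n)
    (fun u w => [seq F (rcons u j) w | j <- iota i n]).
Proof.
move=> lF; elim=> [|n IH] i.
  case=> [|c l]; last by left.
  by right; exists [::] => // u w; split.
have := local_family_pair _ (local_family_child i lF) (IH i.+1).
move=> /(_ _)/(local_family_inj (e := fun p => p.1 :: p.2)) h.
apply: (local_familyW _ (h _ _)).
- move=> [|j v]//= /orP[/andP[/eqP -> _]|/andP[ij jn]].
    by rewrite -[_ \in _]/(i <= i < i + n.+1)%N leqnn -[ltnLHS]addn0 ltn_add2l.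
  by rewrite -[_ \in _]/(i <= j < i + n.+1)%N (ltnW ij)/= -addSnnS.
- by move=> [? ?] [? ?] /= [-> ->].
- by move=> [|j v]//= /andP[/eqP-> _]; apply/negP => /andP[]; rewrite ltnn.
Qed.

Lemma local_family_code h : local_family predT (code h).
Proof.
elim: h => [|h IH] c.
  have [->|c0] := eqVneq c 0%N; last by left=> u w /= /esym/eqP; rewrite (negbTE c0).
  by right; exists [::] => // u w; split.
have [[l <-]|nl] := pselect (exists l : seq nat, choice.pickle l = c); last first.
  by left=> u w /= e; apply: nl; eexists; exact: e.
have := local_family_pair _ local_family_offspring
  (local_family_children IH (size l) 0).
move=> /(_ _ (size l, l))[|nF|[J [uJ _] HJ]].
- by move=> v /eqP ->.
- left=> u w /= /(pcan_inj choice.pickleK) e; apply: (nF u w).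
  by have := congr1 size e; rewrite size_map size_iota => <-; rewrite e.
right; exists J; first by split=> //; apply/allP.
move=> u w; rewrite -HJ/=; split=> [/(pcan_inj choice.pickleK) e|[-> ->]//].
by have := congr1 size e; rewrite size_map size_iota => <-; rewrite e.
Qed.

End TreeCodes.

Section Independence.
Context {R : realType} {mu : probability nat R}.
Context {d : measure_display} {Omega : measurableType d}.
Context {P : probability Omega R} {N : seq nat -> {RV P >-> nat}}.
Hypothesis N_GW : galton_watson mu N.
Implicit Types (J : seq (seq nat * nat)) (F : seq nat -> Omega -> nat).

Lemma measurable_cylinder J : measurable (cylinder N J).
Proof.
elim: J => [|p J IH]; first by rewrite (_ : cylinder _ _ = setT)//; apply/seteqP.
rewrite -cat1s cylinder_cat; apply: measurableI => //.
rewrite (_ : cylinder _ _ = N p.1 @^-1` [set p.2]).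
  by rewrite -[X in measurable X]setTI; exact: measurable_funPT.
by apply/seteqP; split=> w; rewrite /cylinder/= andbT => /eqP.
Qed.

Lemma probability_cylinder J : uniq (unzip1 J) ->
  P (cylinder N J) = (\prod_(p <- J) mu [set p.2])%E.
Proof.
move=> uJ; have [ind law] := N_GW.
pose K := seq_fset tt (unzip1 J).
pose A v := [set k | (v, k) \in J].
have uniqJ v k k' : (v, k) \in J -> (v, k') \in J -> k = k'.
  move: uJ {K A}; elim: J => // -[v0 k0] J IH /=.
  move=> /andP[v0J uJ]; rewrite !inE => /orP[/eqP[-> ->]|vkJ].
    by move=> /orP[/eqP[->]//|h]; rewrite (map_f fst h) in v0J.
  by move=> /orP[/eqP[e _]|]; [rewrite -e (map_f fst vkJ) in v0J|exact: IH].
have -> : cylinder N J = \bigcap_(v in [set` K]) (N v @^-1` A v).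
  apply/seteqP; split=> w.
    move=> /allP wJ v /=; rewrite seq_fsetE => /mapP[[v' k] vJ /= ->].
    by rewrite /A/=; move: (wJ _ vJ) => /= /eqP ->.
  move=> wJ; apply/allP => -[v k] vJ /=.
  have : v \in K by rewrite seq_fsetE; apply/mapP; exists (v, k).
  by move=> /(wJ v) /= h; apply/eqP; exact: uniqJ vJ.
rewrite ind; last by [].
transitivity (\prod_(v <- unzip1 J) mu (A v))%E.
  rewrite (eq_bigr (fun v => mu (A v))); last by move=> v _; rewrite -(law v).
  by apply: perm_big; rewrite -[X in perm_eq _ X]undup_id// seq_fset_perm.
rewrite big_map; apply: eq_big_seq => -[v k] vJ /=; congr (mu _).
by apply/seteqP; split=> k' /=; [move=> /(uniqJ _ _ _ vJ) ->|move=> ->].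
Qed.

Lemma shift_cyl_uniq u J : uniq (unzip1 J) -> uniq (unzip1 (shift_cyl u J)).
Proof.
move=> uJ; rewrite /unzip1 /shift_cyl -map_comp.
rewrite (_ : _ \o _ = cat u \o fst)// map_comp map_inj_uniq//.
by move=> x y; elim: u => //= a u IH [].
Qed.

Lemma local_family_measurable D F u c : local_family N D F ->
  measurable (F u @^-1` [set c]).
Proof.
move=> /(_ c)[nF|[J _ HJ]].
  by rewrite (_ : _ @^-1` _ = set0)//; apply/seteqP; split=> // w /= /nF.
rewrite (_ : _ @^-1` _ = cylinder N (shift_cyl u J)).
  exact: measurable_cylinder.
by apply/seteqP; split=> w /= /HJ.
Qed.

Lemma local_family_law D F u v c : local_family N D F ->
  P (F u @^-1` [set c]) = P (F v @^-1` [set c]).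
Proof.
move=> /(_ c)[nF|[J [uJ _] HJ]].
  rewrite (_ : F u @^-1` _ = set0); last by apply/seteqP; split=> // w /= /nF.
  by rewrite (_ : F v @^-1` _ = set0)//; apply/seteqP; split=> // w /= /nF.
have E x : F x @^-1` [set c] = cylinder N (shift_cyl x J).
  by apply/seteqP; split=> w /= /HJ.
by rewrite !E !probability_cylinder ?shift_cyl_uniq// !big_map.
Qed.

Lemma local_family_indep (D D' : pred (seq nat)) F F' u c c' : (forall v, D v -> ~~ D' v) ->
  local_family N D F -> local_family N D' F' ->
  P (F u @^-1` [set c] `&` F' u @^-1` [set c']) =
  (P (F u @^-1` [set c]) * P (F' u @^-1` [set c']))%E.
Proof.
move=> DD' lF lF'.
have [nF|[J [uJ DJ] HJ]] := lF c.
  rewrite (_ : F u @^-1` _ = set0); last by apply/seteqP; split=> // w /= /nF.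
  by rewrite set0I measure0 mul0e.
have [nF|[J' [uJ' DJ'] HJ']] := lF' c'.
  rewrite (_ : F' u @^-1` _ = set0); last by apply/seteqP; split=> // w /= /nF.
  by rewrite setI0 measure0 mule0.
have -> : F u @^-1` [set c] = cylinder N (shift_cyl u J).
  by apply/seteqP; split=> w /= /HJ.
have -> : F' u @^-1` [set c'] = cylinder N (shift_cyl u J').
  by apply/seteqP; split=> w /= /HJ'.
rewrite -cylinder_cat -map_cat !probability_cylinder ?shift_cyl_uniq//.
  by rewrite map_cat big_cat.
rewrite /unzip1 map_cat cat_uniq uJ uJ' andbT /=.
apply/hasPn => v /(allP DJ')/= D'v.
by apply/negP => /(allP DJ)/= /DD'; rewrite D'v.
Qed.

End Independence.

(** * Functions of a subtree, and Fubini for them *)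

Lemma measurable_of_fibres d (Omega : measurableType d) d'
    (T : measurableType d') (f : Omega -> nat) (G : nat -> T) : (forall k, measurable (f @^-1` [set k])) ->
  measurable_fun setT (fun w => G (f w)).
Proof.
move=> mf _ B mB; rewrite setTI.
rewrite (_ : _ @^-1` B = \bigcup_(k in G @^-1` B) f @^-1` [set k]).
  by apply: bigcup_measurable.
by apply/seteqP; split=> [w /= h|w [k /= h fw]]; [by exists (f w)|rewrite fw].
Qed.

Section Fibres.
Context {d : measure_display} {Omega : measurableType d} {R : realType}.
Context (P : probability Omega R).

Lemma bigcup_fibres (f : Omega -> nat) (D : set Omega) :
  \bigcup_k (D `&` f @^-1` [set k]) = D.
Proof.
by apply/seteqP; split=> [w [k _ []]//|w Dw]; exists (f w).
Qed.

Lemma trivIset_fibres (f : Omega -> nat) (D : set Omega) :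
  trivIset setT (fun k => D `&` f @^-1` [set k]).
Proof. by move=> k k' _ _ [w /= [[_ <-] [_ <-]]]. Qed.

Lemma integral_fibres (f : Omega -> nat) (H : nat -> Omega -> \bar R) :
  (forall k, measurable (f @^-1` [set k])) ->
  (forall k w, 0 <= H k w)%E ->
  measurable_fun setT ((fun w => H (f w) w) : Omega -> \bar R) ->
  (\int[P]_w H (f w) w = \sum_(k <oo) \int[P]_(w in f @^-1` [set k]) H k w)%E.
Proof.
move=> mf H0 mH; rewrite -[in LHS](bigcup_fibres f setT).
rewrite ge0_integral_bigcup//; last 3 first.
- by move=> k; rewrite setTI.
- by rewrite bigcup_fibres.
- exact: trivIset_fibres.
apply: eq_eseriesr => k _; rewrite setTI; apply: eq_integral => w.
by move=> /set_mem/= e; rewrite e.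
Qed.

Lemma integral_fun_fibres (f : Omega -> nat) (G : nat -> R) (D : set Omega) :
  (forall k, measurable (f @^-1` [set k])) -> measurable D ->
  (forall k, 0 <= G k) ->
  (\int[P]_(w in D) (G (f w))%:E =
   \sum_(k <oo) (G k)%:E * P (D `&` f @^-1` [set k]))%E.
Proof.
move=> mf mD G0; rewrite -[in LHS](bigcup_fibres f D).
have mG : measurable_fun setT (fun w => (G (f w))%:E).
  exact: (measurable_of_fibres (fun k => (G k)%:E)).
rewrite ge0_integral_bigcup//; last 4 first.
- by move=> k; exact: measurableI.
- exact: measurable_funTS.
- by move=> w _; rewrite lee_fin.
- exact: trivIset_fibres.
apply: eq_eseriesr => k _.
rewrite -integral_cst; last exact: measurableI.
by apply: eq_integral => w /set_mem/= [_ ->].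
Qed.

Lemma integral_indep_fibre (f : Omega -> nat) (G : nat -> R) (D : set Omega) :
  (forall k, measurable (f @^-1` [set k])) -> measurable D ->
  (forall k, 0 <= G k) ->
  (forall k, P (D `&` f @^-1` [set k]) = (P D * P (f @^-1` [set k]))%E) ->
  (\int[P]_(w in D) (G (f w))%:E = (\int[P]_w (G (f w))%:E) * P D)%E.
Proof.
move=> mf mD G0 ind; rewrite !integral_fun_fibres//.
rewrite muleC -(fineK (fin_num_measure P _ mD)) -nneseriesZl; last first.
  by move=> k _; rewrite mule_ge0 ?lee_fin.
by apply: eq_eseriesr => k _; rewrite ind setTI fineK ?fin_num_measure// muleCA.
Qed.

(** Fubini for two independent variables with countably many values. *)
Lemma integral_indep_pair (f f' : Omega -> nat) (F : nat -> nat -> R) :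
  (forall k, measurable (f @^-1` [set k])) ->
  (forall k, measurable (f' @^-1` [set k])) ->
  (forall k l, 0 <= F k l) ->
  (forall k l, P (f @^-1` [set k] `&` f' @^-1` [set l]) =
    (P (f @^-1` [set k]) * P (f' @^-1` [set l]))%E) ->
  (\int[P]_w (F (f w) (f' w))%:E =
   \int[P]_w \int[P]_w' (F (f w) (f' w'))%:E)%E.
Proof.
move=> mf mf' F0 ind.
rewrite (integral_fibres (H := fun k w => (F k (f' w))%:E))//; last 2 first.
- by move=> k w; rewrite lee_fin.
- pose h w := choice.pickle (f w, f' w).
  pose G n := (if choice.unpickle n is Some p then F p.1 p.2 else 0)%:E.
  have -> : (fun w => (F (f w) (f' w))%:E) = (fun w => G (h w)).
    by apply/funext => w; rewrite /G /h choice.pickleK.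
  apply: measurable_of_fibres => n.
  have [[p <-]|nn] := pselect (exists p : nat * nat, choice.pickle p = n).
    rewrite (_ : _ @^-1` _ = f @^-1` [set p.1] `&` f' @^-1` [set p.2]).
      exact: measurableI.
    apply/seteqP; split=> w /=; first by move=> /(pcan_inj choice.pickleK) <-.
    by case: p => k l /= [<- <-].
  rewrite (_ : _ @^-1` _ = set0)//; apply/seteqP; split=> // w /= e.
  by apply: nn; eexists; exact: e.
rewrite (integral_fibres (H := fun k w => \int[P]_w' (F k (f' w'))%:E)%E)//.
- apply: eq_eseriesr => k _; rewrite integral_cst//.
  by rewrite integral_indep_fibre.
- by move=> k w; apply: integral_ge0 => w' _; rewrite lee_fin.
- exact: (measurable_of_fibres (fun k => \int[P]_w' (F k (f' w'))%:E)%E).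
Qed.

(** Through their values in a countable discrete space, f and f' give a jointly
    measurable function on the product, to which Tonelli applies. *)
Lemma integral_swap (f f' : Omega -> nat) (F : nat -> nat -> R) :
  (forall k, measurable (f @^-1` [set k])) ->
  (forall k, measurable (f' @^-1` [set k])) ->
  (forall k l, 0 <= F k l) ->
  (\int[P]_w \int[P]_w' (F (f w) (f' w'))%:E =
   \int[P]_w' \int[P]_w (F (f w) (f' w'))%:E)%E.
Proof.
move=> mf mf' F0.
apply: (fubini_tonelli (fun z : Omega * Omega => (F (f z.1) (f' z.2))%:E)).
  pose h (z : Omega * Omega) := choice.pickle (f z.1, f' z.2).
  pose G n := (if choice.unpickle n is Some p then F p.1 p.2 else 0)%:E.
  have -> : (fun z : Omega * Omega => (F (f z.1) (f' z.2))%:E) = (fun z => G (h z)).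
    by apply/funext => z; rewrite /G /h choice.pickleK.
  apply: measurable_of_fibres => n.
  have [[p <-]|nn] := pselect (exists p : nat * nat, choice.pickle p = n).
    rewrite (_ : _ @^-1` _ = (f @^-1` [set p.1]) `*` (f' @^-1` [set p.2])).
      exact: measurableX.
    apply/seteqP; split=> w /=; first by move=> /(pcan_inj choice.pickleK) <-.
    by case: p => k l /= [<- <-].
  rewrite (_ : _ @^-1` _ = set0)//; apply/seteqP; split=> // w /= e.
  by apply: nn; eexists; exact: e.
by move=> z; rewrite lee_fin.
Qed.

End Fibres.

Section TreeVariableDefs.
Context {R : realType} {Omega : Type} (N : seq nat -> Omega -> nat).
Implicit Types (A : seq nat -> Omega -> R).

(** The same function of the subtree above u, for every u, seen only up to a
    fixed height. *)
Definition tree_var A := exists h f, forall u w, A u w = f (code N h u w) :> R.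

Definition child_sum A u w : R := \sum_(0 <= i < N u w) A (rcons u i) w.

End TreeVariableDefs.


(** * Means *)

Section Mean.
Context {d : measure_display} {Omega : measurableType d} {R : realType}.
Context (P : probability Omega R).
Implicit Types (X Y : Omega -> R) (c : R).

Definition mean X : \bar R := (\int[P]_w (X w)%:E)%E.

Lemma mean_ge0 X : (forall w, 0 <= X w) -> (0 <= mean X)%E.
Proof. by move=> X0; apply: integral_ge0 => w _; rewrite lee_fin. Qed.

Lemma mean_cst c : mean (fun=> c) = c%:E.
Proof. by rewrite /mean integral_cst//= probability_setT mule1. Qed.

Lemma eq_mean X Y : (forall w, X w = Y w) -> mean X = mean Y.
Proof. by move=> XY; apply: eq_integral => w _; rewrite XY. Qed.

Lemma le_mean X Y : measurable_fun setT X -> measurable_fun setT Y ->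
  (forall w, 0 <= X w) -> (forall w, X w <= Y w) -> (mean X <= mean Y)%E.
Proof.
move=> mX mY X0 XY; apply: ge0_le_integral => //.
- by move=> w _; rewrite lee_fin.
- exact/measurable_EFinP.
- exact/measurable_EFinP.
- by move=> w _; rewrite lee_fin.
Qed.

Lemma meanD X Y : measurable_fun setT X -> measurable_fun setT Y ->
  (forall w, 0 <= X w) -> (forall w, 0 <= Y w) ->
  mean (fun w => X w + Y w) = (mean X + mean Y)%E.
Proof.
move=> mX mY X0 Y0; rewrite /mean -ge0_integralD//.
- by move=> w _; rewrite lee_fin.
- exact/measurable_EFinP.
- by move=> w _; rewrite lee_fin.
- exact/measurable_EFinP.
Qed.

Lemma meanZ c X : measurable_fun setT X -> (forall w, 0 <= X w) -> 0 <= c ->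
  mean (fun w => c * X w) = (c%:E * mean X)%E.
Proof.
move=> mX X0 c0; rewrite /mean -ge0_integralZl_EFin//.
- by move=> w _; rewrite lee_fin.
- exact/measurable_EFinP.
Qed.

Lemma mean_sum n (F : nat -> Omega -> R) :
  (forall i, measurable_fun setT (F i)) -> (forall i w, 0 <= F i w) ->
  mean (fun w => \sum_(0 <= i < n) F i w) = (\sum_(0 <= i < n) mean (F i))%E.
Proof.
move=> mF F0; rewrite /mean -ge0_integral_sum//.
- by apply: eq_integral => w _; rewrite sumEFin.
- by move=> i; exact/measurable_EFinP.
- by move=> i w _; rewrite lee_fin.
Qed.

Lemma mean_integrable X : measurable_fun setT X ->
  (mean (fun w => `|X w|%R) < +oo)%E -> P.-integrable setT (fun w => (X w)%:E).
Proof. by move=> mX fX; apply/integrableP; split=> //; exact/measurable_EFinP. Qed.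

(** The cross term has mean 0. *)
Lemma mean_sqrD_centered (X : Omega -> R) x V : measurable_fun setT X ->
  mean X = 0%E -> mean (fun w => X w ^+ 2) = V%:E ->
  mean (fun w => (x + X w) ^+ 2) = (x ^+ 2 + V)%:E.
Proof.
move=> mX X0 XV.
have mX2 : measurable_fun setT (fun w => X w ^+ 2) by exact: measurable_funX.
have iX2 : P.-integrable setT (fun w => (X w ^+ 2)%:E).
  apply: mean_integrable => //.
  by under eq_mean do rewrite ger0_norm ?sqr_ge0//; rewrite XV ltry.
have iX : P.-integrable setT (fun w => (X w)%:E).
  apply: mean_integrable => //.
  apply: (@le_lt_trans _ _ (mean (fun w => 1 + X w ^+ 2))).
    apply: le_mean => //; [exact: measurableT_comp|exact: measurable_funD|].
    move=> w; rewrite -[X w ^+ 2]real_normK ?num_real//.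
    by have := sqr_ge0 (`|X w| - 2^-1); nra.
  rewrite meanD//; last by move=> w; exact: sqr_ge0.
  by rewrite mean_cst XV -EFinD ltry.
have -> : (fun w => (x + X w) ^+ 2) =
  (fun w => x ^+ 2 + (2 * x * X w + X w ^+ 2)) by apply/funext => w; ring.
have iZ : P.-integrable setT (fun w => (2 * x * X w)%:E).
  by under eq_fun do rewrite EFinM; exact: integrableZl.
rewrite /mean; under eq_integral do rewrite EFinD.
rewrite integralD//; last 2 first.
- exact: finite_measure_integrable_cst.
- by under eq_fun do rewrite EFinD; exact: integrableD.
under [X in (_ + X)%E]eq_integral do rewrite EFinD.
rewrite integralD//; under [X in (_ + (X + _))%E]eq_integral do rewrite EFinM.
rewrite integralZl//; move: X0 XV; rewrite /mean => -> ->.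
by rewrite mule0 add0e integral_cst//= probability_setT mule1.
Qed.

End Mean.

(** * The convex order *)

Section ConvexOrder.
Context {d : measure_display} {Omega : measurableType d} {R : realType}.
Context (P : probability Omega R).
Implicit Types (X Y Z : Omega -> R) (phi : R -> R) (eps L c : R).

(** The increasing convex order up to an error proportional to the Lipschitz
    constant: with eps = 0 it says that Y is more spread out than X, and it
    also absorbs couplings at L^1-distance at most eps. *)
Definition cx_le eps X Y := forall L phi, convex_lip L phi ->
  (mean P (fun w => phi (X w)) <= mean P (fun w => phi (Y w)) + (L * eps)%:E)%E.

Lemma cx_le_refl X : cx_le 0 X X.
Proof. by move=> L phi _; rewrite mulr0 adde0. Qed.

Lemma cx_le_trans eps eps' X Y Z :
  cx_le eps X Y -> cx_le eps' Y Z -> cx_le (eps + eps') X Z.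
Proof.
move=> XY YZ L phi cphi; apply: le_trans (XY _ _ cphi) _.
rewrite mulrDr EFinD addeA [X in (_ <= X)%E]addeAC leeD2r//; exact: YZ.
Qed.

Lemma cx_le_scale eps X Y c : 0 <= c -> cx_le eps X Y ->
  cx_le (c * eps) (fun w => c * X w) (fun w => c * Y w).
Proof.
move=> c0 XY L phi cphi; rewrite mulrA [L * c]mulrC.
exact: XY (convex_lip_scale c0 cphi).
Qed.

End ConvexOrder.


(** * Measurability and limits *)

Section RealLimits.
Context {d : measure_display} {T : measurableType d} {R : realType}.

(** The Cauchy criterion, with tolerances 1 / (k + 1). *)
Lemma measurable_cvgn (u : nat -> T -> R) :
  (forall n, measurable_fun setT (u n)) -> measurable [set w | cvgn (u ^~ w)].
Proof.
move=> mu; rewrite (_ : [set w | _] = \bigcap_k \bigcup_M \bigcap_n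
    [set w | (n >= M)%N -> `|u n w - u M w| < k.+1%:R^-1]).
  apply: bigcapT_measurable => k; apply: bigcupT_measurable => M.
  apply: bigcapT_measurable => n.
  have [Mn|nM] := leqP M n; last first.
    by rewrite (_ : [set _ | _] = setT)//; apply/seteqP.
  rewrite (_ : [set _ | _] = (fun w => `|u n w - u M w|) @^-1` `]-oo, k.+1%:R^-1[%classic).
    rewrite -[X in measurable X]setTI.
    have m1 : measurable_fun setT (fun w => `|u n w - u M w|).
      by apply: measurableT_comp => //; exact: measurable_funB.
    by apply: m1 => //; exact: measurable_itv.
  by apply/seteqP; split=> w /=; rewrite in_itv/= => h; [exact: h|move=> _].
apply/seteqP; split=> w /=.
  move=> /cvg_ex[l ul] k _.
  have k0 : (0 : R) < k.+1%:R^-1 / 2 by rewrite divr_gt0 ?invr_gt0.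
  move/cvgrPdist_lt: ul => /(_ _ k0)[M _ hM]; exists M => // n _ /= Mn.
  have := hM _ Mn; have := hM _ (leqnn M); rewrite /= => h1 h2.
  rewrite (_ : u n w - u M w = (l - u M w) - (l - u n w)); last by ring.
  apply: le_lt_trans (ler_normB _ _) _.
  by rewrite [X in _ < X](splitr (k.+1%:R^-1 : R)) ltrD.
move=> h; apply/cauchy_cvgP/cauchy_exP => e e0.
have := near_infty_natSinv_lt (PosNum e0) => -[k _ /(_ _ (leqnn k))/= ke].
have [M _ hM] := h k I; exists (u M w), M => // n /= Mn.
by rewrite /ball/= distrC; apply: lt_trans ke; exact: hM.
Qed.

Lemma measurable_limn (u : nat -> T -> R) :
  (forall n, measurable_fun setT (u n)) ->
  measurable_fun setT (fun w => limn (u ^~ w)).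
Proof.
move=> mu.
rewrite (_ : (fun _ => _) = fun w => if `[< cvgn (u ^~ w) >]
   then fine (limn_esup (fun n => (u n w)%:E)) else 0).
  apply: measurable_fun_ifT => //.
    apply: (measurable_fun_bool true); rewrite setTI.
    rewrite (_ : _ @^-1` _ = [set w | cvgn (u ^~ w)]); first exact: measurable_cvgn.
    by apply/seteqP; split=> w /= /asboolP.
  apply: measurableT_comp => //; apply: measurable_fun_limn_esup => n.
  exact/measurable_EFinP.
apply/funext => w; case: asboolP => [cu|]; last exact: dvgP.
have cE : (u n w)%:E @[n --> \oo] --> (limn (u ^~ w))%:E.
  by apply: cvg_EFin => //; exact: nearW.
rewrite is_cvg_limn_esupE; last by apply/cvg_ex; eexists; exact: cE.
by rewrite (cvg_lim _ cE).
Qed.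

Lemma convex_lip_cvg L (phi : R -> R) (u : nat -> R) l : convex_lip L phi ->
  (forall n, 0 <= u n) -> u n @[n --> \oo] --> l -> phi (u n) @[n --> \oo] --> phi l.
Proof.
move=> cphi u0 ul.
have l0 : 0 <= l by apply: (cvgr_to_ge ul); exact: nearW.
have L0 := convex_lip_ge0 cphi.
apply/cvgrPdist_le => e e0.
have e1 : 0 < e / (L + 1) by rewrite divr_gt0// ltr_wpDl.
move/cvgrPdist_le : ul => /(_ _ e1); apply: filterS => n.
rewrite ler_pdivlMr ?ltr_wpDl// => h.
have h1 := convex_lip_lip cphi l0 (u0 n).
have := convex_lip_lip cphi (u0 n) l0; rewrite distrC => h2.
have h3 : L * `|l - u n| <= e.
  by apply: le_trans h; rewrite mulrDr mulr1 mulrC lerDl.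
by rewrite ler_distl; apply/andP; split; lra.
Qed.

Lemma measurable_powR_trunc p L (X : T -> R) : measurable_fun setT X ->
  measurable_fun setT (fun w => powR_trunc p L (X w)).
Proof.
move=> mX.
have mN : measurable_fun setT (fun w => `|X w|) by exact: measurableT_comp.
have mm : measurable_fun setT (fun w => Num.min `|X w| L : R).
  exact: measurable_minr.
have mpow q : measurable_fun setT (fun w => (Num.min `|X w| L) `^ q : R).
  exact: (measurableT_comp (measurable_powR q) mm).
apply: measurable_funD; first exact: mpow.
apply: measurable_funM; last exact: measurable_funB.
by apply: measurable_funM => //; exact: mpow.
Qed.

Lemma mean_powR_trunc_cvg (P : probability T R) p (X : T -> R) : 1 < p ->
  measurable_fun setT X -> (forall w, 0 <= X w) ->
  mean P (fun w => powR_trunc p n%:R (X w)) @[n --> \oo] -->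
  mean P (fun w => X w `^ p).
Proof.
move=> p1 mX X0; have pe n := convex_lip_powR_trunc p1 (ler0n R n).
have mphi n := measurable_powR_trunc p n%:R mX.
have lim w : limn (fun n => (powR_trunc p n%:R (X w))%:E) = (X w `^ p)%:E.
  apply/cvg_lim => //; apply: cvg_near_cst.
  exists (Num.bound (X w)) => // n /= Xn; congr (_%:E).
  apply: powR_trunc_small => //; apply: ltW.
  apply: lt_le_trans (archi_boundP (X0 w)) _.
  by rewrite ler_nat.
rewrite (_ : mean P (fun w => X w `^ p) = (\int[P]_w
    limn (fun n => (powR_trunc p n%:R (X w))%:E))%E); last first.
  by apply: eq_integral => w _; rewrite lim.
apply: cvg_monotone_convergence => //.
- by move=> n; exact/measurable_EFinP.
- by move=> n w _; rewrite lee_fin; have [h _] := pe n; exact: h.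
- move=> w _ n k nk; rewrite lee_fin.
  by apply: powR_trunc_homo => //; rewrite ler_nat.
Qed.

End RealLimits.
Section Branching.
Context {R : realType} {mu : probability nat R}.
Context {d : measure_display} {Omega : measurableType d}.
Context {P : probability Omega R} {N : seq nat -> {RV P >-> nat}}.
Hypothesis N_GW : galton_watson mu N.
Implicit Types (A : seq nat -> Omega -> R) (u v : seq nat) (phi : R -> R).

Local Notation tree_var := (tree_var N).
Local Notation child_sum := (child_sum N).

Lemma tree_var_comp phi A : tree_var A -> tree_var (fun u w => phi (A u w)).
Proof. by move=> [h [f Af]]; exists h, (phi \o f) => u w; rewrite /= Af. Qed.

Lemma tree_var_cst (c : R) : tree_var (fun _ _ => c).
Proof. by exists 0%N, (fun=> c). Qed.

Lemma tree_var_child_sum A : tree_var A -> tree_var (child_sum A).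
Proof.
move=> [h [f Af]]; exists h.+1.
exists (fun c => \sum_(k <- odflt [::] (choice.unpickle c)) f k) => u w.
rewrite -[code _ _ _ _]/(choice.pickle _) choice.pickleK [odflt _ _]/= big_map.
by rewrite /child_sum /index_iota subn0; apply: eq_bigr => i _; rewrite Af.
Qed.

Lemma child_sum_cst (c : R) u w : child_sum (fun _ _ => c) u w = c *+ N u w.
Proof. by rewrite /child_sum big_const_nat iter_addr_0 subn0. Qed.

Lemma measurable_code h u k : measurable (code N h u @^-1` [set k]).
Proof. exact: (local_family_measurable _ _ (local_family_code N h)). Qed.

Lemma tree_var_measurable A u : tree_var A -> measurable_fun setT (A u).
Proof.
move=> [h [f Af]]; rewrite (_ : A u = fun w => f (code N h u w)).
  by apply: measurable_of_fibres => k; exact: measurable_code.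
by apply/funext => w; rewrite Af.
Qed.

Lemma tree_var_law A phi u v : tree_var A -> (forall x, 0 <= phi x) ->
  (\int[P]_w (phi (A u w))%:E = \int[P]_w (phi (A v w))%:E)%E.
Proof.
move=> [h [f Af]] phi0.
have E x : (\int[P]_w (phi (A x w))%:E =
    \sum_(k <oo) (phi (f k))%:E * P (code N h x @^-1` [set k]))%E.
  rewrite (eq_integral (fun w => (phi (f (code N h x w)))%:E)); last first.
    by move=> w _; rewrite Af.
  rewrite (integral_fun_fibres P (G := fun k => phi (f k)))//.
    by apply: eq_eseriesr => k _; rewrite setTI.
  exact: measurable_code.
rewrite !E; apply: eq_eseriesr => k _; congr (_ * _)%E.
exact: (local_family_law N_GW _ _ _ (local_family_code N h)).
Qed.

Let childcode h n u w :=
  choice.pickle [seq code N h (rcons u j) w | j <- iota 0 n].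

Let local_childcode h n : local_family N (below_child 0 n) (childcode h n).
Proof.
apply: local_family_inj; first exact: (pcan_inj choice.pickleK).
exact: (local_family_children (local_family_code N h)).
Qed.

Let sum_of_code (f : nat -> R) (c : nat) : R :=
  \sum_(k <- odflt [::] (choice.unpickle c)) f k.

Let sum_of_childcode h f n u w : sum_of_code f (childcode h n u w) =
  \sum_(0 <= j < n) f (code N h (rcons u j) w).
Proof.
by rewrite /sum_of_code choice.pickleK [odflt _ _]/= big_map /index_iota subn0.
Qed.

(** The number of children of u is independent of the subtrees above them. *)
Lemma child_sum_fubini A phi u : tree_var A -> (forall x, 0 <= phi x) ->
  (\int[P]_w (phi (child_sum A u w))%:E =
   \int[P]_w \int[P]_w' (phi (\sum_(0 <= i < N u w) A (rcons u i) w'))%:E)%E.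
Proof.
move=> tA phi0; have [h [f Af]] := tA.
have mN k : measurable (N u @^-1` [set k]).
  exact: (local_family_measurable _ _ (local_family_offspring N)).
have E n w : \sum_(0 <= i < n) A (rcons u i) w = sum_of_code f (childcode h n u w).
  by rewrite sum_of_childcode; apply: eq_bigr => i _; rewrite Af.
rewrite (integral_fibres P
  (H := fun n w => (phi (\sum_(0 <= i < n) A (rcons u i) w))%:E))//.
- rewrite (integral_fibres P (H := fun n _ =>
    \int[P]_w' (phi (\sum_(0 <= i < n) A (rcons u i) w'))%:E)%E)//.
  + apply: eq_eseriesr => n _; rewrite integral_cst//.
    have -> : (fun w => (phi (\sum_(0 <= i < n) A (rcons u i) w))%:E) =
      (fun w => (phi (sum_of_code f (childcode h n u w)))%:E).
      by apply/funext => w; rewrite E.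
    apply: (integral_indep_fibre (G := fun c => phi (sum_of_code f c))) => // k.
    * exact: (local_family_measurable _ _ (local_childcode h n)).
    * apply: (local_family_indep N_GW _ _ _ _ (local_family_offspring N)
        (local_childcode h n)).
      by move=> v /eqP ->.
  + by move=> k w; apply: integral_ge0 => w' _; rewrite lee_fin.
  + exact: (measurable_of_fibres (fun n =>
      \int[P]_w' (phi (\sum_(0 <= i < n) A (rcons u i) w'))%:E)%E).
- by move=> k w; rewrite lee_fin.
- apply/measurable_EFinP.
  have tS := tree_var_comp phi (tree_var_child_sum tA).
  exact: (tree_var_measurable u tS).
Qed.

(** The subtree above a child is independent of those above the previous
    ones. *)
Lemma sibling_fubini A (psi : R -> R -> R) n u : tree_var A ->
  (forall x y, 0 <= psi x y) ->
  (\int[P]_w (psi (\sum_(0 <= i < n) A (rcons u i) w) (A (rcons u n) w))%:E =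
   \int[P]_w \int[P]_w'
     (psi (\sum_(0 <= i < n) A (rcons u i) w) (A (rcons u n) w'))%:E)%E.
Proof.
move=> [h [f Af]] psi0.
have E w : \sum_(0 <= i < n) A (rcons u i) w = sum_of_code f (childcode h n u w).
  by rewrite sum_of_childcode; apply: eq_bigr => i _; rewrite Af.
have -> : (fun w => (psi (\sum_(0 <= i < n) A (rcons u i) w)
    (A (rcons u n) w))%:E) =
  (fun w => (psi (sum_of_code f (childcode h n u w))
    (f (code N h (rcons u n) w)))%:E) by apply/funext => w; rewrite E Af.
have -> : (fun w => \int[P]_w' (psi (\sum_(0 <= i < n) A (rcons u i) w)
    (A (rcons u n) w'))%:E)%E =
  (fun w => \int[P]_w' (psi (sum_of_code f (childcode h n u w))
    (f (code N h (rcons u n) w')))%:E)%E.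
  by apply/funext => w; apply: eq_integral => w' _; rewrite E Af.
apply: (integral_indep_pair (f := childcode h n u)
  (f' := code N h (rcons u n)) (F := fun c k => psi (sum_of_code f c) (f k))) => //.
- by move=> k; exact: (local_family_measurable _ _ (local_childcode h n)).
- by move=> k; exact: measurable_code.
move=> k l; apply: (local_family_indep N_GW _ _ _ _ (local_childcode h n)
    (local_family_child n (local_family_code N h))).
move=> [|i v]//= /andP[_ iltn]; apply/negP => /andP[/eqP e _].
by rewrite e add0n ltnn in iltn.
Qed.

Lemma sibling_sum_measurable A phi n u : tree_var A ->
  measurable_fun setT (fun w => phi (\sum_(0 <= i < n) A (rcons u i) w)).
Proof.
move=> [h [f Af]].
rewrite (_ : (fun _ => _) = fun w => phi (sum_of_code f (childcode h n u w))).
  apply: (measurable_of_fibres (fun c => phi (sum_of_code f c))) => k.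
  exact: (local_family_measurable _ _ (local_childcode h n)).
apply/funext => w; rewrite sum_of_childcode; congr phi.
by apply: eq_bigr => i _; rewrite Af.
Qed.

Lemma sibling_swap A A' (psi : R -> R -> R) n u v : tree_var A -> tree_var A' ->
  (forall x y, 0 <= psi x y) ->
  (\int[P]_w \int[P]_w' (psi (\sum_(0 <= i < n) A (rcons u i) w) (A' v w'))%:E =
   \int[P]_w' \int[P]_w (psi (\sum_(0 <= i < n) A (rcons u i) w) (A' v w'))%:E)%E.
Proof.
move=> [h [f Af]] [h' [f' Af']] psi0.
have E w w' : (psi (\sum_(0 <= i < n) A (rcons u i) w) (A' v w'))%:E =
    (psi (sum_of_code f (childcode h n u w)) (f' (code N h' v w')))%:E.
  rewrite sum_of_childcode Af'; congr (psi _ _)%:E.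
  by apply: eq_bigr => i _; rewrite Af.
transitivity (\int[P]_w \int[P]_w'
    (psi (sum_of_code f (childcode h n u w)) (f' (code N h' v w')))%:E)%E.
  by apply: eq_integral => w _; apply: eq_integral => w' _.
have mf k : measurable (childcode h n u @^-1` [set k]).
  exact: (local_family_measurable _ _ (local_childcode h n)).
have mf' k : measurable (code N h' v @^-1` [set k]) by exact: measurable_code.
apply: (etrans (integral_swap P mf mf'
  (F := fun c k => psi (sum_of_code f c) (f' k)) (fun _ _ => psi0 _ _))).
by apply: eq_integral => w _; apply: eq_integral => w' _.
Qed.

Lemma measurable_sibling_section A A' (psi : R -> R -> R) n u v :
  tree_var A -> tree_var A' ->
  measurable_fun setT (fun w =>
    \int[P]_w' (psi (\sum_(0 <= i < n) A (rcons u i) w) (A' v w'))%:E)%E.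
Proof.
move=> [h [f Af]] tA'.
rewrite (_ : (fun _ => _) = fun w =>
  \int[P]_w' (psi (sum_of_code f (childcode h n u w)) (A' v w'))%:E)%E.
  apply: (measurable_of_fibres (fun c =>
    \int[P]_w' (psi (sum_of_code f c) (A' v w'))%:E)%E) => k.
  exact: (local_family_measurable _ _ (local_childcode h n)).
apply/funext => w; rewrite sum_of_childcode; apply: eq_integral => w' _.
by congr (psi _ _)%:E; apply: eq_bigr => i _; rewrite Af.
Qed.

Lemma measurable_sibling_section2 A A' (psi : R -> R -> R) n u v :
  tree_var A -> tree_var A' ->
  measurable_fun setT (fun w' =>
    \int[P]_w (psi (\sum_(0 <= i < n) A (rcons u i) w) (A' v w'))%:E)%E.
Proof.
move=> tA [h [f Af]].
rewrite (_ : (fun _ => _) = fun w' =>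
  \int[P]_w (psi (\sum_(0 <= i < n) A (rcons u i) w) (f (code N h v w')))%:E)%E.
  apply: (measurable_of_fibres (fun c =>
    \int[P]_w (psi (\sum_(0 <= i < n) A (rcons u i) w) (f c))%:E)%E) => k.
  exact: measurable_code.
by apply/funext => w'; rewrite Af.
Qed.

(** * The sum over the children *)

Context {m : R}.
Hypothesis mE : offspring_mean mu = m%:E.
Implicit Types (D : seq nat -> Omega -> R).

Lemma offspring_integral u (F : nat -> \bar R) : (forall k, 0 <= F k)%E ->
  (\int[P]_w F (N u w) = \int[mu]_k F k)%E.
Proof.
move=> F0; rewrite -(ge0_integral_distribution (N u) (f := F))//.
by have [_ law] := N_GW; apply: eq_measure_integral => A _ _; exact: law.
Qed.

Lemma offspring_mean_integral u : (\int[P]_w (N u w)%:R%:E = m%:E)%E.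
Proof.
by rewrite (offspring_integral u (F := fun k => k%:R%:E)).
Qed.

Lemma offspring_mean_ge0 : 0 <= m.
Proof.
rewrite -lee_fin -(offspring_mean_integral [::]).
by apply: integral_ge0 => w _; rewrite lee_fin.
Qed.

Lemma measurable_offspring u : measurable_fun setT (fun w => (N u w)%:R : R).
Proof.
apply: (measurable_of_fibres (fun k => k%:R : R)) => k.
exact: (local_family_measurable _ _ (local_family_offspring N)).
Qed.

Lemma mean_law A phi u v : tree_var A -> (forall x, 0 <= phi x) ->
  mean P (fun w => phi (A u w)) = mean P (fun w => phi (A v w)).
Proof. by move=> tA phi0; exact: (tree_var_law u v tA phi0). Qed.

Lemma mean_law_ge0 A u v : tree_var A -> (forall u w, 0 <= A u w) ->
  mean P (A u) = mean P (A v).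
Proof.
move=> tA A0.
have norm x : mean P (A x) = mean P (fun w => `|A x w|).
  by apply: eq_mean => w; rewrite ger0_norm.
rewrite !norm; exact: (mean_law (phi := fun x => `|x|)).
Qed.

Lemma child_sum_ge0 A u w : (forall u w, 0 <= A u w) -> 0 <= child_sum A u w.
Proof. by move=> A0; apply: sumr_ge0. Qed.

Lemma mean_sibling_sum A u v n : tree_var A -> (forall u w, 0 <= A u w) ->
  mean P (fun w => \sum_(0 <= i < n) A (rcons u i) w) = (n%:R%:E * mean P (A v))%E.
Proof.
move=> tA A0; rewrite mean_sum//; last by move=> i; exact: (tree_var_measurable (rcons u i) tA).
rewrite (eq_bigr (fun=> mean P (A v))); last by move=> i _; exact: (mean_law_ge0 _ _ tA A0).
elim: n => [|n IH]; first by rewrite big_nil mul0e.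
rewrite big_nat_recr//= IH -natr1 EFinD ge0_muleDl ?lee_fin//.
by rewrite mul1e.
Qed.

(** Wald's identity. *)
Lemma mean_child_sum A u v : tree_var A -> (forall u w, 0 <= A u w) ->
  mean P (child_sum A u) = (m%:E * mean P (A v))%E.
Proof.
move=> tA A0.
rewrite (eq_mean P (Y := fun w => `|child_sum A u w|)); last first.
  by move=> w; rewrite ger0_norm// child_sum_ge0.
rewrite [LHS](child_sum_fubini (phi := fun x => `|x|) u tA (fun x => normr_ge0 x)).
rewrite -(offspring_mean_integral u) -ge0_integralZr//; last 2 first.
- exact/measurable_EFinP/measurable_offspring.
- exact: mean_ge0.
apply: eq_integral => w _; rewrite -(mean_sibling_sum u)//.
by apply: eq_integral => w' _; rewrite ger0_norm// sumr_ge0.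
Qed.

(** Induction on n: by independence the last summand can be replaced with the
    others frozen, and then the others with the last one frozen. *)
Lemma cx_le_siblings eps A A' u n L phi : 0 <= eps ->
  tree_var A -> tree_var A' ->
  (forall u w, 0 <= A u w) -> (forall u w, 0 <= A' u w) ->
  cx_le P eps (A [::]) (A' [::]) -> convex_lip L phi ->
  (mean P (fun w => phi (\sum_(0 <= i < n) A (rcons u i) w)%R) <=
   mean P (fun w => phi (\sum_(0 <= i < n) A' (rcons u i) w)%R) +
     (n%:R * (L * eps))%:E)%E.
Proof.
move=> e0 tA tA' A0 A'0 AA'; elim: n L phi => [|n IH] L phi cphi.
  under eq_mean do rewrite big_nil.
  under [X in (_ <= X + _)%E]eq_mean do rewrite big_nil.
  by rewrite mul0r adde0.
have [phi0 _] := cphi; have L0 := convex_lip_ge0 cphi.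
have split1 B : tree_var B ->
  mean P (fun w => phi (\sum_(0 <= i < n.+1) B (rcons u i) w)%R) =
  (\int[P]_w mean P (fun w' => phi (\sum_(0 <= i < n) B (rcons u i) w +
     B [::] w')%R))%E.
  move=> tB; under eq_mean do rewrite big_nat_recr//=.
  apply: (etrans (sibling_fubini n u tB (fun x y => phi0 (x + y)))).
  apply: eq_integral => w _.
  exact: (mean_law (phi := fun y => phi (_ + y))).
have add_cst (F : Omega -> \bar R) c : 0 <= c -> measurable_fun setT F ->
    (forall w, 0 <= F w)%E ->
    (\int[P]_w (F w + c%:E) = \int[P]_w F w + c%:E)%E.
  move=> c0 mF F0; rewrite ge0_integralD//.
  by rewrite integral_cst//= probability_setT mule1.
have meas B B' (tB : tree_var B) (tB' : tree_var B') :
    measurable_fun setT (fun w => mean P (fun w' =>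
      phi (\sum_(0 <= i < n) B (rcons u i) w + B' [::] w')%R)).
  exact: (measurable_sibling_section (fun x y => phi (x + y)) n u [::] tB tB').
have meas2 B B' (tB : tree_var B) (tB' : tree_var B') :
    measurable_fun setT (fun w' => mean P (fun w =>
      phi (\sum_(0 <= i < n) B (rcons u i) w + B' [::] w')%R)).
  exact: (measurable_sibling_section2 (fun x y => phi (x + y)) n u [::] tB tB').
have swap B B' (tB : tree_var B) (tB' : tree_var B') :=
  sibling_swap (psi := fun x y => phi (x + y)) n u [::] tB tB' (fun x y => phi0 (x + y)).
have LE : 0 <= L * eps by exact: mulr_ge0.
rewrite !split1// (_ : n.+1%:R * (L * eps) = n%:R * (L * eps) + L * eps); last first.
  by rewrite -natr1 mulrDl mul1r.
apply: (@le_trans _ _ (\int[P]_w (mean P (fun w' =>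
    phi (\sum_(0 <= i < n) A (rcons u i) w + A' [::] w')%R) + (L * eps)%:E))%E).
  apply: ge0_le_integral => //.
  - by move=> w _; exact: mean_ge0.
  - exact: (meas A A tA tA).
  - by apply: emeasurable_funD => //; exact: (meas A A' tA tA').
  - move=> w _; apply: (AA' L (fun y => phi (\sum_(0 <= i < n) A (rcons u i) w + y))).
    by apply: convex_lip_shift => //; exact: sumr_ge0.
rewrite add_cst//; [|exact: (meas A A' tA tA')|by move=> w; exact: mean_ge0].
rewrite EFinD addeA leeD2r// [leLHS]swap// [X in (_ <= X + _)%E]swap//.
rewrite -add_cst//; last 3 first.
- by rewrite mulr_ge0.
- exact: (meas2 A' A' tA' tA').
- by move=> w; exact: mean_ge0.
apply: ge0_le_integral => //.
- by move=> w _; exact: mean_ge0.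
- exact: (meas2 A A' tA tA').
- by apply: emeasurable_funD => //; exact: (meas2 A' A' tA' tA').
move=> w _; apply: (IH L (fun x => phi (x + A' [::] w))).
under eq_fun do rewrite addrC.
exact: convex_lip_shift.
Qed.

(** The sum over the children respects the order: given the number of children,
    replace the summands one after the other. *)
Lemma cx_le_child_sum eps A A' u : 0 <= eps -> tree_var A -> tree_var A' ->
  (forall u w, 0 <= A u w) -> (forall u w, 0 <= A' u w) ->
  cx_le P eps (A [::]) (A' [::]) ->
  cx_le P (m * eps) (child_sum A u) (child_sum A' u).
Proof.
move=> e0 tA tA' A0 A'0 AA' L phi cphi; have [phi0 _] := cphi.
rewrite [leLHS](child_sum_fubini u tA phi0).
rewrite [X in (_ <= X + _)%E](child_sum_fubini u tA' phi0).
have L0 := convex_lip_ge0 cphi.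
have mNF (F : nat -> \bar R) : measurable_fun setT (fun w => F (N u w)).
  apply: measurable_of_fibres => k.
  exact: (local_family_measurable _ _ (local_family_offspring N)).
have -> : (L * (m * eps))%:E = (\int[P]_w ((N u w)%:R * (L * eps))%:E)%E.
  under eq_integral do rewrite EFinM.
  rewrite ge0_integralZr//.
  - by rewrite offspring_mean_integral -EFinM mulrCA.
  - exact: (mNF (fun k => k%:R%:E)).
  - by rewrite lee_fin mulr_ge0.
rewrite -ge0_integralD//; last 4 first.
- by move=> w _; exact: mean_ge0.
- exact: (mNF (fun n => mean P (fun w' => phi (\sum_(0 <= i < n) A' (rcons u i) w')%R))).
- by move=> w _; rewrite lee_fin !mulr_ge0.
- exact: (mNF (fun n => (n%:R * (L * eps))%:E)).
apply: ge0_le_integral => //.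
- by move=> w _; exact: mean_ge0.
- exact: (mNF (fun n => mean P (fun w' => phi (\sum_(0 <= i < n) A (rcons u i) w')%R))).
- exact: (mNF (fun n => mean P (fun w' => phi (\sum_(0 <= i < n) A' (rcons u i) w')%R)
    + (n%:R * (L * eps))%:E)%E).
by move=> w _; exact: (cx_le_siblings u (N u w) e0 tA tA' A0 A'0 AA' cphi).
Qed.

(** * Moments of the sum over the children *)

Lemma child_sumD A A' u w : child_sum (fun u w => A u w + A' u w) u w =
  child_sum A u w + child_sum A' u w.
Proof. exact: big_split. Qed.

Lemma child_sumZ c A u w : child_sum (fun u w => c * A u w) u w =
  c * child_sum A u w.
Proof. by rewrite /child_sum mulr_sumr. Qed.

Lemma ler_norm_child_sum A u w :
  `|child_sum A u w| <= child_sum (fun u w => `|A u w|) u w.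
Proof. exact: ler_norm_sum. Qed.

(** Variances of independent centered summands add up. *)
Lemma mean_sqr_siblings D V u n : tree_var D ->
  mean P (D [::]) = 0%E -> mean P (fun w => D [::] w ^+ 2) = V%:E ->
  mean P (fun w => (\sum_(0 <= i < n) D (rcons u i) w) ^+ 2) = (n%:R * V)%:E.
Proof.
move=> tD D0 DV.
have V0 : 0 <= V by rewrite -lee_fin -DV; apply: mean_ge0 => w; exact: sqr_ge0.
elim: n => [|n IH].
  by under eq_mean do rewrite big_nil expr0n; rewrite mean_cst mul0r.
under eq_mean do rewrite big_nat_recr//=.
rewrite [LHS](sibling_fubini (psi := fun x y => (x + y) ^+ 2) n u tD); last first.
  by move=> x y; exact: sqr_ge0.
transitivity (mean P (fun w => (\sum_(0 <= i < n) D (rcons u i) w) ^+ 2 + V)).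
  apply: eq_integral => w _; rewrite -(mean_sqrD_centered _ (tree_var_measurable [::] tD) D0 DV).
  apply: (mean_law (phi := fun y => (_ + y) ^+ 2)) => // x.
  exact: sqr_ge0.
rewrite meanD//; last 2 first.
- exact: (sibling_sum_measurable (fun x => x ^+ 2) n u tD).
- by move=> w; exact: sqr_ge0.
by rewrite mean_cst IH -natr1 -EFinD mulrDl mul1r.
Qed.

Lemma mean_sqr_child_sum D V u : tree_var D ->
  mean P (D [::]) = 0%E -> mean P (fun w => D [::] w ^+ 2) = V%:E ->
  mean P (fun w => child_sum D u w ^+ 2) = (m * V)%:E.
Proof.
move=> tD D0 DV.
have V0 : 0 <= V by rewrite -lee_fin -DV; apply: mean_ge0 => w; exact: sqr_ge0.
rewrite [LHS](child_sum_fubini (phi := fun x => x ^+ 2) u tD); last first.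
  by move=> x; exact: sqr_ge0.
transitivity (\int[P]_w ((N u w)%:R%:E * V%:E))%E.
  by apply: eq_integral => w _; exact: (mean_sqr_siblings u (N u w) tD D0 DV).
rewrite ge0_integralZr//.
- by rewrite offspring_mean_integral.
- exact/measurable_EFinP/measurable_offspring.
Qed.

(** Wald's identity for the nonnegative variables D + |D| and |D|, whose means
    agree. *)
Lemma mean_child_sum_centered D u v : tree_var D ->
  (mean P (fun w => `|D v w|%R) < +oo)%E -> mean P (D v) = 0%E ->
  mean P (child_sum D u) = 0%E.
Proof.
move=> tD fD D0.
have tN : tree_var (fun u w => `|D u w|) := tree_var_comp (fun x => `|x|) tD.
have tS : tree_var (fun u w => D u w + `|D u w|) :=
  tree_var_comp (fun x => x + `|x|) tD.
have S0 u' w : 0 <= D u' w + `|D u' w|.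
  by have := ler_norm (- D u' w); rewrite normrN; lra.
have iN : P.-integrable setT (fun w => (child_sum (fun u w => `|D u w|) u w)%:E).
  apply: mean_integrable; first exact: (tree_var_measurable u (tree_var_child_sum tN)).
  under eq_mean do rewrite ger0_norm ?child_sum_ge0//.
  by rewrite (mean_child_sum u v)// lte_mul_pinfty// lee_fin offspring_mean_ge0.
have iND : P.-integrable setT (fun w => (child_sum D u w)%:E).
  apply: (le_integrable _ _ _ iN) => //.
    exact/measurable_EFinP/(tree_var_measurable u (tree_var_child_sum tD)).
  move=> w _; rewrite !abse_EFin lee_fin.
  rewrite [X in _ <= X]ger0_norm ?child_sum_ge0//; exact: ler_norm_child_sum.
have iD : P.-integrable setT (fun w => (D v w)%:E).
  by apply: mean_integrable => //; exact: (tree_var_measurable v tD).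
have iDN : P.-integrable setT (fun w => `|D v w|%:E).
  apply: mean_integrable; first exact: (tree_var_measurable v tN).
  by under eq_mean do rewrite normr_id.
have E1 : mean P (fun w => D v w + `|D v w|) = mean P (fun w => `|D v w|).
  rewrite /mean; under eq_integral do rewrite EFinD.
  by rewrite integralD//; move: D0; rewrite /mean => ->; rewrite add0e.
have E2 : mean P (child_sum (fun u w => D u w + `|D u w|) u) =
  (mean P (child_sum D u) + mean P (child_sum (fun u w => `|D u w|%R) u))%E.
  rewrite /mean; under eq_integral do rewrite child_sumD EFinD.
  by rewrite integralD.
have fin : mean P (child_sum (fun u w => `|D u w|%R) u) \is a fin_num.
  exact: integral_fune_fin_num.
have W1 : mean P (child_sum (fun u w => D u w + `|D u w|) u) =
  mean P (child_sum (fun u w => `|D u w|) u).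
  have -> := mean_child_sum u v tS S0.
  have -> := mean_child_sum u v tN (fun u w => normr_ge0 _).
  by congr (_ * _)%E; exact: E1.
by rewrite -[LHS](addeK _ fin) -E2 W1 subee.
Qed.

(** Jensen's inequality: add up the tangents at the arithmetic mean. *)
Lemma power_mean_le p n (a : nat -> R) : 1 < p -> (forall i, 0 <= a i) ->
  (\sum_(0 <= i < n) a i) `^ p <= n%:R `^ (p - 1) * \sum_(0 <= i < n) a i `^ p.
Proof.
move=> p1 a0; have p0 : 0 < p by lra.
case: n => [|n]; first by rewrite !big_nil powR0 ?gt_eqF// mulr0.
set S := \sum_(0 <= i < n.+1) a i; set b := S / n.+1%:R.
have S0 : 0 <= S by exact: sumr_ge0.
have b0 : 0 <= b by exact: divr_ge0.
have SE : S = n.+1%:R * b by rewrite mulrC divfK// pnatr_eq0.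
have h : n.+1%:R * b `^ p <= \sum_(0 <= i < n.+1) a i `^ p.
  apply: (@le_trans _ _ (\sum_(0 <= i < n.+1) (b `^ p + p * b `^ (p - 1) * (a i - b)))).
    rewrite big_split/= -mulr_sumr sumrB -/S !sumr_const_nat subn0 SE.
    by rewrite !mulr_natl subrr mulr0 addr0.
  by apply: ler_sum => i _; exact: powR_tangent_le.
rewrite SE powRM//.
have -> : n.+1%:R `^ p = n.+1%:R `^ (p - 1) * n.+1%:R :> R.
  by rewrite mulrC mulr_powRB1.
by rewrite -mulrA ler_wpM2l ?powR_ge0.
Qed.

Section PowerMoment.
Context (p M : R) (A : seq nat -> Omega -> R).
Hypotheses (p_gt1 : 1 < p) (tA : tree_var A) (A_ge0 : forall u w, 0 <= A u w).
Hypothesis A_mean : mean P (A [::]) = 1%E.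
Hypothesis A_moment : (mean P (fun w => (A [::] w `^ p)%R) <= M%:E)%E.

Let M_ge0 : 0 <= M.
Proof.
rewrite -lee_fin; apply: le_trans A_moment.
by apply: mean_ge0 => w; exact: powR_ge0.
Qed.

Lemma mean_powR_pred_siblings dlt C u n : 0 < dlt -> 0 <= C ->
  (forall a, 0 <= a -> a `^ (p - 1) <= dlt * a `^ p + C) ->
  (mean P (fun w => ((\sum_(0 <= i < n) A (rcons u i) w) `^ (p - 1))%R) <=
    (n%:R `^ (p - 1) * (dlt * M + C))%R%:E)%E.
Proof.
move=> d0 C0 hC; have q0 : 0 < p - 1 by rewrite subr_gt0.
have p0 : 0 < p := lt_trans ltr01 p_gt1.
case: n => [|n].
  under eq_mean do rewrite big_nil powR0 ?gt_eqF//.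
  by rewrite mean_cst lee_fin mulr_ge0 ?powR_ge0// addr_ge0// mulr_ge0// ltW.
pose c : R := n.+1%:R `^ (p - 1).
have tAp : tree_var (fun u w => A u w `^ p) := tree_var_comp (fun x => x `^ p) tA.
have n0 : (0 : R) < n.+1%:R by [].
have mS : measurable_fun setT (fun w => \sum_(0 <= i < n.+1) A (rcons u i) w `^ p).
  exact: (sibling_sum_measurable (fun x => x) n.+1 u tAp).
pose T w := \sum_(0 <= i < n.+1) A (rcons u i) w `^ p.
have T0 w : 0 <= T w by apply: sumr_ge0 => i _; exact: powR_ge0.
pose Q w := (dlt / n.+1%:R) * T w.
have dn0 : 0 <= dlt / n.+1%:R by rewrite divr_ge0// ltW.
have Q0 w : 0 <= Q w by exact: mulr_ge0.
have mQ : measurable_fun setT Q by exact: measurable_funM.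
pose QC w := Q w + C.
have mQC : measurable_fun setT QC by exact: measurable_funD.
apply: (@le_trans _ _ (mean P (fun w => (c * QC w)%R))).
  apply: le_mean.
  - exact: (sibling_sum_measurable (fun x => x `^ (p - 1)) n.+1 u tA).
  - exact: measurable_funM.
  - by move=> w; exact: powR_ge0.
  move=> w; set S := \sum_(0 <= i < n.+1) A (rcons u i) w.
  have S0 : 0 <= S by exact: sumr_ge0.
  have b0 : 0 <= S / n.+1%:R by exact: divr_ge0.
  have SE : S = n.+1%:R * (S / n.+1%:R) by rewrite mulrC divfK// gt_eqF.
  rewrite [in leLHS]SE powRM// ler_wpM2l ?powR_ge0//.
  apply: le_trans (hC _ b0) _; rewrite /QC lerD2r /Q -mulrA (ler_wpM2l (ltW d0))//.
  have h := power_mean_le n.+1 p_gt1 (fun i => A_ge0 (rcons u i) w).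
  rewrite powRM ?invr_ge0 ?(ltW n0)//.
  apply: le_trans (ler_wpM2r (powR_ge0 _ _) h) _.
  have cE : n.+1%:R `^ (p - 1) * n.+1%:R^-1 `^ p = n.+1%:R^-1 :> R.
    rewrite -powR_inv1 ?(ltW n0)// -powRrM mulN1r -powRD; last first.
      by rewrite pnatr_eq0 implybT.
    by congr (_ `^ _); lra.
  by rewrite mulrAC cE.
rewrite (meanZ P mQC) ?powR_ge0//; last by move=> w; exact: addr_ge0.
rewrite EFinM lee_wpmul2l ?lee_fin ?powR_ge0//.
rewrite (meanD P mQ) ?mean_cst// EFinD leeD2r// (meanZ P mS)//.
rewrite (mean_sibling_sum u [::] n.+1 tAp); last by move=> *; exact: powR_ge0.
by rewrite muleA -EFinM divfK ?gt_eqF// EFinM lee_wpmul2l ?lee_fin ?(ltW d0).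
Qed.

(** Induction on n with the inequality for (x + y)^p: the new summand is independent
    of the previous ones and has mean 1, so that the cross term contributes a
    moment of order p - 1 only. *)
Lemma mean_powR_siblings eps dlt C C' u n : 0 < eps -> 0 < dlt -> 0 <= C ->
  0 <= C' ->
  (forall x y, 0 <= x -> 0 <= y ->
    (x + y) `^ p <= x `^ p + (1 + eps) * y `^ p + C * (x `^ (p - 1) * y)) ->
  (forall a, 0 <= a -> a `^ (p - 1) <= dlt * a `^ p + C') ->
  (mean P (fun w => ((\sum_(0 <= i < n) A (rcons u i) w) `^ p)%R) <=
    (n%:R * ((1 + eps) * M) + n%:R `^ p * (C * (dlt * M + C')))%R%:E)%E.
Proof.
move=> e0 d0 C0 C'0 hC hC'; have p0 : 0 < p := lt_trans ltr01 p_gt1.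
have q0 : 0 < p - 1 by rewrite subr_gt0.
have K0 : 0 <= C * (dlt * M + C').
  by rewrite mulr_ge0// addr_ge0// mulr_ge0// ltW.
elim: n => [|n IH].
  under eq_mean do rewrite big_nil powR0 ?gt_eqF//.
  by rewrite mean_cst powR0 ?gt_eqF// !mul0r addr0.
pose S w := \sum_(0 <= i < n) A (rcons u i) w.
have S0 w : 0 <= S w by exact: sumr_ge0.
have mSphi (phi : R -> R) : measurable_fun setT (fun w => phi (S w)).
  exact: (sibling_sum_measurable phi n u tA).
have mAp : measurable_fun setT (fun w => A [::] w `^ p).
  exact: (tree_var_measurable [::] (tree_var_comp (fun x => x `^ p) tA)).
have mA : measurable_fun setT (A [::]) := tree_var_measurable [::] tA.
under eq_mean do rewrite big_nat_recr//=.
rewrite [leLHS](sibling_fubini (psi := fun x y => (x + y) `^ p) n u tA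
  (fun _ _ => powR_ge0 _ _)).
have inner w : (mean P (fun w' => ((S w + A (rcons u n) w') `^ p)%R) <=
    (S w `^ p + ((1 + eps) * M + C * S w `^ (p - 1)))%R%:E)%E.
  rewrite (mean_law (phi := fun y => (S w + y) `^ p) _ [::] tA
    (fun=> powR_ge0 _ _)).
  apply: (@le_trans _ _ (mean P (fun w' =>
     ((S w `^ p + (1 + eps) * A [::] w' `^ p) + (C * S w `^ (p - 1)) * A [::] w')%R))).
    apply: le_mean.
    - exact: (tree_var_measurable [::] (tree_var_comp (fun x => (S w + x) `^ p) tA)).
    - apply: measurable_funD; last exact: measurable_funM.
      by apply: measurable_funD => //; exact: measurable_funM.
    - by move=> w'; exact: powR_ge0.
    - by move=> w'; rewrite -mulrA; exact: hC.
  have e1 : 0 <= 1 + eps by lra.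
  have k0 : 0 <= C * S w `^ (p - 1) by rewrite mulr_ge0 ?powR_ge0.
  have mF1 : measurable_fun setT (fun w' => (1 + eps) * A [::] w' `^ p).
    exact: measurable_funM.
  have F10 w' : 0 <= (1 + eps) * A [::] w' `^ p by rewrite mulr_ge0 ?powR_ge0.
  rewrite (meanD P (X := fun w' => S w `^ p + (1 + eps) * A [::] w' `^ p)
    (Y := fun w' => C * S w `^ (p - 1) * A [::] w')); first last.
  - by move=> w'; rewrite mulr_ge0.
  - by move=> w'; rewrite addr_ge0 ?powR_ge0.
  - exact: measurable_funM.
  - exact: measurable_funD.
  rewrite (meanD P (X := fun=> S w `^ p) (measurable_cst _) mF1
    (fun=> powR_ge0 _ _) F10).
  rewrite (meanZ P mA)// (meanZ P mAp)//; last by move=> w'; exact: powR_ge0.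
  rewrite mean_cst A_mean mule1 addrA [in leRHS]EFinD; apply: leeD2r.
  rewrite [in leRHS]EFinD; apply: leeD2l.
  by rewrite [in leRHS]EFinM lee_wpmul2l// lee_fin.
apply: (@le_trans _ _ (mean P (fun w =>
    (S w `^ p + ((1 + eps) * M + C * S w `^ (p - 1)))%R))).
  apply: ge0_le_integral => //.
  - by move=> w _; apply: mean_ge0 => w'; exact: powR_ge0.
  - exact: (measurable_sibling_section (fun x y => (x + y) `^ p) n u (rcons u n) tA tA).
  - exact/measurable_EFinP/(mSphi (fun x => x `^ p + ((1 + eps) * M + C * x `^ (p - 1)))).
  - by move=> w _; exact: inner.
have eM : 0 <= (1 + eps) * M by rewrite mulr_ge0//; lra.
have CS0 w : 0 <= C * S w `^ (p - 1) by rewrite mulr_ge0 ?powR_ge0.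
have -> : mean P (fun w => S w `^ p + ((1 + eps) * M + C * S w `^ (p - 1))) =
  (mean P (fun w => (S w `^ p)%R) + (((1 + eps) * M)%:E +
     C%:E * mean P (fun w => (S w `^ (p - 1))%R)))%E.
  rewrite [LHS](meanD P (mSphi (fun x => x `^ p))
    (mSphi (fun x => (1 + eps) * M + C * x `^ (p - 1)))
    (fun=> powR_ge0 _ _) (fun w => addr_ge0 eM (CS0 w))); congr (_ + _)%E.
  rewrite [LHS](meanD P (measurable_cst _) (mSphi (fun x => C * x `^ (p - 1)))
    (fun=> eM) CS0) mean_cst; congr (_ + _)%E.
  exact: (meanZ P (mSphi (fun x => x `^ (p - 1))) (fun=> powR_ge0 _ _) C0).
have := mean_powR_pred_siblings u n d0 C'0 hC'.
have CE0 : (0 <= C%:E)%E by rewrite lee_fin.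
move=> /(lee_wpmul2l CE0) h.
apply: le_trans (leeD IH (leeD (lexx _) h)) _.
rewrite -EFinM -!EFinD lee_fin -natr1 mulrDl mul1r.
have -> : (n%:R + 1) `^ p = (n%:R + 1) * (n%:R + 1) `^ (p - 1) :> R.
  by rewrite mulr_powRB1.
have h1 : n%:R `^ (p - 1) <= (n%:R + 1) `^ (p - 1) :> R.
  by apply: powR_le; [exact: ltW|exact: ler0n|rewrite lerDl].
have h2 : n%:R `^ p = n%:R * n%:R `^ (p - 1) :> R by rewrite mulr_powRB1.
rewrite h2; have := ler_wpM2l (addr_ge0 (ler0n R n) ler01) h1.
move=> /(ler_wpM2r K0); rewrite mulrDl mul1r mulrDl; lra.
Qed.

(** Integrate the bound for n summands with respect to the number of children. *)
Lemma mean_powR_child_sum eps dlt C C' u Zp : 0 < eps -> 0 < dlt -> 0 <= C ->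
  0 <= C' ->
  (forall x y, 0 <= x -> 0 <= y ->
    (x + y) `^ p <= x `^ p + (1 + eps) * y `^ p + C * (x `^ (p - 1) * y)) ->
  (forall a, 0 <= a -> a `^ (p - 1) <= dlt * a `^ p + C') ->
  offspring_moment mu p = Zp%:E ->
  (mean P (fun w => (child_sum A u w `^ p)%R) <=
    (m * ((1 + eps) * M) + Zp * (C * (dlt * M + C')))%R%:E)%E.
Proof.
move=> e0 d0 C0 C'0 hC hC' ZpE; have p0 : 0 < p := lt_trans ltr01 p_gt1.
have K0 : 0 <= C * (dlt * M + C').
  by rewrite mulr_ge0// addr_ge0// mulr_ge0// ltW.
have M1 : 0 <= (1 + eps) * M by rewrite mulr_ge0//; lra.
have mNF (F : nat -> \bar R) : measurable_fun setT (fun w => F (N u w)).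
  apply: measurable_of_fibres => k.
  exact: (local_family_measurable _ _ (local_family_offspring N)).
rewrite [leLHS](child_sum_fubini (phi := fun x => x `^ p) u tA); last first.
  by move=> x; exact: powR_ge0.
apply: (@le_trans _ _ (\int[P]_w
  ((N u w)%:R%:E * ((1 + eps) * M)%:E +
   ((N u w)%:R `^ p)%R%:E * (C * (dlt * M + C'))%:E))%E).
  apply: ge0_le_integral => //.
  - by move=> w _; apply: mean_ge0 => w'; exact: powR_ge0.
  - exact: (mNF (fun n => mean P (fun w' => ((\sum_(0 <= i < n) A (rcons u i) w') `^ p)%R))).
  - exact: (mNF (fun n => n%:R%:E * ((1 + eps) * M)%:E +
      (n%:R `^ p)%R%:E * (C * (dlt * M + C'))%:E)%E).
  - move=> w _; rewrite -!EFinM -EFinD.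
    exact: (mean_powR_siblings u (N u w) e0 d0 C0 C'0 hC hC').
rewrite ge0_integralD//; last 4 first.
- by move=> w _; rewrite -EFinM lee_fin mulr_ge0.
- exact: (mNF (fun n => n%:R%:E * ((1 + eps) * M)%:E)%E).
- by move=> w _; rewrite -EFinM lee_fin mulr_ge0 ?powR_ge0.
- exact: (mNF (fun n => (n%:R `^ p)%R%:E * (C * (dlt * M + C'))%:E)%E).
rewrite ge0_integralZr//; last exact: (mNF (fun n => n%:R%:E)).
rewrite ge0_integralZr//; last exact: (mNF (fun n => (n%:R `^ p)%R%:E)).
rewrite offspring_mean_integral.
rewrite (offspring_integral u (F := fun k => (k%:R `^ p)%:E)); last first.
  by move=> k; rewrite lee_fin powR_ge0.
by move: ZpE; rewrite /offspring_moment => ->; rewrite -!EFinM -EFinD.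
Qed.

End PowerMoment.

(** * The branching martingale *)

Hypothesis m_gt1 : 1 < m.

Let m_gt0 : 0 < m. Proof. exact: lt_trans m_gt1. Qed.
Let m_neq0 : m != 0. Proof. by rewrite gt_eqF. Qed.
Let mV_ge0 : 0 <= m^-1. Proof. by rewrite invr_ge0 ltW. Qed.

(** The sum over the children, normalized so as to preserve means. *)
Definition branch A u w : R := m^-1 * child_sum A u w.

Lemma tree_var_branch A : tree_var A -> tree_var (branch A).
Proof. by move=> /tree_var_child_sum/(tree_var_comp (fun x => m^-1 * x)). Qed.

Lemma branch_ge0 A u w : (forall u w, 0 <= A u w) -> 0 <= branch A u w.
Proof. by move=> A0; rewrite mulr_ge0// child_sum_ge0. Qed.

Lemma mean_branch A u v : tree_var A -> (forall u w, 0 <= A u w) ->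
  mean P (branch A u) = mean P (A v).
Proof.
move=> tA A0; rewrite [LHS](meanZ P (X := child_sum A u))//.
- by rewrite (mean_child_sum u v)// muleA -EFinM mulVf// mul1e.
- exact: (tree_var_measurable u (tree_var_child_sum tA)).
- by move=> w; exact: child_sum_ge0.
Qed.

Lemma cx_le_branch eps A A' u : 0 <= eps -> tree_var A -> tree_var A' ->
  (forall u w, 0 <= A u w) -> (forall u w, 0 <= A' u w) ->
  cx_le P eps (A [::]) (A' [::]) -> cx_le P eps (branch A u) (branch A' u).
Proof.
move=> e0 tA tA' A0 A'0 /(cx_le_child_sum u e0 tA tA' A0 A'0).
by move=> /(cx_le_scale mV_ge0); rewrite mulrA mulVf// mul1r.
Qed.

Lemma branchD A A' u w :
  branch (fun u w => A u w + A' u w) u w = branch A u w + branch A' u w.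
Proof. by rewrite /branch child_sumD mulrDr. Qed.

Lemma ler_norm_branch A u w :
  `|branch A u w| <= branch (fun u w => `|A u w|) u w.
Proof.
by rewrite /branch normrM (ger0_norm mV_ge0) ler_wpM2l// ler_norm_child_sum.
Qed.

(** The martingale m^(-n) Z_n of the subtree above any vertex, computed by
    branching at the root. *)
Fixpoint normalized_size n : seq nat -> Omega -> R :=
  if n is n'.+1 then branch (normalized_size n') else fun _ _ => 1.

Local Notation W := normalized_size.

Lemma tree_var_W n : tree_var (W n).
Proof. by elim: n => [|n IH]; [exact: tree_var_cst|exact: tree_var_branch]. Qed.

Lemma W_ge0 n u w : 0 <= W n u w.
Proof. by elim: n u w => [|n IH] u w //=; exact: branch_ge0. Qed.

Lemma mean_W n u : mean P (W n u) = 1%E.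
Proof.
elim: n u => [|n IH] u; first exact: mean_cst.
rewrite -(IH [::]); apply: mean_branch; [exact: tree_var_W|exact: W_ge0].
Qed.

Lemma measurable_W n u : measurable_fun setT (W n u).
Proof. exact: (tree_var_measurable u (tree_var_W n)). Qed.

(** Jensen's inequality, from the subgradient of phi at the mean. *)
Lemma mean_ge_convex L phi (X : Omega -> R) b : convex_lip L phi ->
  measurable_fun setT X -> measurable_fun setT (phi \o X) ->
  (forall w, 0 <= X w) -> mean P X = b%:E ->
  ((phi b)%:E <= mean P (phi \o X))%E.
Proof.
move=> [phi0 [dphi h]] mX mphi X0 Xb.
have b0 : 0 <= b by rewrite -lee_fin -Xb; exact: mean_ge0.
have [/andP[d0 _] hb] := h _ b0.
have : (mean P (fun w => (phi b + dphi b * X w)%R) <=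
        mean P (fun w => (phi (X w) + dphi b * b)%R))%E.
  apply: le_mean.
  - by apply: measurable_funD => //; exact: measurable_funM.
  - exact: measurable_funD.
  - by move=> w; rewrite addr_ge0// mulr_ge0.
  - by move=> w; have := hb _ (X0 w); lra.
rewrite (meanD P (X := fun=> phi b) (measurable_cst _)
  (measurable_funM (measurable_cst _) mX) (fun=> phi0 _)
  (fun w => mulr_ge0 d0 (X0 w))).
rewrite (meanD P mphi (measurable_cst _) (fun=> phi0 _) (fun=> mulr_ge0 d0 b0)).
rewrite meanZ// Xb !mean_cst -EFinM -EFinD => h2.
have := leeD2r (- (dphi b * b)%:E)%E h2.
by rewrite addeK// EFinD addeK.
Qed.

Lemma cx_le_mean1 A u : tree_var A -> (forall u w, 0 <= A u w) ->
  mean P (A u) = 1%E -> cx_le P 0 (fun=> 1) (A u).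
Proof.
move=> tA A0 A1 L phi cphi; rewrite mulr0 adde0 mean_cst.
apply: (mean_ge_convex cphi) => //.
  exact: (tree_var_measurable u tA).
exact: (tree_var_measurable u (tree_var_comp phi tA)).
Qed.

(** The constant 1 is less spread out than W_1, and branching preserves the order. *)
Lemma cx_le_W_leq i j u : (i <= j)%N -> cx_le P 0 (W i u) (W j u).
Proof.
elim: i j u => [|i IH] [|j] u ij //; first exact: cx_le_refl.
  apply: cx_le_mean1; [exact: tree_var_W|exact: W_ge0|exact: mean_W].
by apply: cx_le_branch => //; [exact: tree_var_W|exact: tree_var_W|
  exact: W_ge0|exact: W_ge0|exact: IH].
Qed.

(** One generation multiplies the p-th moment by at most a factor close to
    m^(1-p) < 1, up to an additive constant. *)
Lemma W_moment_bounded p Zp : 1 < p -> offspring_moment mu p = Zp%:E ->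
  exists Mb : R, forall n, (mean P (fun w => (W n [::] w `^ p)%R) <= Mb%:E)%E.
Proof.
move=> p1 ZpE; have p0 : 0 < p := lt_trans ltr01 p1.
have q0 : 0 < p - 1 by rewrite subr_gt0.
have Zp0 : 0 <= Zp.
  by rewrite -lee_fin -ZpE; apply: integral_ge0 => k _; rewrite lee_fin powR_ge0.
pose mp := m^-1 `^ p.
have mp0 : 0 <= mp by exact: powR_ge0.
pose rho := mp * m.
have rho_gt0 : 0 < rho by rewrite mulr_gt0// powR_gt0// invr_gt0.
have rho1 : rho < 1.
  rewrite /rho /mp -mulr_powRB1// mulrAC mulVf// mul1r.
  rewrite -[ltRHS](_ : 1 `^ (p - 1) = 1); last by rewrite powR1.
  apply: gt0_ltr_powR; rewrite ?nnegrE//.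
  by rewrite invf_lt1.
pose eps := (rho^-1 - 1) / 2.
have eps0 : 0 < eps by rewrite divr_gt0// subr_gt0 invf_gt1.
have epsE : rho * (1 + eps) = (1 + rho) / 2.
  by rewrite /eps; field; rewrite gt_eqF.
have [C C0 hC] := powR_add_le p1 eps0.
pose dlt := (1 - rho) / (4 * (mp * Zp * C + 1)).
have K0 : 0 < mp * Zp * C + 1 by rewrite ltr_wpDl// !mulr_ge0.
have dlt0 : 0 < dlt by rewrite divr_gt0 ?subr_gt0// mulr_gt0.
have dltE : mp * Zp * C * dlt <= (1 - rho) / 4.
  have -> : (1 - rho) / 4 = (mp * Zp * C + 1) * dlt.
    by rewrite /dlt; field; rewrite gt_eqF.
  by rewrite ler_wpM2r ?(ltW dlt0)// lerDl.
have [C' C'0 hC'] := powR_pred_le q0 dlt0.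
pose K := mp * Zp * C * C'.
have Kge0 : 0 <= K by rewrite !mulr_ge0.
have r1 : 0 < 1 - rho by rewrite subr_gt0.
(* the fixed point of x |-> (1 + rho) / 2 * x + (1 - rho) / 4 * x + K is
   4 K / (1 - rho), and the bound must exceed W_0 = 1 *)
exists (1 + 4 * K / (1 - rho)).
set Mb := 1 + 4 * K / (1 - rho).
have Mb1 : 1 <= Mb by rewrite lerDl divr_ge0 ?mulr_ge0// ltW.
have MbE : (1 - rho) * Mb = (1 - rho) + 4 * K.
  by rewrite /Mb; field; rewrite gt_eqF.
elim=> [|n IH].
  by under eq_mean do rewrite /= powR1; rewrite mean_cst lee_fin.
have mS : measurable_fun setT (fun w => child_sum (W n) [::] w `^ p).
  exact: (tree_var_measurable [::]
    (tree_var_comp (fun x => x `^ p) (tree_var_child_sum (tree_var_W n)))).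
have -> : mean P (fun w => (W n.+1 [::] w `^ p)%R) =
  (mp%:E * mean P (fun w => (child_sum (W n) [::] w `^ p)%R))%E.
  rewrite -meanZ//; last by move=> w; exact: powR_ge0.
  by apply: eq_mean => w; rewrite /= /branch powRM// child_sum_ge0//; exact: W_ge0.
have := mean_powR_child_sum p1 (tree_var_W n) (W_ge0 n) (mean_W n [::])
  IH [::] eps0 dlt0 C0 C'0 hC hC' ZpE.
have mpE : (0 <= mp%:E)%E by rewrite lee_fin.
move=> /(lee_wpmul2l mpE) /le_trans; apply; rewrite -EFinM lee_fin.
have -> : mp * (m * ((1 + eps) * Mb) + Zp * (C * (dlt * Mb + C'))) =
  (rho * (1 + eps)) * Mb + (mp * Zp * C * dlt) * Mb + K.
  by rewrite /rho /K; ring.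
rewrite epsE; have Mb0 : 0 <= Mb by exact: le_trans Mb1.
have := ler_wpM2r Mb0 dltE; lra.
Qed.

(** * Geometric decay of the increments *)

(** Generations grow at the leaves, whereas functions of the subtree unfold at the
    root.  Starting the recursion k levels higher reconciles the two. *)
Lemma sum_generation (F : nat -> seq nat -> Omega -> R) w n k :
  (forall k u, F k.+1 u w = \sum_(0 <= i < N u w) F k (rcons u i) w) ->
  \sum_(u <- generation N w n) F k u w = F (n + k)%N [::] w.
Proof.
move=> FS; elim: n k => [|n IH] k; first by rewrite big_seq1.
rewrite /= big_flatten/= big_map addSnnS -IH; apply: eq_bigr => u _.
by rewrite FS /children big_map /index_iota subn0.
Qed.

Lemma generation_sizeE n w :
  (generation_size N n w)%:R / m ^+ n = W n [::] w.
Proof.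
have := sum_generation (F := fun k u w => m ^+ k * W k u w) (w := w) n 0.
rewrite addn0 => h; rewrite -[RHS](mulKf (expf_neq0 n m_neq0)) mulrC -h.
  congr (_ * _); rewrite /generation_size -sum1_size natr_sum.
  by apply: eq_bigr => u _; rewrite expr0 mul1r.
by move=> k u; rewrite /= /branch exprSr -mulrA mulVKf// mulr_sumr.
Qed.

Lemma tree_var_offspring (f : nat -> R) : tree_var (fun u w => f (N u w)).
Proof.
exists 1%N, (fun c => f (size (odflt [::] (choice.unpickle c : option (seq nat))))).
move=> u w; rewrite -[code _ _ _ _]/(choice.pickle _) choice.pickleK [odflt _ _]/=.
by rewrite size_map size_iota.
Qed.

(** The average of f over the offspring numbers of the n-th generation,
    normalized by m^n. *)
Fixpoint offspring_avg (f : nat -> R) n : seq nat -> Omega -> R :=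
  if n is n'.+1 then branch (offspring_avg f n') else fun u w => f (N u w).

Local Notation avg := offspring_avg.

Lemma tree_var_avg f n : tree_var (avg f n).
Proof.
by elim: n => [|n IH]; [exact: tree_var_offspring|exact: tree_var_branch].
Qed.

Lemma avgD f f' n u w : avg (fun k => f k + f' k) n u w = avg f n u w + avg f' n u w.
Proof.
elim: n u w => [//|n IH] u w /=; rewrite -branchD; congr (_ * _).
by apply: eq_bigr => i _.
Qed.

Lemma avg_ge0 f n u w : (forall k, 0 <= f k) -> 0 <= avg f n u w.
Proof.
by move=> f0; elim: n u w => [|n IH] u w //=; exact: branch_ge0.
Qed.

Lemma ler_norm_avg f n u w : `|avg f n u w| <= avg (fun k => `|f k|) n u w.
Proof.
elim: n u w => [//|n IH] u w /=; apply: le_trans (ler_norm_branch _ _ _) _.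
by rewrite ler_wpM2l ?invr_ge0 ?(ltW m_gt0)//; apply: ler_sum.
Qed.

Lemma mean_avg f n u v : (forall k, 0 <= f k) ->
  mean P (avg f n u) = mean P (fun w => f (N v w)).
Proof.
move=> f0; elim: n u => [|n IH] u.
  apply: (mean_law_ge0 (A := fun u w => f (N u w))) => //.
  exact: tree_var_offspring.
rewrite -(IH [::]); apply: mean_branch => //; first exact: tree_var_avg.
by move=> *; exact: avg_ge0.
Qed.

Lemma W_increment n u w : W n.+1 u w - W n u w = avg (fun k => m^-1 * k%:R - 1) n u w.
Proof.
elim: n u w => [|n IH] u w.
  by rewrite /= /branch child_sum_cst.
rewrite [W n.+2]/= [W n.+1]/= [avg _ _]/= /branch -mulrBr; congr (_ * _).
by rewrite -sumrB; apply: eq_bigr => i _; rewrite -IH.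
Qed.

Lemma mean_norm_sqr_lty (X : Omega -> R) (V : R) : measurable_fun setT X ->
  mean P (fun w => X w ^+ 2) = V%:E -> (mean P (fun w => `|X w|%R) < +oo)%E.
Proof.
move=> mX XV; have mX2 : measurable_fun setT (fun w => X w ^+ 2).
  exact: measurable_funX.
apply: (@le_lt_trans _ _ (mean P (fun w => 1 + X w ^+ 2))).
  apply: le_mean => //; [exact: measurableT_comp|exact: measurable_funD|].
  move=> w; rewrite -[X w ^+ 2]real_normK ?num_real//.
  by have := sqr_ge0 (`|X w| - 2^-1); nra.
rewrite meanD//; last by move=> w; exact: sqr_ge0.
by rewrite mean_cst XV -EFinD ltry.
Qed.

(** Each generation divides the variance of a centered average by m. *)
Lemma mean_sqr_avg f V n :
  mean P (fun w => f (N [::] w)) = 0%E ->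
  mean P (fun w => f (N [::] w) ^+ 2) = V%:E ->
  mean P (avg f n [::]) = 0%E /\
  mean P (fun w => avg f n [::] w ^+ 2) = (m^-1 ^+ n * V)%:E.
Proof.
move=> f0 fV; elim: n => [|n [IH0 IHV]]; first by rewrite expr0 mul1r.
have tA := tree_var_avg f n.
have mA := tree_var_measurable [::] tA.
have mC := tree_var_measurable [::] (tree_var_child_sum tA).
have CV := mean_sqr_child_sum [::] tA IH0 IHV.
have C0 := mean_child_sum_centered [::] tA (mean_norm_sqr_lty mA IHV) IH0.
split.
  rewrite /mean [avg _ _]/= /branch; under eq_integral do rewrite EFinM.
  rewrite integralZl//; last first.
    by apply: mean_integrable => //; exact: mean_norm_sqr_lty CV.
  by move: C0; rewrite /mean => ->; rewrite mule0.
rewrite [avg _ _]/= /branch; under eq_mean do rewrite exprMn.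
rewrite meanZ ?sqr_ge0//; last 2 first.
- exact: measurable_funX.
- by move=> w; exact: sqr_ge0.
rewrite CV -EFinM; congr (_%:E).
by rewrite [in RHS]exprS expr2 -!mulrA mulKf.
Qed.

(** The offspring numbers are cut at level m^n: the lower part has a small
    variance, which averages out over the generation, and the upper part has a
    small mean. *)
Lemma increment_bound p Zp : 1 < p -> p <= 2 -> offspring_moment mu p = Zp%:E ->
  exists C theta : R, [/\ 0 <= C, 0 < theta, theta < 1 & forall n,
    (mean P (fun w => `|W n.+1 [::] w - W n [::] w|%R) <= (C * theta ^+ n)%:E)%E].
Proof.
move=> p1 p2 ZpE; have p0 : 0 < p := lt_trans ltr01 p1.
have Zp0 : 0 <= Zp.
  by rewrite -lee_fin -ZpE; apply: integral_ge0 => k _; rewrite lee_fin powR_ge0.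
(* theta^2 = m^(1-p) is the common order of the mean of the upper part and of
   the variance of the average of the lower part *)
pose theta := m `^ ((1 - p) / 2).
have th0 : 0 < theta by exact: powR_gt0.
have th1 : theta < 1.
  rewrite /theta /powR gt_eqF// -[ltRHS]expR0 ltr_expR pmulr_llt0 ?ln_gt0//.
  by rewrite pmulr_llt0 ?invr_gt0// subr_lt0.
have th2 : theta ^+ 2 = m `^ (1 - p).
  by rewrite -powR_mulrn ?(ltW th0)// -powRrM divfK// pnatr_eq0.
exists (2^-1 + m^-1 ^+ 2 * Zp / 2 + 2 * (m^-1 * Zp)), theta; split=> //.
  by rewrite !addr_ge0// ?mulr_ge0 ?exprn_ge0 ?invr_ge0// ?ltW.
move=> n; pose T := m ^+ n; have T0 : 0 < T by exact: exprn_gt0.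
have T1p : T `^ (1 - p) = (theta ^+ n) ^+ 2.
  rewrite /T -[m ^+ n]powR_mulrn ?(ltW m_gt0)// powRAC -th2.
  by rewrite powR_mulrn ?exprn_ge0 ?(ltW th0)// exprAC.
pose g1 k : R := m^-1 * (k%:R * (k%:R <= T)%R%:R).
pose g2 k : R := m^-1 * (k%:R * (T < k%:R)%R%:R).
have g10 k : 0 <= g1 k by rewrite !mulr_ge0 ?invr_ge0// ltW.
have g20 k : 0 <= g2 k by rewrite !mulr_ge0 ?invr_ge0// ltW.
have mf (f : nat -> R) : measurable_fun setT (fun w => f (N [::] w)).
  exact: (tree_var_measurable [::] (tree_var_offspring f)).
have mN1 : mean P (fun w => m^-1 * (N [::] w)%:R) = 1%E.
  rewrite (meanZ P (mf (fun k => k%:R))) ?invr_ge0 ?(ltW m_gt0)//.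
  by rewrite /mean offspring_mean_integral -EFinM mulVf.
have g12 k : g1 k + g2 k = m^-1 * k%:R.
  by rewrite /g1 /g2 -mulrDr -mulrDr leNgt; case: ltP => _; rewrite ?addr0 ?add0r mulr1.
have sum1 : (mean P (fun w => g1 (N [::] w)) + mean P (fun w => g2 (N [::] w)))%E = 1%E.
  rewrite -mN1 -(meanD P (mf g1) (mf g2))//.
  by apply: eq_mean => w; rewrite g12.
have fin1 : mean P (fun w => g1 (N [::] w)) \is a fin_num.
  rewrite ge0_fin_numE ?mean_ge0//; apply: (@le_lt_trans _ _ 1%E); last exact: ltry.
  by rewrite -sum1 leeDl// mean_ge0.
pose c := fine (mean P (fun w => g1 (N [::] w))).
have c1 : mean P (fun w => g1 (N [::] w)) = c%:E by rewrite /c fineK.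
have c0 : 0 <= c by rewrite -lee_fin -c1 mean_ge0.
have c2 : mean P (fun w => g2 (N [::] w)) = (1 - c)%:E.
  have := sum1; rewrite c1 => h.
  by rewrite EFinB -h addeAC subee// add0e.
have powN f : (forall k, 0 <= f k) -> forall K, 0 <= K ->
    (forall k, f k <= K * k%:R `^ p) ->
    (mean P (fun w => f (N [::] w)) <= (K * Zp)%:E)%E.
  move=> f0 K K0 fK.
  apply: (@le_trans _ _ (mean P (fun w => (K * (N [::] w)%:R `^ p)%R))).
    exact: (le_mean _ (mf f) (mf (fun k => K * k%:R `^ p))).
  rewrite (meanZ P (mf (fun k => k%:R `^ p)) (fun=> powR_ge0 _ _))//.
  rewrite EFinM lee_wpmul2l ?lee_fin// -ZpE /mean.
  by rewrite (offspring_integral _ (F := fun k => (k%:R `^ p)%R%:E))//;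
     move=> k; rewrite lee_fin powR_ge0.
have c3 : 1 - c <= m^-1 * Zp * (theta ^+ n) ^+ 2.
  rewrite -lee_fin -c2 -T1p mulrAC; apply: powN => //.
    by rewrite mulr_ge0 ?powR_ge0 ?invr_ge0 ?ltW.
  move=> k; rewrite /g2 -mulrA ler_wpM2l ?invr_ge0 ?(ltW m_gt0)//.
  case: ltP => [Tk|_]; last by rewrite mulr0 mulr_ge0 ?powR_ge0.
  have k0 : (0 : R) < k%:R by exact: lt_trans Tk.
  rewrite mulr1 -(mulr_powRB1 (ltW k0) p0) mulrCA ler_peMr//.
  rewrite -opprB powRN ler_pdivlMl ?powR_gt0// mulr1.
  by apply: powR_le; rewrite ?subr_ge0; exact: ltW.
(* 1 = c + (1 - c) is distributed so as to center both parts *)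
pose f1 k := g1 k - c; pose f2 k := g2 k - (1 - c).
have f1m : mean P (fun w => f1 (N [::] w)) = 0%E.
  rewrite /mean /f1; under eq_integral do rewrite EFinB.
  rewrite integralB//; last 2 first.
  - apply: mean_integrable; first exact: mf.
    by under eq_mean do rewrite ger0_norm//; rewrite c1 ltry.
  - exact: finite_measure_integrable_cst.
  move: c1; rewrite /mean => ->.
  by rewrite integral_cst//= probability_setT mule1 subee.
have g1T k : g1 k <= m^-1 * T.
  rewrite /g1 ler_wpM2l ?invr_ge0 ?(ltW m_gt0)//.
  case: (leP k%:R T) => [kT|_]; first by rewrite mulr1.
  by rewrite mulr0 (ltW T0).
have f1fin : mean P (fun w => f1 (N [::] w) ^+ 2) \is a fin_num.
  rewrite ge0_fin_numE ?mean_ge0//; last by move=> w; exact: sqr_ge0.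
  apply: (@le_lt_trans _ _ (mean P (fun=> (m^-1 * T + c) ^+ 2))); last first.
    by rewrite mean_cst ltry.
  apply: le_mean => //; first exact: (mf (fun k => f1 k ^+ 2)).
    by move=> w; exact: sqr_ge0.
  move=> w; rewrite -[f1 _ ^+ 2]real_normK ?num_real//.
  have f1b : `|f1 (N [::] w)| <= m^-1 * T + c.
    apply: le_trans (ler_normB _ _) _.
    by rewrite (ger0_norm c0) (ger0_norm (g10 _)) lerD2r.
  by apply: lerXn2r => //; rewrite nnegrE// (le_trans _ f1b).
pose V := fine (mean P (fun w => f1 (N [::] w) ^+ 2)).
have VE : mean P (fun w => f1 (N [::] w) ^+ 2) = V%:E by rewrite /V fineK.
have V0 : 0 <= V by rewrite -lee_fin -VE; apply: mean_ge0 => w; exact: sqr_ge0.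
have Vle : V <= m^-1 ^+ 2 * Zp * (T * (theta ^+ n) ^+ 2).
  have := mean_sqrD_centered c (mf f1) f1m VE.
  under eq_mean do rewrite /f1 addrC subrK.
  move=> h; apply: (@le_trans _ _ (c ^+ 2 + V)); first by rewrite lerDr sqr_ge0.
  rewrite -lee_fin -h mulrAC; apply: (powN (fun k => g1 k ^+ 2)).
  - by move=> k; exact: sqr_ge0.
  - by rewrite !mulr_ge0 ?exprn_ge0 ?invr_ge0// ltW.
  move=> k; rewrite /g1 exprMn -[leRHS]mulrA; apply: ler_wpM2l; first exact: sqr_ge0.
  rewrite exprMn.
  rewrite -T1p; have -> : T * T `^ (1 - p) = T `^ (2 - p).
    rewrite -[X in X * _](powRr1 (ltW T0)) -powRD; last by rewrite (gt_eqF T0) implybT.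
    by have -> : 1 + (1 - p) = 2 - p by ring.
  case: (leP k%:R T) => [kT|_]; last by rewrite expr0n mulr0 mulr_ge0 ?powR_ge0.
  rewrite expr1n mulr1; have [->|k0] := posnP k.
    by rewrite expr0n mulr_ge0 ?powR_ge0.
  have kR0 : (0 : R) < k%:R by rewrite ltr0n.
  rewrite -powR_mulrn ?(ltW kR0)// -[X in _ `^ X](subrK p).
  rewrite powRD; last by rewrite (gt_eqF kR0) implybT.
  by rewrite ler_wpM2r ?powR_ge0// powR_le ?subr_ge0// ltW.
have [_ V1] := mean_sqr_avg n f1m VE.
pose a := theta ^+ n; have a0 : 0 < a by exact: exprn_gt0.
have a1 : a <= 1 by rewrite exprn_ile1 ?ltW.
have m1 := tree_var_measurable [::] (tree_var_avg f1 n).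
have m2 := tree_var_measurable [::] (tree_var_avg f2 n).
have B1 : (mean P (fun w => `|avg f1 n [::] w|%R) <=
    (2^-1 * a + m^-1 ^+ 2 * Zp / 2 * a)%:E)%E.
  (* |x| <= a / 2 + x^2 / (2 a) *)
  apply: (@le_trans _ _ (mean P (fun w =>
      (2^-1 * a + (2 * a)^-1 * (avg f1 n [::] w) ^+ 2)%R))).
    apply: le_mean => //.
    - exact: measurableT_comp.
    - apply: measurable_funD => //; apply: measurable_funM => //.
      exact: measurable_funX.
    - move=> w; rewrite -[avg f1 n [::] w ^+ 2]real_normK ?num_real//.
      set x := `|_|; have := sqr_ge0 (x - a).
      rewrite -subr_ge0 => h; rewrite -subr_ge0.
      have -> : 2^-1 * a + (2 * a)^-1 * x ^+ 2 - x = (2 * a)^-1 * (x - a) ^+ 2.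
        by field; rewrite gt_eqF.
      by rewrite mulr_ge0 ?sqr_ge0// invr_ge0 mulr_ge0// ltW.
  have mS : measurable_fun setT (fun w => avg f1 n [::] w ^+ 2) by exact: measurable_funX.
  have i0 : 0 <= (2 * a)^-1 by rewrite invr_ge0 mulr_ge0// ltW.
  rewrite (meanD P (X := fun=> 2^-1 * a) (measurable_cst _)
    (measurable_funM (measurable_cst _) mS))//; last 2 first.
  - by move=> _; rewrite mulr_ge0 ?invr_ge0// ltW.
  - by move=> w; rewrite mulr_ge0 ?sqr_ge0.
  rewrite mean_cst (meanZ P mS) ?V1//; last by move=> w; exact: sqr_ge0.
  rewrite -EFinM -EFinD lee_fin lerD2l exprVn -/T.
  have TV : T^-1 * V <= m^-1 ^+ 2 * Zp * a ^+ 2.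
    by rewrite ler_pdivrMl// mulrCA.
  apply: le_trans (ler_wpM2l i0 TV) _.
  by rewrite le_eqVlt; apply/orP; left; apply/eqP; field; rewrite m_neq0 gt_eqF.
have B2 : (mean P (fun w => `|avg f2 n [::] w|%R) <= (2 * (m^-1 * Zp) * a)%:E)%E.
  pose h k := `|f2 k|.
  apply: (@le_trans _ _ (mean P (avg h n [::]))).
    apply: le_mean => //; first exact: measurableT_comp.
      exact: (tree_var_measurable [::] (tree_var_avg h n)).
    by move=> w; exact: ler_norm_avg.
  rewrite (mean_avg n [::] [::]); last by move=> k; exact: normr_ge0.
  have c4 : 0 <= 1 - c by rewrite -lee_fin -c2 mean_ge0.
  apply: (@le_trans _ _ (mean P (fun w => (g2 (N [::] w) + (1 - c))%R))).
    apply: le_mean => //; first exact: (mf (fun k => g2 k + (1 - c))).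
      by move=> w; exact: normr_ge0.
    move=> w; rewrite /h /f2; apply: le_trans (ler_normB _ _) _.
    by rewrite (ger0_norm c4) (ger0_norm (g20 _)).
  rewrite (meanD P (mf g2) (measurable_cst _))// mean_cst c2 -EFinD lee_fin.
  have aa : a ^+ 2 <= a by rewrite expr2 ler_piMl// ltW.
  have mZ : 0 <= m^-1 * Zp by rewrite mulr_ge0 ?invr_ge0// ltW.
  have ca : 1 - c <= m^-1 * Zp * a := le_trans c3 (ler_wpM2l mZ aa).
  by rewrite -[leRHS]mulrA mulr_natl mulr2n lerD.
apply: (@le_trans _ _ (mean P (fun w =>
   (`|avg f1 n [::] w| + `|avg f2 n [::] w|)%R))).
  apply: le_mean => //.
  - by apply: measurableT_comp => //; apply: measurable_funB; exact: measurable_W.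
  - by apply: measurable_funD; exact: measurableT_comp.
  move=> w; rewrite W_increment.
  rewrite (_ : (fun k => _) = fun k => f1 k + f2 k).
    by rewrite avgD ler_normD.
  by apply/funext => k; rewrite /f1 /f2 -g12; ring.
rewrite meanD//; [|exact: measurableT_comp|exact: measurableT_comp].
apply: le_trans (leeD B1 B2) _; rewrite -EFinD lee_fin -/a; lra.
Qed.

(** * The limit of the martingale *)

Context {p : R}.
Hypothesis p_gt1 : 1 < p.
Hypothesis Zp_fin : (offspring_moment mu p < +oo)%E.
Local Notation Winf := (@martingale_limit Omega (fun u => N u) R m).

Lemma martingale_limitE w : Winf w = limn (fun n => W n [::] w).
Proof.
rewrite /martingale_limit (_ : (fun n => _ / _) = fun n => W n [::] w)//.
by apply/funext => n; exact: generation_sizeE.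
Qed.

Lemma measurable_martingale_limit : measurable_fun setT Winf.
Proof.
rewrite (_ : Winf = fun w => limn (fun n => W n [::] w)).
  by apply: measurable_limn => n; exact: (measurable_W n [::]).
by apply/funext => w; exact: martingale_limitE.
Qed.

Lemma martingale_limit_ge0 w : 0 <= Winf w.
Proof.
rewrite martingale_limitE; have [cW|/dvgP ->//] := pselect (cvgn (fun n => W n [::] w)).
by apply: limr_ge => //; apply: nearW => n; exact: W_ge0.
Qed.

Lemma offspring_moment_fin q : 0 < q -> q <= p ->
  exists Zq : R, offspring_moment mu q = Zq%:E.
Proof.
move=> q0 qp; have p0 : 0 < p := lt_trans ltr01 p_gt1.
have fin : offspring_moment mu q \is a fin_num.
  rewrite ge0_fin_numE; last first.
    by apply: integral_ge0 => k _; rewrite lee_fin powR_ge0.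
  apply: le_lt_trans Zp_fin; apply: ge0_le_integral => //.
  move=> k _; rewrite lee_fin; have [->|k0] := posnP k.
    by rewrite !powR0// gt_eqF.
  by apply: ler_powR => //; rewrite ler1n.
by exists (fine (offspring_moment mu q)); rewrite fineK.
Qed.

(** Its integrability yields both the almost sure convergence of the martingale
    and a dominating function. *)
Definition total_variation w : \bar R :=
  (\sum_(n <oo) (`|W n.+1 [::] w - W n [::] w|%R)%:E)%E.

(** The increments are bounded through a moment of order min(p, 2), as only orders
    up to 2 give a geometric decay from the variance. *)
Lemma total_variation_integrable : P.-integrable setT total_variation.
Proof.
have mD n : measurable_fun setT (fun w => `|W n.+1 [::] w - W n [::] w|).
  by apply: measurableT_comp => //; apply: measurable_funB;
    [exact: (measurable_W n.+1 [::])|exact: (measurable_W n [::])].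
have tv0 w : (0 <= total_variation w)%E.
  by apply: nneseries_ge0 => n _ _; rewrite lee_fin.
have mtv : measurable_fun setT total_variation.
  rewrite /total_variation; apply: ge0_emeasurable_sum.
    by move=> n w _ _; rewrite lee_fin.
  by move=> n _; exact/measurable_EFinP.
apply/integrableP; split=> //.
under eq_integral do rewrite gee0_abs//.
rewrite integral_nneseries//; last first.
  by move=> n; exact/measurable_EFinP.
have [q [q1 q2 qp]] : exists q, [/\ 1 < q, q <= 2 & q <= p].
  exists (Num.min p 2); split; last 2 first.
  - by rewrite ge_min lexx orbT.
  - by rewrite ge_min lexx.
  - by rewrite lt_min p_gt1/= ltr1n.
have [Zq ZqE] := offspring_moment_fin (lt_trans ltr01 q1) qp.
have [C [theta [C0 t0 t1 hC]]] := increment_bound q1 q2 ZqE.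
apply: (@le_lt_trans _ _ (C / (1 - theta))%:E); last exact: ltry.
apply: lime_le.
  by apply: is_cvg_nneseries => n _ _; exact: mean_ge0.
apply: nearW => n.
apply: (@le_trans _ _ (\sum_(0 <= i < n) (C * theta ^+ i)%:E)%E).
  by apply: lee_sum => i _; exact: hC.
rewrite sumEFin lee_fin.
have := @geometric_seriesE _ C theta (negbT (lt_eqF t1)).
rewrite /series/geometric/= => /(congr1 (fun f => f n)) /= ->.
rewrite ler_pM2r ?invr_gt0 ?subr_gt0// ler_piMr//.
by rewrite gerBl exprn_ge0// ltW.
Qed.

Lemma W_le_total_variation n w : ((W n [::] w)%:E <= 1 + total_variation w)%E.
Proof.
apply: (@le_trans _ _ (1 + \sum_(0 <= i < n) (`|W i.+1 [::] w - W i [::] w|%R)%:E)%E).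
  rewrite sumEFin -EFinD lee_fin.
  elim: n => [|n IH]; first by rewrite big_nil addr0.
  rewrite big_nat_recr//= addrA; apply: le_trans (lerD IH (ler_norm _)).
  by rewrite addrC subrK.
by apply: leeD => //; apply: nneseries_lim_ge => i _ _; rewrite lee_fin.
Qed.

Lemma W_cvg_ae : {ae P, forall w, W n [::] w @[n --> \oo] --> Winf w}.
Proof.
apply: filterS (integrable_ae measurableT total_variation_integrable) => w /(_ I) tvfin.
rewrite martingale_limitE.
pose D n := W n.+1 [::] w - W n [::] w.
have cD : cvgn (series D).
  apply: normed_cvg; apply: nondecreasing_is_cvgn.
    by apply: nondecreasing_series => n _ _; exact: normr_ge0.
  exists (fine (total_variation w)) => _ [n _ <-].
  rewrite -lee_fin fineK// /series/= -sumEFin.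
  by apply: nneseries_lim_ge => i _ _; rewrite lee_fin.
have -> : (fun n => W n [::] w) = (fun n => 1 + series D n).
  apply/funext => n; rewrite /series/= telescope_sumr//.
  by rewrite addrC subrK.
by apply: is_cvgD => //; exact: is_cvg_cst.
Qed.

(** Dominated convergence: phi (W_n) grows at most linearly in W_n. *)
Lemma mean_convex_cvg L (phi : R -> R) : convex_lip L phi ->
  measurable_fun setT (fun w => phi (Winf w)) ->
  mean P (fun w => phi (W n [::] w)) @[n --> \oo] -->
  mean P (fun w => phi (Winf w)).
Proof.
move=> cphi mphi; have [phi0 _] := cphi; have L0 := convex_lip_ge0 cphi.
pose G w := ((phi 0 + L)%:E + L%:E * total_variation w)%E.
have iG : P.-integrable setT G.
  apply: integrableD => //; first exact: finite_measure_integrable_cst.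
  by apply: integrableZl => //; exact: total_variation_integrable.
have [] := @dominated_convergence _ _ _ P setT measurableT
  (fun n w => (phi (W n [::] w))%:E) (fun w => (phi (Winf w))%:E) G.
- move=> n; apply/measurable_EFinP.
  exact: (tree_var_measurable [::] (tree_var_comp phi (tree_var_W n))).
- exact/measurable_EFinP.
- apply: filterS W_cvg_ae => w cw _; apply: cvg_EFin; first exact: nearW.
  by apply: (convex_lip_cvg cphi) => // n; exact: W_ge0.
- exact: iG.
- apply: aeW => w n _; rewrite abse_EFin ger0_norm//.
  apply: (@le_trans _ _ ((phi 0)%:E + L%:E * (W n [::] w)%:E)%E).
    rewrite -EFinM -EFinD lee_fin.
    have W0 : 0 <= W n [::] w by exact: W_ge0.
    have := convex_lip_lip cphi W0 (lexx 0).
    by rewrite subr0 (ger0_norm W0).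
  rewrite /G EFinD -addeA leeD2l//.
  apply: (@le_trans _ _ (L%:E * (1 + total_variation w))%E).
    by apply: lee_wpmul2l; rewrite ?lee_fin//; exact: W_le_total_variation.
  rewrite ge0_muleDr//; last by apply: nneseries_ge0 => i _ _; rewrite lee_fin.
  by rewrite mule1.
by move=> _ _.
Qed.

Definition limit_moment : R := fine (mean P (fun w => Winf w `^ p)).

Let mtr L := measurable_powR_trunc p L measurable_martingale_limit.

Lemma mean_trunc_W_le L n : 0 <= L ->
  (mean P (fun w => powR_trunc p L (W n [::] w)) <=
   mean P (fun w => powR_trunc p L (Winf w)))%E.
Proof.
move=> L0; have cphi := convex_lip_powR_trunc p_gt1 L0.
have cv := mean_convex_cvg cphi (mtr L).
apply: (cvge_to_ge cv); exists n => // k /= nk.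
have := cx_le_W_leq [::] nk cphi.
by rewrite mulr0 adde0.
Qed.

Lemma mean_trunc_le L : 0 <= L ->
  (mean P (fun w => powR_trunc p L (Winf w)) <= mean P (fun w => (Winf w `^ p)%R))%E.
Proof.
move=> L0; apply: le_mean.
- exact: mtr.
- exact: (measurableT_comp (measurable_powR p) measurable_martingale_limit).
- by move=> w; have [h _] := convex_lip_powR_trunc p_gt1 L0; exact: h.
- by move=> w; apply: powR_trunc_le => //; exact: martingale_limit_ge0.
Qed.

(** The moments of W_n are bounded, and the truncated moments pass to the limit. *)
Lemma limit_momentE : mean P (fun w => Winf w `^ p) = limit_moment%:E.
Proof.
rewrite /limit_moment fineK// ge0_fin_numE; last first.
  by apply: mean_ge0 => w; exact: powR_ge0.
have [Zp ZpE] := offspring_moment_fin (lt_trans ltr01 p_gt1) (lexx p).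
have [Mb hMb] := W_moment_bounded p_gt1 ZpE.
apply: (@le_lt_trans _ _ Mb%:E); last exact: ltry.
apply: (cvge_to_le (mean_powR_trunc_cvg (P := P) p_gt1 measurable_martingale_limit
  martingale_limit_ge0)).
apply: nearW => k.
have cphi := convex_lip_powR_trunc p_gt1 (ler0n R k).
apply: (cvge_to_le (mean_convex_cvg cphi (mtr k%:R))).
apply: nearW => n; apply: le_trans (hMb n); apply: le_mean.
- exact: (tree_var_measurable [::]
    (tree_var_comp (powR_trunc p k%:R) (tree_var_W n))).
- exact: (tree_var_measurable [::]
    (tree_var_comp (fun x => x `^ p) (tree_var_W n))).
- by move=> w; have [h _] := cphi; exact: h.
- by move=> w; apply: powR_trunc_le => //; exact: W_ge0.
Qed.

(** A truncation level first, then a generation. *)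
Lemma limit_moment_approx eps : 0 < eps -> exists L n, 1 <= L /\
  ((limit_moment - eps)%:E <= mean P (fun w => powR_trunc p L (W n [::] w)))%E.
Proof.
move=> e0; have e2 : 0 < eps / 2 by rewrite divr_gt0.
have := mean_powR_trunc_cvg (P := P) p_gt1 measurable_martingale_limit martingale_limit_ge0.
rewrite limit_momentE => cvL.
have : \forall k \near \oo,
   ((limit_moment - eps / 2)%:E < mean P (fun w => powR_trunc p k%:R (Winf w)))%E.
  apply: (cvL [set u | ((limit_moment - eps / 2)%:E < u)%E]).
  by apply: open_ereal_gt'; rewrite lte_fin ltrBlDr ltrDl.
move=> [K _ /(_ (maxn K 1) (leq_maxl _ _))/= hK].
have L1 : 1 <= (maxn K 1)%:R :> R by rewrite ler1n leq_maxr.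
have cphi := convex_lip_powR_trunc p_gt1 (le_trans ler01 L1).
have cv := mean_convex_cvg cphi (mtr _).
have : \forall n \near \oo, ((limit_moment - eps / 2 - eps / 2)%:E <
    mean P (fun w => powR_trunc p (maxn K 1)%:R (W n [::] w)))%E.
  apply: (cv [set u | ((limit_moment - eps / 2 - eps / 2)%:E < u)%E]).
  apply: open_ereal_gt'; apply: lt_trans hK.
  by rewrite lte_fin ltrBlDr ltrDl.
move=> [n _ /(_ n (leqnn n))/= hn].
exists (maxn K 1)%:R, n; split=> //; apply: ltW; apply: le_lt_trans hn.
by rewrite lee_fin -addrA -opprD -splitr.
Qed.

Lemma limit_moment_ge1 : 1 <= limit_moment.
Proof.
have cphi := convex_lip_powR_trunc p_gt1 (ler01 : 0 <= 1 :> R).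
have := le_trans (mean_trunc_W_le 0 ler01) (mean_trunc_le ler01).
rewrite limit_momentE -lee_fin; apply: le_trans.
under eq_mean do rewrite /= powR_trunc_small// powR1.
by rewrite mean_cst.
Qed.

(** The truncated powers are test functions for the order; let the level grow. *)
Lemma mean_powR_le_limit_moment (X : Omega -> R) n : measurable_fun setT X ->
  (forall w, 0 <= X w) -> cx_le P 0 X (W n [::]) ->
  (mean P (fun w => (X w `^ p)%R) <= limit_moment%:E)%E.
Proof.
move=> mX X0 XW; apply: (cvge_to_le (mean_powR_trunc_cvg (P := P) p_gt1 mX X0)).
apply: nearW => k.
have cphi := convex_lip_powR_trunc p_gt1 (ler0n R k).
have := XW _ _ cphi; rewrite mulr0 adde0 => /le_trans; apply.
apply: le_trans (mean_trunc_W_le n (ler0n R k)) _.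
by rewrite -limit_momentE; exact: mean_trunc_le.
Qed.

End Branching.

(** * Concave images are less spread out *)

Section ConcaveImage.
Context {R : realType} {d : measure_display} {Omega : measurableType d}.
Context {P : probability Omega R} {N : seq nat -> {RV P >-> nat}}.
Local Notation tree_var := (tree_var N).
Context (g : R -> R).
Hypotheses (g_ge0 : forall x, 0 <= x -> 0 <= g x)
  (g_mono : forall x y, 0 <= x -> x <= y -> g x <= g y)
  (g_ratio : forall x y, 0 < x -> x <= y -> g y / y <= g x / x).

Lemma subgradient_mono L (phi dphi : R -> R) a b :
  (forall a, 0 <= a -> 0 <= dphi a <= L /\
    forall b, 0 <= b -> phi a + dphi a * (b - a) <= phi b) ->
  0 <= a -> a <= b -> dphi a <= dphi b.
Proof.
move=> h a0; rewrite le_eqVlt => /predU1P[->//|ab].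
have b0 : 0 <= b by rewrite (le_trans a0)// ltW.
have [_ /(_ b b0) h1] := h a a0; have [_ /(_ a a0) h2] := h b b0.
have ba : 0 < b - a by rewrite subr_gt0.
rewrite -(ler_pM2r ba); lra.
Qed.

(** Since g x / x is nonincreasing, there is a level of x below which the
    normalized image g x / gam exceeds x / b and above which it is smaller; as
    both have mean 1, the former is less spread out.  The number ell separates
    the slopes of phi on the two sides. *)
Lemma cx_le_concave_image A u b gam : tree_var A -> (forall u w, 0 <= A u w) ->
  0 < b -> 0 < gam -> mean P (A u) = b%:E ->
  mean P (fun w => g (A u w)) = gam%:E ->
  cx_le P 0 (fun w => gam^-1 * g (A u w)) (fun w => b^-1 * A u w).
Proof.
move=> tA A0 b0 gam0 Ab gAgam L phi [phi0 [dphi h]]; rewrite mulr0 adde0.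
pose S := [set dphi (gam^-1 * g x) | x in
  [set x | 0 <= x /\ b^-1 * x <= gam^-1 * g x]].
have bV0 : 0 < b^-1 by rewrite invr_gt0.
have gV0 : 0 < gam^-1 by rewrite invr_gt0.
have ga0 x : 0 <= x -> 0 <= gam^-1 * g x by move=> x0; rewrite mulr_ge0 ?g_ge0// ltW.
have ba0 x : 0 <= x -> 0 <= b^-1 * x by move=> x0; rewrite mulr_ge0// ltW.
have Sub : has_ubound S.
  exists L => _ [x [x0 _] <-].
  by have [/andP[_]] := h _ (ga0 x x0).
pose ell := sup S.
have ell0 : 0 <= ell.
  have [S0|/set0P[z Sz]] := eqVneq S set0; first by rewrite /ell S0 sup0.
  apply: le_trans (sup_ubound Sub Sz); case: Sz => x [x0 _] <-.
  by have [/andP[+ _]] := h _ (ga0 x x0).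
have ptw x : 0 <= x ->
    phi (gam^-1 * g x) + ell * (b^-1 * x) <= phi (b^-1 * x) + ell * (gam^-1 * g x).
  move=> x0; have [/andP[d0 _] /(_ _ (ba0 x x0)) hb] := h _ (ga0 x x0).
  suff : (ell - dphi (gam^-1 * g x)) * (b^-1 * x - gam^-1 * g x) <= 0.
    by move: (dphi _) hb => D hb; lra.
  have [le|lt] := leP (b^-1 * x) (gam^-1 * g x).
    have le1 : dphi (gam^-1 * g x) <= ell by apply: sup_ubound => //; exists x.
    by rewrite mulr_ge0_le0 ?subr_ge0 ?subr_le0.
  have le1 : ell <= dphi (gam^-1 * g x).
    have [S0|/set0P S0] := eqVneq S set0; first by rewrite /ell S0 sup0.
    apply: sup_le_ub => // _ [x' [x'0 le'] <-].
    apply: (subgradient_mono h (ga0 _ x'0)); rewrite ler_pM2l//; apply: g_mono => //.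
    rewrite leNgt; apply/negP => xx'.
    have xpos : 0 < x.
      rewrite -(pmulr_rgt0 x bV0); apply: le_lt_trans lt; exact: ga0.
    have x'pos : 0 < x' := lt_trans xpos xx'.
    have := g_ratio xpos (ltW xx'); rewrite ler_pdivrMr// leNgt => /negP; apply.
    rewrite mulrAC ltr_pdivrMr//.
    have l1 : b * g x < gam * x.
      by move: lt; rewrite ltr_pdivlMl// mulrCA ltr_pdivrMl.
    have l2 : gam * x' <= b * g x'.
      by move: le'; rewrite ler_pdivrMl// mulrCA ler_pdivlMl.
    rewrite -(ltr_pM2l b0) mulrA [b * (g x' * x)]mulrA.
    apply: (@lt_le_trans _ _ (gam * x * x')); first by rewrite ltr_pM2r.
    by rewrite mulrAC ler_wpM2r// ltW.
  by rewrite mulr_le0_ge0 ?subr_ge0 ?subr_le0// ltW.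
have mphi (f : R -> R) : measurable_fun setT (fun w => f (A u w)).
  exact: (tree_var_measurable u (tree_var_comp f tA)).
have : (mean P (fun w => phi (gam^-1 * g (A u w)) + ell * (b^-1 * A u w))%R <=
    mean P (fun w => phi (b^-1 * A u w) + ell * (gam^-1 * g (A u w)))%R)%E.
  apply: le_mean.
  - exact: (mphi (fun x => phi (gam^-1 * g x) + ell * (b^-1 * x))).
  - exact: (mphi (fun x => phi (b^-1 * x) + ell * (gam^-1 * g x))).
  - by move=> w; rewrite addr_ge0// mulr_ge0// ba0.
  - by move=> w; exact: ptw.
have mg : measurable_fun setT (fun w => g (A u w)) by exact: (mphi g).
have mA : measurable_fun setT (A u) := tree_var_measurable u tA.
have one (c : R) (X : Omega -> R) : 0 < c -> measurable_fun setT X ->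
    (forall w, 0 <= X w) -> mean P X = c%:E ->
    mean P (fun w => ell * (c^-1 * X w)) = ell%:E.
  move=> c0 mX X0 Xc; have cV0 : 0 <= c^-1 by rewrite invr_ge0 ltW.
  rewrite (meanZ P (X := fun w => c^-1 * X w))//.
  - by rewrite meanZ// Xc -!EFinM mulVf ?gt_eqF// mulr1.
  - exact: measurable_funM.
  - by move=> w; exact: mulr_ge0.
rewrite (meanD P (mphi (fun x => phi (gam^-1 * g x)))
  (mphi (fun x => ell * (b^-1 * x))))//; last first.
  by move=> w; rewrite mulr_ge0// ba0.
rewrite (meanD P (mphi (fun x => phi (b^-1 * x)))
  (mphi (fun x => ell * (gam^-1 * g x))))//; last first.
  by move=> w; rewrite mulr_ge0// ga0.
rewrite one// one//; last by move=> w; exact: g_ge0.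
by rewrite leeD2rE.
Qed.

End ConcaveImage.

(** * Limits of powers and of weighted averages *)

Section Averages.
Context {R : realType}.

Lemma powRV (x t : R) : 0 <= x -> x^-1 `^ t = (x `^ t)^-1.
Proof.
move=> x0; rewrite -[X in X `^ _]powR_inv1// -powRrM [X in _ `^ X]mulrC powRrM.
by rewrite powR_inv1 ?powR_ge0.
Qed.

Lemma powR_cvg (T : Type) (F : set_system T) {FF : Filter F} (u : T -> R) (l t : R) :
  0 < l -> u x @[x --> F] --> l -> u x `^ t @[x --> F] --> l `^ t.
Proof.
move=> l0 ul.
have h : expR (t * ln (u x)) @[x --> F] --> expR (t * ln l).
  apply: continuous_cvg; first exact: continuous_expR.
  apply: cvgM; first exact: cvg_cst.
  by apply: continuous_cvg => //; exact: continuous_ln.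
have u0 : \forall x \near F, 0 < u x by exact: (cvgr_gt l ul).
rewrite {2}/powR (gt_eqF l0); apply: cvg_trans h; apply: near_eq_cvg.
by apply: filterS u0 => x ux; rewrite /powR gt_eqF.
Qed.

Lemma powRX (x t : R) n : 0 <= x -> (x `^ t) ^+ n = (x ^+ n) `^ t.
Proof.
move=> x0; rewrite -(powR_mulrn n (powR_ge0 x t)) -(powR_mulrn n x0).
by rewrite -!powRrM mulrC.
Qed.

Lemma exprn_cvg (T : Type) (F : set_system T) {FF : Filter F} (u : T -> R) (l : R) n :
  u x @[x --> F] --> l -> u x ^+ n @[x --> F] --> l ^+ n.
Proof.
move=> ul; apply: (@continuous_cvg _ _ _ _ FF u (fun x : R => x ^+ n) l _ ul).
exact: exprn_continuous.
Qed.

(** Averages of e against geometric weights of ratio tending to 1: any fixed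
    number of weights is negligible, as each of them is comparable with the M
    following ones. *)
Lemma weighted_average_cvg (q : nat -> R) (e : nat -> nat -> R) (A : R) :
  (forall n, 0 < q n) -> q n @[n --> \oo] --> (1 : R) ->
  (forall eps, 0 < eps -> exists K, \forall n \near \oo,
     forall k, (K <= k)%N -> `|e n k - A| <= eps) ->
  (forall K, exists C, \forall n \near \oo, forall k, (k < K)%N -> `|e n k| <= C) ->
  (\sum_(0 <= k < n.+1) q n ^+ (n.+1 - k) * e n k) /
  (\sum_(0 <= k < n.+1) q n ^+ (n.+1 - k)) @[n --> \oo] --> A.
Proof.
move=> q0 q1 he hC; apply/cvgrPdist_le => eps eps0.
have eps2 : 0 < eps / 2 by rewrite divr_gt0.
have [K hK] := he _ eps2; have [C hCK] := hC K.
pose D := `|C| + `|A|.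
have D0 : 0 <= D by exact: addr_ge0.
pose M := (Num.bound (2 * (expR 1 * K%:R * D) / eps)).+1.
have M0 : (0 : R) < M%:R by [].
have MD : expR 1 * K%:R * D / M%:R <= eps / 2.
  rewrite ler_pdivrMr//.
  have : 2 * (expR 1 * K%:R * D) / eps < M%:R.
    apply: lt_le_trans (archi_boundP _) _; last by rewrite ler_nat leqnSn.
    by rewrite divr_ge0 ?(ltW eps0)// !mulr_ge0 ?expR_ge0.
  rewrite ltr_pdivrMr//; lra.
have eM : 1 < expR M%:R^-1 :> R by rewrite expR_gt1 invr_gt0.
near=> n.
have hKn : forall k, (K <= k)%N -> `|e n k - A| <= eps / 2 by near: n; exact: hK.
have hCn : forall k, (k < K)%N -> `|e n k| <= C by near: n; exact: hCK.
have qM : q n < expR M%:R^-1 by near: n; exact: (cvgr_lt 1 q1).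
have nKM : (K + M <= n)%N by near: n; exists (K + M)%N.
pose w k := q n ^+ (n.+1 - k).
have w0 k : 0 < w k by exact: exprn_gt0.
pose Sw := \sum_(0 <= k < n.+1) w k.
have Sw0 : 0 < Sw.
  rewrite /Sw big_nat_recr//=; apply: ltr_wpDl => //.
  by apply: sumr_ge0 => k _; exact: ltW.
rewrite -/Sw; have -> : A - (\sum_(0 <= k < n.+1) q n ^+ (n.+1 - k) * e n k) / Sw =
    - ((\sum_(0 <= k < n.+1) w k * (e n k - A)) / Sw).
  have -> : \sum_(0 <= k < n.+1) w k * (e n k - A) =
    \sum_(0 <= k < n.+1) w k * e n k - Sw * A.
    by rewrite /Sw mulr_suml -sumrB; apply: eq_bigr => k _; rewrite mulrBr.
  by rewrite mulrBl mulrAC divff ?gt_eqF// mul1r opprB.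
rewrite normrN normrM normfV (gtr0_norm Sw0) ler_pdivrMr//.
apply: le_trans (ler_norm_sum _ _ _) _.
have small k : (k < K)%N -> w k <= expR 1 / M%:R * Sw.
  move=> kK; rewrite mulrAC ler_pdivlMr//.
  apply: (@le_trans _ _ (expR 1 * \sum_(k <= j < k + M) w j)); last first.
    rewrite ler_wpM2l ?expR_ge0// /Sw.
    have kM : (k + M <= n.+1)%N.
      by rewrite (leq_trans _ (leqW nKM))// leq_add2r ltnW.
    rewrite (big_cat_nat (n := k) (leq0n k))/=; last first.
      by apply: leq_trans kM; exact: leq_addr.
    rewrite (big_cat_nat (n := (k + M)%N) (leq_addr _ _) kM)/=.
    rewrite addrCA lerDl addr_ge0// sumr_ge0// => j _; exact: ltW.
  have -> : w k * M%:R = \sum_(k <= j < k + M) w k.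
    by rewrite sumr_const_nat addKn mulr_natr.
  rewrite mulr_sumr; apply: ler_sum_nat => j /andP[kj jkM].
  have jn : (j <= n.+1)%N.
    apply: leq_trans (ltnW jkM) _; apply: leq_trans (leqW nKM).
    by rewrite leq_add2r ltnW.
  have -> : w k = q n ^+ (j - k) * w j.
    by rewrite /w -exprD addnC addnBA// subnK.
  rewrite ler_pM2r//.
  apply: (@le_trans _ _ (expR M%:R^-1 ^+ (j - k))).
    by apply: lerXn2r; rewrite ?nnegrE ?expR_ge0// ltW.
  rewrite -expRM_natr ler_expR mulrC ler_pdivrMr// mul1r ler_nat.
  by rewrite leq_subLR ltnW.
have Kn : (K <= n.+1)%N.
  by apply: leq_trans (leqW nKM); exact: leq_addr.
rewrite (big_cat_nat (n := K) (leq0n K) Kn)/=.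
have -> : eps * Sw = eps / 2 * Sw + eps / 2 * Sw by rewrite -mulrDl -splitr.
apply: lerD.
  apply: (@le_trans _ _ (\sum_(0 <= k < K) expR 1 / M%:R * Sw * D)).
    apply: ler_sum_nat => k /andP[_ kK]; rewrite normrM (gtr0_norm (w0 k)).
    apply: ler_pM => //; [exact: ltW|exact: small|].
    apply: le_trans (ler_normB _ _) _; rewrite lerD2r.
    exact: le_trans (hCn k kK) (ler_norm _).
  rewrite sumr_const_nat subn0 -[leLHS]mulr_natr.
  have -> : expR 1 / M%:R * Sw * D * K%:R = expR 1 * K%:R * D / M%:R * Sw by ring.
  by rewrite ler_pM2r.
apply: (@le_trans _ _ (\sum_(K <= k < n.+1) eps / 2 * w k)).
  apply: ler_sum_nat => k /andP[Kk _].
  by rewrite normrM (gtr0_norm (w0 k)) mulrC ler_pM2r// hKn.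
rewrite -mulr_sumr ler_wpM2l ?(ltW eps2)// /Sw.
rewrite (big_cat_nat (n := K) (leq0n K) Kn)/= lerDr.
by apply: sumr_ge0 => k _; exact: ltW.
Unshelve. all: by end_near. Qed.

End Averages.

(** * The recursion with a finite value at the leaves *)

(** Here Q is compared with c3 y up to an error c1 y and up to a tail c2 (y - f),
    where both f and y are within eta below A. *)
Lemma norm_le_of_bounds (R : realType) (Q y f A c1 c2 c3 eta eps : R) :
  0 <= c1 -> 0 <= c2 -> 0 <= c3 -> 0 <= eta ->
  Q + c2 * f <= (c3 + c1 + c2) * y -> c3 * y + c2 * f <= Q + (c1 + c2) * y ->
  c1 * A <= eps / 2 -> (c2 + c3) * eta <= eps / 2 ->
  A - eta <= f -> f <= y -> y <= A -> `|Q - c3 * A| <= eps.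
Proof.
move=> c10 c20 c30 eta0 up lo h1 h2 fl fy yl.
have h3 : c1 * y <= c1 * A by rewrite ler_wpM2l.
have h4 : c2 * (y - f) <= c2 * eta by rewrite ler_wpM2l//; lra.
have h5 : c3 * (A - y) <= c3 * eta by rewrite ler_wpM2l//; lra.
have h6 : 0 <= c3 * (A - y) by rewrite mulr_ge0// subr_ge0.
have h7 : 0 <= c3 * eta by rewrite mulr_ge0.
by rewrite ler_norml; apply/andP; split; lra.
Qed.

Section ConductanceRecursion.
Context {R : realType} {mu : probability nat R}.
Context {d : measure_display} {Omega : measurableType d}.
Context {P : probability Omega R} {N : seq nat -> {RV P >-> nat}}.
Hypothesis N_GW : galton_watson mu N.
Context {m : R}.
Hypothesis mE : offspring_mean mu = m%:E.
Hypothesis m_gt1 : 1 < m.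
Context {s : R}.
Hypothesis s_gt0 : 0 < s.
Hypothesis Zs : (offspring_moment mu (s + 1) < +oo)%E.
Context {g : R -> R} {kappa1 kappa2 ginf : R}.
Hypothesis g_ge0 : forall x, 0 <= x -> 0 <= g x.
Hypothesis g_concave : concave_on_nonneg g.
Hypotheses (kappa1_gt0 : 0 < kappa1) (kappa2_gt0 : 0 < kappa2).
Hypothesis g_bounds : forall x, 0 < x ->
    x / (1 + kappa1 * x `^ s) `^ (s^-1) <= g x <=
    x / (1 + kappa2 * x `^ s) `^ (s^-1).
Hypotheses (ginf_gt0 : 0 < ginf) (g_le_ginf : forall x, 0 <= x -> g x <= ginf).
Local Notation tree_var := (tree_var N).
Local Notation child_sum := (child_sum N).
Local Notation branch := (@branch _ _ _ _ N m).
Local Notation W := (@normalized_size _ _ _ _ N m).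
Local Notation EW := (limit_moment (P := P) (N := N) (m := m) (p := s + 1)).
Implicit Types (r : R) (k : nat).

Let m_gt0 : 0 < m. Proof. exact: lt_trans m_gt1. Qed.
Let p_gt1 : 1 < s + 1. Proof. by rewrite ltrDr. Qed.
Let gmono := g_mono g_ge0 g_concave.
Let gratio := g_ratio s_gt0 g_ge0 g_concave kappa1_gt0 kappa2_gt0 g_bounds.
Let gle := g_le s_gt0 g_ge0 g_concave kappa1_gt0 kappa2_gt0 g_bounds.
Let gscale := g_scale s_gt0 g_ge0 g_concave kappa1_gt0 kappa2_gt0 g_bounds.
Let ggt0 := g_gt0 kappa1_gt0 g_bounds.

(** The function g of the solution, in a tree of height k.  The number ginf stands
    for g (+oo), which keeps the recursion within the reals. *)
Fixpoint gvalue r k : seq nat -> Omega -> R :=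
  if k is k'.+1 then fun u w => g (r * child_sum (gvalue r k') u w)
  else fun _ _ => ginf.

(** The solution of the recursion in a tree of height k + 1. *)
Definition value r k u w : R := r * child_sum (gvalue r k) u w.

Definition mean_value r k : R := fine (mean P (value r k [::])).

Definition mean_gvalue r k : R := fine (mean P (gvalue r k [::])).

Local Notation b := mean_value.
Local Notation gam := mean_gvalue.

Lemma tree_var_gvalue r k : tree_var (gvalue r k).
Proof.
elim: k => [|k IH]; first exact: tree_var_cst.
exact: (tree_var_comp (fun x => g (r * x)) (tree_var_child_sum IH)).
Qed.

Lemma tree_var_value r k : tree_var (value r k).
Proof.
exact: (tree_var_comp (fun x => r * x) (tree_var_child_sum (tree_var_gvalue r k))).
Qed.

Lemma gvalue_ge0 r k u w : 0 <= r -> 0 <= gvalue r k u w.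
Proof.
move=> r0; elim: k u w => [|k IH] u w /=; first exact: ltW.
by apply: g_ge0; rewrite mulr_ge0// child_sum_ge0.
Qed.

Lemma value_ge0 r k u w : 0 <= r -> 0 <= value r k u w.
Proof.
by move=> r0; rewrite mulr_ge0// child_sum_ge0// => *; exact: gvalue_ge0.
Qed.

Lemma gvalue_le r k u w : 0 <= r -> gvalue r k u w <= ginf.
Proof.
move=> r0; case: k => [|k] //=; apply: g_le_ginf.
exact: (value_ge0 k u w r0).
Qed.

Lemma mean_gvalueE r k u : 0 <= r -> mean P (gvalue r k u) = (gam r k)%:E.
Proof.
move=> r0; have tG := tree_var_gvalue r k.
rewrite (mean_law_ge0 N_GW u [::] tG); last by move=> *; exact: gvalue_ge0.
rewrite /mean_gvalue fineK// ge0_fin_numE; last first.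
  by apply: mean_ge0 => w; exact: gvalue_ge0.
apply: (@le_lt_trans _ _ (mean P (fun=> ginf))); last by rewrite mean_cst ltry.
apply: le_mean => //; first exact: (tree_var_measurable [::] tG).
  by move=> w; exact: gvalue_ge0.
by move=> w; exact: gvalue_le.
Qed.

Lemma value_branch r k u w : value r k u w = m * r * branch (gvalue r k) u w.
Proof. by rewrite /value /branch mulrACA divff ?gt_eqF// mul1r. Qed.

Lemma mean_valueE r k u : 0 <= r -> mean P (value r k u) = (b r k)%:E.
Proof.
move=> r0.
have h v : mean P (value r k v) = (m * r * gam r k)%:E.
  rewrite (eq_mean P (value_branch r k v)) meanZ//.
  - rewrite (mean_branch N_GW mE m_gt1 v [::]) ?mean_gvalueE//.
      exact: tree_var_gvalue.
    by move=> *; exact: gvalue_ge0.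
  - exact: (tree_var_measurable v (tree_var_branch (tree_var_gvalue r k))).
  - by move=> w; apply: (branch_ge0 m_gt1) => *; exact: gvalue_ge0.
  - by rewrite mulr_ge0// ltW.
by rewrite /mean_value !h.
Qed.

Lemma mean_value_gvalue r k : 0 <= r -> b r k = m * r * gam r k.
Proof.
move=> r0; apply: EFin_inj; rewrite -(mean_valueE k [::])//.
rewrite (eq_mean P (value_branch r k [::])) meanZ//.
- rewrite (mean_branch N_GW mE m_gt1 [::] [::]) ?mean_gvalueE//.
    exact: tree_var_gvalue.
  by move=> *; exact: gvalue_ge0.
- exact: (tree_var_measurable [::] (tree_var_branch (tree_var_gvalue r k))).
- by move=> w; apply: (branch_ge0 m_gt1) => *; exact: gvalue_ge0.
- by rewrite mulr_ge0// ltW.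
Qed.

Lemma mean_value0 r : 0 <= r -> b r 0 = m * r * ginf.
Proof.
move=> r0; rewrite mean_value_gvalue//; congr (_ * _); apply: EFin_inj.
by rewrite -(mean_gvalueE 0 [::])// mean_cst.
Qed.

Lemma mean_gvalue_gt0 r k : 0 < r -> 0 < gam r k.
Proof.
move=> r0; have r0' := ltW r0; elim: k => [|k IH].
  rewrite (_ : gam r 0 = ginf)//; apply: EFin_inj.
  by rewrite -(mean_gvalueE 0 [::])// mean_cst.
have bk : 0 < b r k by rewrite mean_value_gvalue// !mulr_gt0.
have ge : 0 <= gam r k.+1.
  rewrite -lee_fin -(mean_gvalueE k.+1 [::])//.
  by apply: mean_ge0 => w; exact: gvalue_ge0.
rewrite lt_neqAle ge andbT; apply/eqP => gam0.
(* otherwise g (value) = 0 almost surely, hence value = 0 almost surely *)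
have mG := tree_var_measurable [::] (tree_var_gvalue r k.+1).
have mX := tree_var_measurable [::] (tree_var_value r k).
have G0 : (\int[P]_w `|(gvalue r k.+1 [::] w)%:E| = 0)%E.
  transitivity (mean P (gvalue r k.+1 [::])); last by rewrite mean_gvalueE// -gam0.
  by apply: eq_integral => w _; rewrite abse_EFin ger0_norm// gvalue_ge0.
have aeG : ae_eq P setT (EFin \o gvalue r k.+1 [::]) (cst 0%E).
  by apply/ae_eq_integral_abs => //; exact/measurable_EFinP.
have aeX : ae_eq P setT (EFin \o value r k [::]) (cst 0%E).
  apply: filterS aeG => w /= /(_ I) [h] _.
  congr (_%:E); apply/eqP; rewrite eq_le value_ge0// andbT leNgt; apply/negP => X0.
  by have := ggt0 X0; rewrite /value h ltxx.
have := mean_valueE k [::] r0'.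
rewrite /mean (ae_eq_integral (cst 0%E))//; last exact/measurable_EFinP.
by rewrite integral0 => -[e]; move: bk; rewrite -e ltxx.
Qed.

Lemma mean_value_gt0 r k : 0 < r -> 0 < b r k.
Proof.
by move=> r0; rewrite mean_value_gvalue ?ltW// !mulr_gt0// mean_gvalue_gt0.
Qed.

(** The relative loss of mean when passing from value to g (value). *)
Definition loss r k : R := 1 - gam r k.+1 / b r k.

Lemma mean_value_loss r k : 0 < r -> b r k.+1 = m * r * (1 - loss r k) * b r k.
Proof.
move=> r0; rewrite mean_value_gvalue ?(ltW r0)// /loss subKr.
by field; rewrite gt_eqF// mean_value_gt0.
Qed.

Lemma mean_defect r k : 0 < r ->
  mean P (fun w => value r k [::] w - g (value r k [::] w)) =
  (loss r k * b r k)%:E.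
Proof.
move=> r0; have r0' := ltW r0; have b0 := mean_value_gt0 k r0.
have tX := tree_var_value r k.
have X0 w : 0 <= value r k [::] w by exact: value_ge0.
have mD : measurable_fun setT (fun w => value r k [::] w - g (value r k [::] w)).
  exact: (tree_var_measurable [::] (tree_var_comp (fun x => x - g x) tX)).
have mG := tree_var_measurable [::] (tree_var_gvalue r k.+1).
have h : (mean P (fun w => (value r k [::] w - g (value r k [::] w))%R) +
    (gam r k.+1)%:E)%E = (b r k)%:E.
  rewrite -(mean_gvalueE k.+1 [::])// -(mean_valueE k [::])// -meanD//.
  - by apply: eq_mean => w; rewrite /= subrK.
  - by move=> w; rewrite subr_ge0 gle.
  - by move=> w; exact: gvalue_ge0.
rewrite -[LHS](addeK _ (_ : (gam r k.+1)%:E \is a fin_num))// h -EFinB.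
congr (_%:E); rewrite /loss; field; by rewrite gt_eqF.
Qed.

Lemma loss_ge0 r k : 0 < r -> 0 <= loss r k.
Proof.
move=> r0; rewrite -(pmulr_lge0 _ (mean_value_gt0 k r0)) -lee_fin -mean_defect//.
by apply: mean_ge0 => w; rewrite subr_ge0 gle// value_ge0// ltW.
Qed.

Lemma loss_lt1 r k : 0 < r -> loss r k < 1.
Proof.
by move=> r0; rewrite gtrBl divr_gt0// ?mean_gvalue_gt0// mean_value_gt0.
Qed.

(** The solution divided by its mean.  Written as the branching of the normalized
    gvalue, it can be compared with the martingale W step by step. *)
Definition unit_value r k u w : R := branch (fun u w => (gam r k)^-1 * gvalue r k u w) u w.

Lemma unit_valueE r k u w : 0 < r -> unit_value r k u w = (b r k)^-1 * value r k u w.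
Proof.
move=> r0; rewrite value_branch mean_value_gvalue ?ltW// /unit_value.
rewrite /branch child_sumZ; field.
by rewrite !gt_eqF// mean_gvalue_gt0.
Qed.

Let unit_gvalue r k u w : R := (gam r k)^-1 * gvalue r k u w.

Let tree_var_unit_gvalue r k : tree_var (unit_gvalue r k).
Proof. exact: (tree_var_comp (fun x => _ * x) (tree_var_gvalue r k)). Qed.

Let unit_gvalue_ge0 r k u w : 0 < r -> 0 <= unit_gvalue r k u w.
Proof.
by move=> r0; rewrite mulr_ge0 ?gvalue_ge0 ?invr_ge0// ltW// mean_gvalue_gt0.
Qed.

Lemma tree_var_unit_value r k : tree_var (unit_value r k).
Proof. exact: (tree_var_branch (tree_var_unit_gvalue r k)). Qed.

Lemma unit_value_ge0 r k u w : 0 < r -> 0 <= unit_value r k u w.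
Proof.
by move=> r0; apply: (branch_ge0 m_gt1) => *; exact: unit_gvalue_ge0.
Qed.

Lemma mean_unit_value r k u : 0 < r -> mean P (unit_value r k u) = 1%E.
Proof.
move=> r0; rewrite (eq_mean P (fun w => unit_valueE k u w r0)) meanZ.
- by rewrite mean_valueE ?ltW// -EFinM mulVf// gt_eqF// mean_value_gt0.
- exact: (tree_var_measurable u (tree_var_value r k)).
- by move=> w; apply: value_ge0; exact: ltW.
- by rewrite invr_ge0 ltW// mean_value_gt0.
Qed.

(** Applying g makes the normalized solution less spread out. *)
Let cx_le_unit_gvalue r k u : 0 < r ->
  cx_le P 0 (unit_gvalue r k.+1 u) (unit_value r k u).
Proof.
move=> r0; rewrite (_ : unit_value r k u = fun w => (b r k)^-1 * value r k u w).
  apply: (cx_le_concave_image g_ge0 gmono gratio (tree_var_value r k)).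
  - by move=> *; apply: value_ge0; exact: ltW.
  - exact: mean_value_gt0.
  - exact: mean_gvalue_gt0.
  - by rewrite mean_valueE// ltW.
  - exact: (mean_gvalueE k.+1 u (ltW r0)).
by apply/funext => w; exact: unit_valueE.
Qed.

(** By induction: the recursion applies g before each branching, which makes the
    variable less spread out, and branching preserves the order. *)
Lemma unit_value_cx_le_W r k u : 0 < r -> cx_le P 0 (unit_value r k u) (W k.+1 u).
Proof.
move=> r0; elim: k u => [|k IH] u.
  rewrite (_ : unit_value r 0 u = W 1 u); first exact: cx_le_refl.
  apply/funext => w; rewrite unit_valueE// value_branch mean_value0 ?ltW//.
  rewrite /= /branch !child_sum_cst.
  rewrite -[ginf *+ _]mulr_natl; field; rewrite !gt_eqF//.
apply: (cx_le_branch N_GW mE m_gt1) => //.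
- exact: tree_var_unit_gvalue.
- exact: (tree_var_W k.+1).
- by move=> *; exact: unit_gvalue_ge0.
- by move=> *; exact: (W_ge0 m_gt1 k.+1).
by have := cx_le_trans (cx_le_unit_gvalue k [::] r0) (IH [::]); rewrite addr0.
Qed.

Lemma unit_value_moment r k : 0 < r ->
  (mean P (fun w => (unit_value r k [::] w `^ (s + 1))%R) <= EW%:E)%E.
Proof.
move=> r0; apply: (mean_powR_le_limit_moment N_GW mE m_gt1 p_gt1 Zs (n := k.+1)).
- exact: (tree_var_measurable [::] (tree_var_unit_value r k)).
- by move=> w; exact: unit_value_ge0.
- exact: unit_value_cx_le_W.
Qed.

(** By the pointwise bound on the defect x - g x, the loss is at most a moment of
    order s + 1, which the comparison with W bounds uniformly. *)
Lemma loss_le r k : 0 < r -> loss r k <= kappa1 / s * EW * b r k `^ s.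
Proof.
move=> r0; have b0 := mean_value_gt0 k r0.
have r0' := ltW r0; have tX := tree_var_value r k.
have dl := defect_le s_gt0 g_ge0 g_concave kappa1_gt0 kappa2_gt0 g_bounds.
have p0 : 0 < s + 1 by rewrite addr_gt0.
have k0 : 0 <= kappa1 / s by rewrite divr_ge0// ltW.
have K0 : 0 <= kappa1 / s * b r k `^ (s + 1) by rewrite mulr_ge0 ?powR_ge0.
rewrite -(ler_pM2r b0) -lee_fin -mean_defect//.
have mY : measurable_fun setT (fun w => unit_value r k [::] w `^ (s + 1)).
  exact: (tree_var_measurable [::]
    (tree_var_comp (fun x => x `^ (s + 1)) (tree_var_unit_value r k))).
apply: (@le_trans _ _ (mean P (fun w =>
    (kappa1 / s * b r k `^ (s + 1) * unit_value r k [::] w `^ (s + 1))%R))).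
  apply: le_mean.
  - exact: (tree_var_measurable [::] (tree_var_comp (fun x => x - g x) tX)).
  - exact: measurable_funM.
  - by move=> w; rewrite subr_ge0 gle// value_ge0.
  move=> w; apply: le_trans (dl _ (value_ge0 k [::] w r0')) _.
  rewrite unit_valueE// -[leRHS]mulrA ler_wpM2l// -powRM ?(ltW b0)//.
    by rewrite mulrA divff ?gt_eqF// mul1r.
  by rewrite mulr_ge0 ?value_ge0// invr_ge0 ltW.
rewrite meanZ//; last by move=> w; exact: powR_ge0.
have KE0 : (0 <= (kappa1 / s * b r k `^ (s + 1))%R%:E)%E by rewrite lee_fin.
apply: le_trans (lee_wpmul2l KE0 (unit_value_moment k r0)) _.
rewrite -EFinM lee_fin -[X in X `^ (s + 1)]/(b r k).
have -> : b r k `^ (s + 1) = b r k * b r k `^ s.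
  by rewrite -(mulr_powRB1 (ltW b0) p0) addrK.
by rewrite le_eqVlt; apply/orP; left; apply/eqP; ring.
Qed.

Definition coupling_error r k : R := 2 * loss r k / (1 - loss r k).

Lemma coupling_error_ge0 r k : 0 < r -> 0 <= coupling_error r k.
Proof.
move=> r0; rewrite divr_ge0 ?mulr_ge0 ?loss_ge0// subr_ge0.
by rewrite ltW// loss_lt1.
Qed.

(** The normalizations before and after applying g are at L^1-distance at most
    the coupling error. *)
Let unit_value_cx_le_gvalue r k : 0 < r ->
  cx_le P (coupling_error r k) (unit_value r k [::]) (unit_gvalue r k.+1 [::]).
Proof.
move=> r0 L phi cphi; have [phi0 _] := cphi; have L0 := convex_lip_ge0 cphi.
have r0' := ltW r0; have b0 := mean_value_gt0 k r0.
have g0 := mean_gvalue_gt0 k.+1 r0.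
have gb : gam r k.+1 <= b r k.
  by have := loss_ge0 k r0; rewrite subr_ge0 ler_pdivrMr// mul1r.
have tX := tree_var_value r k.
have X0 w : 0 <= value r k [::] w by exact: value_ge0.
have mphi (f : R -> R) : measurable_fun setT (fun w => f (value r k [::] w)).
  exact: (tree_var_measurable [::] (tree_var_comp f tX)).
pose c := (gam r k.+1)^-1 - (b r k)^-1.
have c0 : 0 <= c by rewrite subr_ge0 lef_pV2// posrE.
have gV0 : 0 <= (gam r k.+1)^-1 by rewrite invr_ge0 ltW.
pose D w := L * ((gam r k.+1)^-1 * (value r k [::] w - g (value r k [::] w)) +
  c * value r k [::] w).
have D0 w : 0 <= D w.
  by rewrite mulr_ge0// addr_ge0// mulr_ge0// subr_ge0 gle.
apply: (@le_trans _ _ (mean P (fun w => (phi (unit_gvalue r k.+1 [::] w) + D w)%R))).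
  apply: le_mean.
  - exact: (tree_var_measurable [::] (tree_var_comp phi (tree_var_unit_value r k))).
  - apply: measurable_funD.
      exact: (tree_var_measurable [::] (tree_var_comp phi (tree_var_unit_gvalue r k.+1))).
    exact: (mphi (fun x => L * ((gam r k.+1)^-1 * (x - g x) + c * x))).
  - by move=> w; exact: phi0.
  move=> w; have u0 := unit_value_ge0 k [::] w r0.
  have v0 := unit_gvalue_ge0 k.+1 [::] w r0.
  (* both normalizations of the value differ through x - g x and through
     1 / gam - 1 / b, and each contributes half of the coupling error *)
  apply: le_trans (convex_lip_lip cphi u0 v0) _.
  rewrite lerD2l ler_wpM2l// unit_valueE// /unit_gvalue /= -/(value r k [::] w).
  have -> : (b r k)^-1 * value r k [::] w - (gam r k.+1)^-1 * g (value r k [::] w)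
    = (gam r k.+1)^-1 * (value r k [::] w - g (value r k [::] w)) -
      c * value r k [::] w by rewrite /c; ring.
  apply: le_trans (ler_normB _ _) _.
  by rewrite !ger0_norm// mulr_ge0// subr_ge0 gle.
rewrite meanD//; last 2 first.
- exact: (tree_var_measurable [::] (tree_var_comp phi (tree_var_unit_gvalue r k.+1))).
- exact: (mphi (fun x => L * ((gam r k.+1)^-1 * (x - g x) + c * x))).
rewrite leeD2l//.
have mDf := mphi (fun x => x - g x).
have mX := mphi id.
have df0 w : 0 <= value r k [::] w - g (value r k [::] w) by rewrite subr_ge0 gle.
have -> : mean P D = (L * ((gam r k.+1)^-1 * (loss r k * b r k) + c * b r k))%:E.
  rewrite /D (meanZ P (X := fun w => (gam r k.+1)^-1 *
    (value r k [::] w - g (value r k [::] w)) + c * value r k [::] w))//; last 2 first.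
  - exact: (mphi (fun x => (gam r k.+1)^-1 * (x - g x) + c * x)).
  - by move=> w; rewrite addr_ge0// mulr_ge0.
  rewrite EFinM; congr (_ * _)%E.
  rewrite (meanD P (mphi (fun x => (gam r k.+1)^-1 * (x - g x))) (mphi (fun x => c * x)))//.
  - rewrite EFinD; congr (_ + _)%E.
      by rewrite [LHS](meanZ P mDf)// mean_defect// -EFinM.
    by rewrite [LHS](meanZ P mX)// mean_valueE// -EFinM.
  - by move=> w; rewrite mulr_ge0.
  - by move=> w; rewrite mulr_ge0.
rewrite lee_fin ler_wpM2l// le_eqVlt; apply/orP; left; apply/eqP.
rewrite /c /coupling_error /loss; field.
by rewrite subKr !gt_eqF.
Qed.

(** The reverse comparison: along j generations the coupling errors add up, since
    the normalized branching does not amplify them. *)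
Lemma W_cx_le_unit_value r j k : 0 < r ->
  cx_le P (\sum_(0 <= i < j) coupling_error r (k + i)) (W j [::])
    (unit_value r (k + j) [::]).
Proof.
move=> r0; elim: j => [|j IH].
  rewrite big_nil addn0; apply: (cx_le_mean1 (tree_var_unit_value r k)).
    by move=> *; exact: unit_value_ge0.
  exact: mean_unit_value.
rewrite big_nat_recr//= addnS; apply: (cx_le_branch N_GW mE m_gt1).
- by rewrite addr_ge0 ?coupling_error_ge0// sumr_ge0// => i _; exact: coupling_error_ge0.
- exact: tree_var_W.
- exact: tree_var_unit_gvalue.
- by move=> *; exact: (W_ge0 m_gt1).
- by move=> *; exact: unit_gvalue_ge0.
- exact: (cx_le_trans IH (unit_value_cx_le_gvalue (k + j) r0)).
Qed.

(** * Parameters near the critical one *)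

Let m_neq0 : m != 0. Proof. by rewrite gt_eqF. Qed.
Let p_gt0 : 0 < s + 1. Proof. by rewrite addr_gt0. Qed.
Let glt := g_lt s_gt0 kappa2_gt0 g_bounds.
Let b_gt0 r k : 0 < r -> 0 < b r k.
Proof. exact: (mean_value_gt0). Qed.
Let b_mean r k u : 0 <= r -> mean P (value r k u) = (b r k)%:E.
Proof. exact: (mean_valueE). Qed.
Let v0 r k u w : 0 <= r -> 0 <= value r k u w.
Proof. exact: (value_ge0). Qed.
Let vG0 r k u w : 0 <= r -> 0 <= gvalue r k u w.
Proof. exact: (gvalue_ge0). Qed.
Let mvalue r k u : measurable_fun setT (value r k u).
Proof. exact: (tree_var_measurable u (tree_var_value r k)). Qed.

Lemma gvalue_decr r k u w : 0 <= r -> gvalue r k.+1 u w <= gvalue r k u w.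
Proof.
move=> r0; elim: k u w => [|k IH] u w.
  by apply: g_le_ginf; exact: (v0 0 u w r0).
apply: gmono; first exact: (v0 k.+1 u w r0).
by rewrite ler_wpM2l//; apply: ler_sum => i _; exact: IH.
Qed.

Lemma mean_value_decr r k l : 0 <= r -> (k <= l)%N -> b r l <= b r k.
Proof.
move=> r0; elim: l => [|l IH]; first by rewrite leqn0 => /eqP ->.
rewrite leq_eqVlt => /predU1P[->//|/IH]; apply: le_trans.
rewrite -lee_fin -!(b_mean _ [::])//; apply: le_mean => // w; first exact: v0.
by rewrite ler_wpM2l//; apply: ler_sum => i _; exact: gvalue_decr.
Qed.

Lemma mean_value_incr r r' k : 0 <= r -> r <= r' -> b r k <= b r' k.
Proof.
move=> r0 rr'; have r'0 : 0 <= r' := le_trans r0 rr'.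
have h u w : gvalue r k u w <= gvalue r' k u w.
  elim: k u w => [|k IH] u w //=; apply: gmono; first exact: (v0 k u w r0).
  apply: ler_pM => //; last by apply: ler_sum => i _; exact: IH.
  by apply: child_sum_ge0 => *; exact: vG0.
rewrite -lee_fin -!(b_mean _ [::])//; apply: le_mean => // w; first exact: v0.
apply: ler_pM => //; last by apply: ler_sum => i _; exact: h.
by apply: child_sum_ge0 => *; exact: vG0.
Qed.

(** Each of the k + 1 multiplications by the parameter costs one factor lam, as
    g (lam x) <= lam g x. *)
Lemma mean_value_scale lam r k : 1 <= lam -> 0 <= r ->
  b (lam * r) k <= lam ^+ k.+1 * b r k.
Proof.
move=> l1 r0; have l0 : 0 <= lam := le_trans ler01 l1.
have lr0 : 0 <= lam * r by exact: mulr_ge0.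
have h u w : gvalue (lam * r) k u w <= lam ^+ k * gvalue r k u w.
  elim: k u w => [|k IH] u w /=; first by rewrite expr0 mul1r.
  apply: le_trans (gscale (exprn_ege1 k.+1 l1) (v0 k u w r0)).
  apply: gmono; first exact: (v0 k u w lr0).
  rewrite exprS /value -!mulrA ler_wpM2l// mulrCA ler_wpM2l// mulr_sumr.
  by apply: ler_sum => i _; exact: IH.
rewrite -lee_fin EFinM -(b_mean k [::] r0) -meanZ ?exprn_ge0//; last by move=> w; exact: v0.
rewrite -(b_mean _ [::])//; apply: le_mean => //.
- exact: measurable_funM.
- by move=> w; exact: v0.
move=> w; rewrite exprS /value -!mulrA ler_wpM2l// mulrCA ler_wpM2l// mulr_sumr.
by apply: ler_sum => i _; exact: h.
Qed.

(** Jensen's inequality for the convex defect x - g x. *)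
Lemma defect_mean_value r k : 0 < r -> b r k - g (b r k) <= loss r k * b r k.
Proof.
move=> r0; have r0' := ltW r0.
have cv := convex_lip_defect s_gt0 g_ge0 g_concave kappa1_gt0 kappa2_gt0 g_bounds.
have := mean_ge_convex cv (mvalue r k [::]) _ (fun w => v0 k [::] w r0') (b_mean k [::] r0').
rewrite (ger0_norm (ltW (b_gt0 k r0))).
have -> : mean P ((fun x => `|x| - g `|x|) \o value r k [::]) = (loss r k * b r k)%:E.
  rewrite -(mean_defect)//.
  by apply: eq_mean => w /=; rewrite ger0_norm// v0.
rewrite lee_fin; apply.
exact: (tree_var_measurable [::] (tree_var_comp (fun x => `|x| - g `|x|) (tree_var_value r k))).
Qed.

Lemma defect_mono x y : 0 <= x -> x <= y -> x - g x <= y - g y.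
Proof.
have [_ [dv h]] := convex_lip_defect s_gt0 g_ge0 g_concave kappa1_gt0 kappa2_gt0 g_bounds.
move=> x0 xy; have y0 := le_trans x0 xy.
have [/andP[d0 _] /(_ y y0)] := h x x0.
rewrite !ger0_norm//; have : 0 <= dv x * (y - x) by rewrite mulr_ge0// subr_ge0.
lra.
Qed.

(** As long as the mean stays above eps, Jensen's inequality makes it decrease by
    at least eps - g eps at each step. *)
Lemma critical_mean_value_cvg0 eps : 0 < eps -> exists K, b m^-1 K <= eps.
Proof.
move=> e0; apply: contrapT => no.
have mV0 : 0 < m^-1 by rewrite invr_gt0.
have big k : eps < b m^-1 k by rewrite ltNge; apply/negP => h; apply: no; exists k.
pose c := eps - g eps.
have c0 : 0 < c by rewrite subr_gt0 glt.
have step k : b m^-1 k.+1 <= b m^-1 k - c.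
  rewrite (mean_value_loss)//.
  rewrite divff// mul1r mulrBl mul1r lerD2l lerN2.
  apply: le_trans (defect_mean_value k mV0).
  exact: (defect_mono (ltW e0) (ltW (big k))).
have down k : b m^-1 k <= b m^-1 0 - k%:R * c.
  elim: k => [|k IH]; first by rewrite mul0r subr0.
  by apply: le_trans (step k) _; rewrite -natr1 mulrDl mul1r; lra.
have := down (Num.bound (b m^-1 0 / c)).
have : b m^-1 0 / c < (Num.bound (b m^-1 0 / c))%:R.
  by apply: archi_boundP; rewrite divr_ge0// ltW// b_gt0.
rewrite ltr_pdivrMr// => h1 h2.
have := b_gt0 (Num.bound (b m^-1 0 / c)) mV0; lra.
Qed.

(** At one fixed height the solution for r exceeds the critical one by a factor
    close to 1, and it decreases with the height.  Hence the bound is uniform in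
    the height, for r close to 1 / m. *)
Lemma mean_value_small eps : 0 < eps -> exists K, \forall r \near m^-1,
  0 < r /\ forall k, (K <= k)%N -> b r k <= eps.
Proof.
move=> e0; have mV0 : 0 < m^-1 by rewrite invr_gt0.
have e2 : 0 < eps / 2 by rewrite divr_gt0.
have [K hK] := critical_mean_value_cvg0 e2; exists K.
pose lam := expR (ln 2 / K.+1%:R) : R.
have l2 : lam ^+ K.+1 = 2.
  by rewrite /lam -expRM_natr divfK ?pnatr_eq0// lnK// posrE.
have l1 : 1 < lam by rewrite expR_gt1 divr_gt0// ln_gt0// ltr1n.
have rm : m^-1 < lam * m^-1 by rewrite ltr_pMl.
near=> r.
have r0 : 0 < r by near: r; exact: lt_nbhsr.
have rl : r < lam * m^-1 by near: r; exact: lt_nbhsl.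
split=> // k Kk; apply: le_trans (mean_value_decr (ltW r0) Kk) _.
apply: le_trans (mean_value_incr K (ltW r0) (ltW rl)) _.
apply: le_trans (mean_value_scale K (ltW l1) (ltW mV0)) _.
by rewrite l2 mulrC -ler_pdivlMr.
Unshelve. all: by end_near. Qed.

Lemma loss_small eps : 0 < eps -> exists K, \forall r \near m^-1,
  0 < r /\ forall k, (K <= k)%N -> loss r k <= eps.
Proof.
move=> e0; pose C := kappa1 / s * EW.
have EW0 : 0 <= EW.
  exact: le_trans ler01 (limit_moment_ge1 N_GW mE m_gt1 p_gt1 Zs).
have C0 : 0 <= C by rewrite mulr_ge0// divr_ge0// ltW.
pose eta := (eps / (C + 1)) `^ s^-1.
have C1 : 0 < C + 1 by rewrite ltr_wpDl.
have eta0 : 0 < eta by rewrite powR_gt0// divr_gt0.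
have [K hK] := mean_value_small eta0; exists K.
apply: filterS hK => r [r0 hr]; split=> // k Kk.
apply: le_trans (loss_le k r0) _.
have bs : b r k `^ s <= eps / (C + 1).
  have -> : eps / (C + 1) = eta `^ s.
    by rewrite /eta -powRrM mulVf ?gt_eqF// powRr1// divr_ge0// ltW.
  by apply: powR_le; [exact: ltW|exact: ltW (b_gt0 k r0)|exact: hr].
apply: le_trans (ler_wpM2l C0 bs) _.
by rewrite mulrA ler_pdivrMr// mulrC ler_pM2l// lerDl.
Qed.

Lemma coupling_error_small eps : 0 < eps -> exists K, \forall r \near m^-1,
  0 < r /\ forall k, (K <= k)%N -> coupling_error r k <= eps.
Proof.
move=> e0; pose eta := Num.min 2^-1 (eps / 4).
have eta0 : 0 < eta by rewrite lt_min invr_gt0 ltr0n divr_gt0.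
have [K hK] := loss_small eta0; exists K.
apply: filterS hK => r [r0 hr]; split=> // k Kk.
have := hr _ Kk; rewrite le_min => /andP[l1 l2].
have d0 : 0 < 1 - loss r k by lra.
rewrite /coupling_error ler_pdivrMr//.
have : eps * 2^-1 <= eps * (1 - loss r k) by rewrite ler_wpM2l ?(ltW e0)//; lra.
lra.
Qed.

(** W_n is less spread out than the normalized solution up to n coupling errors,
    which are small when the n generations are taken far from the leaves. *)
Lemma unit_value_trunc_ge eps : 0 < eps -> exists L K, 1 <= L /\
  \forall r \near m^-1, 0 < r /\ forall k, (K <= k)%N ->
    ((EW - eps)%:E <= mean P (fun w => powR_trunc (s + 1) L (unit_value r k [::] w)))%E.
Proof.
move=> e0; have e2 : 0 < eps / 2 by rewrite divr_gt0.
have [L [n [L1 hL]]] := limit_moment_approx N_GW mE m_gt1 p_gt1 Zs e2.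
have L0 := le_trans ler01 L1.
have cphi := convex_lip_powR_trunc p_gt1 L0.
pose c := (s + 1) * L `^ (s + 1 - 1).
have c0 : 0 <= c := convex_lip_ge0 cphi.
have eta0 : 0 < eps / 2 / (n.+1%:R * (c + 1)).
  by rewrite !divr_gt0// mulr_gt0// ltr_wpDl.
have [K hK] := coupling_error_small eta0.
exists L, (K + n)%N; split=> //.
apply: filterS hK => r [r0 hr]; split=> // k Kk.
have nk : (n <= k)%N by apply: leq_trans Kk; exact: leq_addl.
have Kkn : (K <= k - n)%N by rewrite leq_subRL// addnC.
have := W_cx_le_unit_value n (k - n) r0 cphi.
rewrite subnK// => /(le_trans hL) h.
have sm : c * (\sum_(0 <= i < n) coupling_error r (k - n + i)) <= eps / 2.
  apply: (@le_trans _ _ (c * (n%:R * (eps / 2 / (n.+1%:R * (c + 1)))))).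
    rewrite ler_wpM2l//.
    apply: (@le_trans _ _ (\sum_(0 <= i < n) (eps / 2 / (n.+1%:R * (c + 1))))).
      by apply: ler_sum => i _; apply: hr; rewrite (leq_trans Kkn)// leq_addr.
    by rewrite sumr_const_nat subn0 [leRHS]mulr_natl.
  have cp : 0 < c + 1 by rewrite ltr_wpDl.
  have -> : c * (n%:R * (eps / 2 / (n.+1%:R * (c + 1)))) =
      (c / (c + 1)) * (n%:R / n.+1%:R) * (eps / 2).
    have nn0 : n.+1%:R != 0 :> R by rewrite pnatr_eq0.
    move: nn0; move: (n.+1%:R : R) => nn nn0.
    by field; rewrite nn0 gt_eqF.
  have f1 : c / (c + 1) <= 1 by rewrite ler_pdivrMr// mul1r lerDl.
  have f2 : n%:R / n.+1%:R <= 1 :> R by rewrite ler_pdivrMr// mul1r ler_nat.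
  rewrite ler_piMl ?(ltW e2)// mulr_ile1//; apply: divr_ge0 => //.
  exact: ltW.
have fm : (0 <= mean P (fun w => powR_trunc (s + 1) L (unit_value r k [::] w)))%E.
  by apply: mean_ge0 => w; have [f0 _] := cphi; exact: f0.
have smE : ((c * (\sum_(0 <= i < n) coupling_error r (k - n + i)))%:E <= (eps / 2)%:E)%E.
  by rewrite lee_fin.
have := le_trans h (leeD (lexx _) smE).
by rewrite -leeBlDr// -EFinB -addrA -opprD -splitr.
Qed.

(** * The rate at the critical parameter *)

Context {kappag : R}.
Hypothesis kappag_gt0 : 0 < kappag.
Hypothesis kappagE : (x `^ (s + 1))^-1 * (x - g x) @[x --> 0^'+] --> kappag.

Let g00 : g 0 = 0.
Proof. exact: (g0 s_gt0 g_ge0 g_concave kappa1_gt0 kappa2_gt0 g_bounds). Qed.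

Let Kd := kappa1 / s + kappag.
Let Kd_ge0 : 0 <= Kd.
Proof. by rewrite addr_ge0 ?divr_ge0// ltW. Qed.
Let EW_ge1 : 1 <= EW.
Proof. exact: (limit_moment_ge1 N_GW mE m_gt1 p_gt1 Zs). Qed.
Let EW_ge0 : 0 <= EW.
Proof. exact: le_trans ler01 EW_ge1. Qed.

Lemma defect_near0 eps : 0 < eps -> exists2 x0, 0 < x0 & forall x, 0 <= x ->
  x < x0 -> `|x - g x - kappag * x `^ (s + 1)| <= eps * x `^ (s + 1).
Proof.
move=> e0; move/cvgrPdist_le : kappagE => /(_ _ e0)[x0 /= x00 h].
exists x0 => // x; rewrite le0r => /predU1P[->|xpos] xx0.
  by rewrite g00 powR0 ?gt_eqF// !mulr0 !subr0 normr0.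
have xp : 0 < x `^ (s + 1) by exact: powR_gt0.
have := h x; rewrite /ball/= sub0r normrN gtr0_norm// => /(_ xx0 xpos).
rewrite -(ler_pM2r xp) -[X in _ * X <= _](gtr0_norm xp) -normrM mulrBl.
by rewrite mulrAC mulVf ?gt_eqF// mul1r distrC.
Qed.

(** In the rescaled variable y = x / c the defect is close to kappag y^p, except
    in the tail of y, which the truncated power controls. *)
Lemma defect_scaled eps x0 Lam L x c :
  (forall x, 0 <= x -> x < x0 ->
    `|x - g x - kappag * x `^ (s + 1)| <= eps * x `^ (s + 1)) ->
  (forall L x, 0 <= L -> 0 <= x -> Lam * L <= x ->
    x `^ (s + 1) <= 2 * (x `^ (s + 1) - powR_trunc (s + 1) L x)) ->
  0 <= eps -> 0 <= L -> 0 <= x -> 0 < c -> Lam * L * c <= x0 ->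
  `|(c `^ (s + 1))^-1 * (x - g x) - kappag * (c^-1 * x) `^ (s + 1)| <=
  eps * (c^-1 * x) `^ (s + 1) +
    2 * Kd * ((c^-1 * x) `^ (s + 1) - powR_trunc (s + 1) L (c^-1 * x)).
Proof.
move=> hx0 hLam e0 L0 xge0 c0 Lc.
have cV0 : 0 <= c^-1 by rewrite invr_ge0 ltW.
have y0 : 0 <= c^-1 * x by exact: mulr_ge0.
have xE : x = c * (c^-1 * x) by rewrite mulrA divff ?gt_eqF// mul1r.
move: (powR_trunc_le p_gt1 L0 y0).
set y := c^-1 * x in y0 xE *; move=> ty.
have cp : 0 < c `^ (s + 1) by exact: powR_gt0.
have xpE : x `^ (s + 1) = c `^ (s + 1) * y `^ (s + 1) by rewrite xE powRM// ltW.
have yp : 0 <= y `^ (s + 1) by exact: powR_ge0.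
have tail : 0 <= 2 * Kd * (y `^ (s + 1) - powR_trunc (s + 1) L y).
  by rewrite !mulr_ge0// subr_ge0.
rewrite -(ler_pM2l cp) -{1}(gtr0_norm cp) -normrM mulrBr mulrA divff ?gt_eqF//.
rewrite mul1r mulrCA -xpE.
have [xx0|x0x] := ltP x x0.
  apply: le_trans (hx0 _ xge0 xx0) _; rewrite xpE mulrCA ler_pM2l//.
  by rewrite lerDl.
have xp : 0 <= x `^ (s + 1) by exact: powR_ge0.
have d0 : 0 <= x - g x by rewrite subr_ge0 gle.
have dl := defect_le s_gt0 g_ge0 g_concave kappa1_gt0 kappa2_gt0 g_bounds xge0.
apply: (@le_trans _ _ (Kd * x `^ (s + 1))).
  rewrite ler_norml; apply/andP; split.
    have : 0 <= kappa1 / s * x `^ (s + 1) by rewrite !mulr_ge0 ?invr_ge0// ltW.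
    by rewrite /Kd mulrDl; lra.
  have : 0 <= kappag * x `^ (s + 1) by rewrite mulr_ge0// ltW.
  by rewrite /Kd mulrDl; lra.
rewrite xpE mulrCA ler_pM2l// ler_wpDl ?mulr_ge0//.
rewrite [2 * Kd]mulrC -mulrA ler_wpM2l//; apply: hLam => //.
by rewrite /y [leRHS]mulrC ler_pdivlMr// (le_trans Lc).
Qed.

(** The mean of the defect is the loss times the mean value b.  Near 0 the defect
    is kappag x^(s+1), b tends to 0 uniformly near the critical parameter, and
    the moment of order s + 1 of the normalized solution tends to that of W.
    Indeed it is at most that of W, while already its truncation at a fixed level
    is at least that of W up to an error, so that the tails are uniformly
    small. *)
Lemma defect_ratio_cvg eps : 0 < eps -> exists K0, \forall r \near m^-1,
  0 < r /\ forall k, (K0 <= k)%N ->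
    `|loss r k * b r k `^ (- s) - kappag * EW| <= eps.
Proof.
move=> e0.
pose e1 := eps / (2 * (EW + 1)).
pose eta := eps / (2 * (2 * Kd + kappag + 1)).
have D0 : 0 < 2 * Kd + kappag + 1.
  by rewrite ltr_wpDl// addr_ge0 ?mulr_ge0// ltW.
have EW1 : 0 < EW + 1 by rewrite ltr_wpDl.
have e10 : 0 < e1 by rewrite divr_gt0// mulr_gt0.
have eta0 : 0 < eta by rewrite divr_gt0// mulr_gt0.
have [x0 x00 hx0] := defect_near0 e10.
have [Lam Lam0 hLam] := powR_tail_le p_gt1.
have [L [K1 [L1 hL]]] := unit_value_trunc_ge eta0.
have L0 : 0 < L := lt_le_trans ltr01 L1.
have LL : 0 < Lam * L by exact: mulr_gt0.
have [K2 hb] := mean_value_small (divr_gt0 x00 LL).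
exists (maxn K1 K2); near=> r.
have [r0 hLr] : 0 < r /\ forall k, (K1 <= k)%N ->
    ((EW - eta)%:E <= mean P (fun w => powR_trunc (s + 1) L (unit_value r k [::] w)))%E.
  by near: r; exact: hL.
have [_ hbr] : 0 < r /\ forall k, (K2 <= k)%N -> b r k <= x0 / (Lam * L).
  by near: r; exact: hb.
split=> // k; rewrite geq_max => /andP[K1k K2k].
have b0 := b_gt0 k r0; have r0' := ltW r0.
have tY := tree_var_unit_value r k.
have Y0 w : 0 <= unit_value r k [::] w.
  exact: (unit_value_ge0).
have YE w : unit_value r k [::] w = (b r k)^-1 * value r k [::] w.
  exact: (unit_valueE).
have mY (f : R -> R) : measurable_fun setT (fun w => f (unit_value r k [::] w)).
  exact: (tree_var_measurable [::] (tree_var_comp f tY)).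
have mX (f : R -> R) : measurable_fun setT (fun w => f (value r k [::] w)).
  exact: (tree_var_measurable [::] (tree_var_comp f (tree_var_value r k))).
have cphi := convex_lip_powR_trunc p_gt1 (ltW L0); have [phi0 _] := cphi.
pose Yp w := unit_value r k [::] w `^ (s + 1).
pose Yt w := powR_trunc (s + 1) L (unit_value r k [::] w).
have mYp : measurable_fun setT Yp by exact: (mY (fun x => x `^ (s + 1))).
have mYt : measurable_fun setT Yt by exact: (mY (powR_trunc (s + 1) L)).
have Yp0 w : 0 <= Yp w by exact: powR_ge0.
have Yt0 w : 0 <= Yt w by exact: phi0.
have Ytp w : Yt w <= Yp w by exact: (powR_trunc_le p_gt1 (ltW L0)).
have momY : (mean P Yp <= EW%:E)%E.
  exact: (unit_value_moment k r0).
pose y := fine (mean P Yp); pose f := fine (mean P Yt).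
have yE : mean P Yp = y%:E.
  rewrite /y fineK// ge0_fin_numE ?mean_ge0//.
  exact: le_lt_trans momY (ltry _).
have fy : (mean P Yt <= mean P Yp)%E by exact: le_mean.
have fE : mean P Yt = f%:E.
  rewrite /f fineK// ge0_fin_numE ?mean_ge0//.
  exact: le_lt_trans (le_trans fy momY) (ltry _).
have fle : EW - eta <= f by rewrite -lee_fin -fE; exact: hLr.
have {}fy : f <= y by rewrite -lee_fin -fE -yE.
have yle : y <= EW by move: momY; rewrite yE lee_fin.
have y0 : 0 <= y by rewrite /y fine_ge0// mean_ge0.
pose V w := (b r k `^ (s + 1))^-1 * (value r k [::] w - g (value r k [::] w)).
have bp : 0 < b r k `^ (s + 1) by exact: powR_gt0.
have bV : 0 <= (b r k `^ (s + 1))^-1 by rewrite invr_ge0 ltW.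
have df0 w : 0 <= value r k [::] w - g (value r k [::] w) by rewrite subr_ge0 gle// v0.
have V0 w : 0 <= V w by exact: mulr_ge0.
have mV : measurable_fun setT V.
  exact: (mX (fun x => (b r k `^ (s + 1))^-1 * (x - g x))).
pose Q := loss r k * b r k `^ (- s).
have VE : mean P V = Q%:E.
  rewrite (meanZ P (mX (fun x => x - g x)) df0 bV).
  rewrite (mean_defect)// -EFinM; congr (_%:E).
  rewrite /Q powRN.
  have -> : b r k `^ (s + 1) = b r k * b r k `^ s.
    by rewrite -(mulr_powRB1 (ltW b0) p_gt0) addrK.
  by field; rewrite !gt_eqF// powR_gt0.
have ptw w : `|V w - kappag * Yp w| <= e1 * Yp w + 2 * Kd * (Yp w - Yt w).
  rewrite /V /Yp /Yt YE; apply: (@defect_scaled e1 x0 Lam) => //.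
  - exact: ltW.
  - exact: ltW.
  - exact: v0.
  - by have := hbr _ K2k; rewrite ler_pdivlMr// mulrC.
have K2ge0 : 0 <= 2 * Kd by exact: mulr_ge0.
have up : Q + 2 * Kd * f <= (kappag + e1 + 2 * Kd) * y.
  have c0 : 0 <= kappag + e1 + 2 * Kd by rewrite !addr_ge0// ltW.
  have Kf0 w : 0 <= 2 * Kd * Yt w by exact: mulr_ge0.
  have mKf : measurable_fun setT (fun w => 2 * Kd * Yt w) by exact: measurable_funM.
  have lE : mean P (fun w => V w + 2 * Kd * Yt w) = (Q + 2 * Kd * f)%:E.
    by rewrite (meanD P mV mKf V0 Kf0) (meanZ P mYt Yt0 K2ge0) fE VE.
  have rE : mean P (fun w => (kappag + e1 + 2 * Kd) * Yp w) =
      ((kappag + e1 + 2 * Kd) * y)%:E by rewrite (meanZ P mYp Yp0 c0) yE.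
  rewrite -lee_fin -lE -rE; apply: le_mean.
  - exact: measurable_funD.
  - exact: measurable_funM.
  - by move=> w; exact: addr_ge0.
  by move=> w; have := ptw w; rewrite ler_norml => /andP[_]; lra.
have lo : kappag * y + 2 * Kd * f <= Q + (e1 + 2 * Kd) * y.
  have c0 : 0 <= e1 + 2 * Kd by rewrite !addr_ge0// ltW.
  have kg0 := ltW kappag_gt0.
  have Kf0 w : 0 <= 2 * Kd * Yt w by exact: mulr_ge0.
  have Ky0 w : 0 <= kappag * Yp w by exact: mulr_ge0.
  have Kc0 w : 0 <= (e1 + 2 * Kd) * Yp w by exact: mulr_ge0.
  have mKf : measurable_fun setT (fun w => 2 * Kd * Yt w) by exact: measurable_funM.
  have mKy : measurable_fun setT (fun w => kappag * Yp w) by exact: measurable_funM.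
  have mKc : measurable_fun setT (fun w => (e1 + 2 * Kd) * Yp w) by exact: measurable_funM.
  have lE : mean P (fun w => kappag * Yp w + 2 * Kd * Yt w) =
    (kappag * y + 2 * Kd * f)%:E.
    rewrite (meanD P mKy mKf Ky0 Kf0) (meanZ P mYp Yp0 kg0) (meanZ P mYt Yt0 K2ge0).
    by rewrite yE fE.
  have rE : mean P (fun w => V w + (e1 + 2 * Kd) * Yp w) = (Q + (e1 + 2 * Kd) * y)%:E.
    by rewrite (meanD P mV mKc V0 Kc0) (meanZ P mYp Yp0 c0) yE VE.
  rewrite -lee_fin -lE -rE; apply: le_mean.
  - exact: measurable_funD.
  - exact: measurable_funD.
  - by move=> w; exact: addr_ge0.
  by move=> w; have := ptw w; rewrite ler_norml => /andP[+ _]; lra.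
have h1 : e1 * EW <= eps / 2.
  have -> : eps / 2 = e1 * (EW + 1) by rewrite /e1; field; rewrite gt_eqF.
  by rewrite ler_wpM2l ?(ltW e10)// lerDl.
have h2 : (2 * Kd + kappag) * eta <= eps / 2.
  have -> : eps / 2 = (2 * Kd + kappag + 1) * eta.
    by rewrite /eta; field; rewrite gt_eqF.
  by rewrite ler_wpM2r ?(ltW eta0)// lerDl.
exact: (norm_le_of_bounds (ltW e10) K2ge0 (ltW kappag_gt0) (ltW eta0)
  up lo h1 h2 fle fy yle).
Unshelve. all: by end_near. Qed.

(** The increment of the mean value raised to the power -s, up to the factor
    (m r)^(-s). *)
Definition rate r k : R := b r k `^ (- s) * ((1 - loss r k) `^ (- s) - 1).

(** To first order the increment of b^(-s) is s times the loss times b^(-s). *)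
Lemma rate_cvg eps : 0 < eps -> exists K0, \forall r \near m^-1,
  0 < r /\ forall k, (K0 <= k)%N -> `|rate r k - s * kappag * EW| <= eps.
Proof.
move=> e0; pose A := kappag * EW.
have A0 : 0 <= A by rewrite mulr_ge0// ltW.
pose e1 := eps / (2 * s).
have e10 : 0 < e1 by rewrite divr_gt0// mulr_gt0.
have Ae : 0 < A + e1 by rewrite ltr_wpDl.
pose e2 := eps / (2 * s * (A + e1)).
have e20 : 0 < e2 by rewrite divr_gt0// !mulr_gt0.
(* loss <= eta means (1 - loss)^(-(s+1)) <= 1 + e2 *)
pose eta := 1 - (1 + e2) `^ (- (s + 1)^-1).
have pE : ((1 + e2) `^ (- (s + 1)^-1)) `^ (- (s + 1)) = 1 + e2.
  by rewrite -powRrM mulrNN mulVf ?gt_eqF// powRr1//; lra.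
have eta1 : 0 < (1 + e2) `^ (- (s + 1)^-1) by rewrite powR_gt0//; lra.
have eta0 : 0 < eta.
  rewrite subr_gt0 powRN invf_lt1 ?powR_gt0//; last by lra.
  rewrite -[ltLHS](_ : 1 `^ (s + 1)^-1 = 1); last by rewrite powR1.
  apply: gt0_ltr_powR; rewrite ?nnegrE ?invr_gt0//; lra.
have [K1 h1] := defect_ratio_cvg e10.
have [K2 h2] := loss_small eta0.
exists (maxn K1 K2); near=> r.
have [r0 h1r] : 0 < r /\ forall k, (K1 <= k)%N ->
    `|loss r k * b r k `^ (- s) - kappag * EW| <= e1.
  by near: r; exact: h1.
have [_ h2r] : 0 < r /\ forall k, (K2 <= k)%N -> loss r k <= eta.
  by near: r; exact: h2.
split=> // k; rewrite geq_max => /andP[K1k K2k].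
have l0 : 0 <= loss r k.
  exact: (loss_ge0).
have l1 : loss r k < 1.
  exact: (loss_lt1).
have bs : 0 <= b r k `^ (- s) by exact: powR_ge0.
have /andP[lo up] := powRN_1B_bounds s_gt0 l0 l1.
have := h1r _ K1k; rewrite -/A ler_norml => /andP[q1 q2].
have {}lo : s * (loss r k * b r k `^ (- s)) <= rate r k.
  by have := ler_wpM2l bs lo; rewrite mulrC mulrA.
have pw : (1 - loss r k) `^ (- (s + 1)) <= 1 + e2.
  have w1 : (1 + e2) `^ (- (s + 1)^-1) <= 1 - loss r k.
    by have := h2r _ K2k; rewrite /eta; lra.
  rewrite -[leRHS]pE.
  by apply: powRN_le; [exact: ltW|exact: eta1|exact: w1].
have {}up : rate r k <= s * (A + e1) * (1 + e2).
  apply: le_trans (ler_wpM2l bs up) _.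
  have -> : b r k `^ (- s) * (s * loss r k * (1 - loss r k) `^ (- (s + 1))) =
    s * (loss r k * b r k `^ (- s)) * (1 - loss r k) `^ (- (s + 1)) by ring.
  apply: ler_pM; rewrite ?mulr_ge0 ?powR_ge0 ?(ltW s_gt0)//.
  by rewrite ler_wpM2l ?(ltW s_gt0)//; lra.
have E1 : s * e1 = eps / 2 by rewrite /e1; field; rewrite gt_eqF.
have E2 : s * (A + e1) * e2 = eps / 2.
  by rewrite /e2; field; rewrite !gt_eqF.
have E3 : s * (A - e1) <= s * (loss r k * b r k `^ (- s)).
  by rewrite ler_wpM2l ?(ltW s_gt0)//; lra.
rewrite [X in rate r k - X](_ : _ = s * A); last by rewrite /A mulrA.
rewrite ler_norml; apply/andP; split.
  by move: E3; rewrite mulrBr E1; lra.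
by move: up; rewrite mulrDr mulr1 E2 mulrDr E1; lra.
Unshelve. all: by end_near. Qed.

(** * The critical case *)

(** The powers b^(-s) satisfy a linear recursion with coefficient (m r)^(-s), whose
    inhomogeneous terms are the rates; the index 0 stands for the leaves. *)
Lemma mean_value_powRN r n : 0 < r ->
  b r n `^ (- s) = \sum_(0 <= k < n.+1) ((m * r) `^ (- s)) ^+ (n.+1 - k) *
    (if k is k'.+1 then rate r k' else ginf `^ (- s)).
Proof.
move=> r0; have mr0 : 0 < m * r by exact: mulr_gt0.
elim: n => [|n IH].
  rewrite big_nat1 subn0 expr1.
  rewrite (mean_value0 (ltW r0)).
  by rewrite powRM// ltW.
rewrite big_nat_recr//= subSn// subnn expr1.
have l1 : 0 <= 1 - loss r n.
  rewrite subr_ge0 ltW//.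
  exact: (loss_lt1).
rewrite (mean_value_loss)//.
rewrite -mulrA powRM ?(ltW mr0)//; last by rewrite mulr_ge0// ltW// b_gt0.
rewrite (powRM _ l1 (ltW (b_gt0 n r0))).
have -> : (1 - loss r n) `^ (- s) * b r n `^ (- s) = b r n `^ (- s) + rate r n.
  by rewrite /rate mulrBr mulr1 [RHS]addrC subrK mulrC.
rewrite mulrDr IH mulr_sumr; congr (_ + _).
apply: eq_big_nat => k /andP[_ kn]; rewrite mulrA -exprS.
by rewrite -subSn// ltnW.
Qed.

Lemma a_seqE (r : nat -> R) n : (forall n, 0 < r n) ->
  a_seq m s r n.+1 = \sum_(0 <= k < n.+1) ((m * r n.+1) `^ (- s)) ^+ (n.+1 - k).
Proof.
move=> r0; rewrite /a_seq big_add1/= [RHS]big_nat_rev/= add0n.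
apply: eq_big_nat => k /andP[_ kn].
rewrite -powR_mulrn ?powR_ge0// -powRrM; congr (_ `^ _).
by rewrite subKn// mulNr mulrC.
Qed.

Lemma a_seq_gt0 (r : nat -> R) n : (forall n, 0 < r n) -> 0 < a_seq m s r n.+1.
Proof.
move=> r0; rewrite a_seqE// big_nat_recr//=; apply: ltr_wpDl.
  by apply: sumr_ge0 => k _; rewrite exprn_ge0 ?powR_ge0.
by rewrite exprn_gt0// powR_gt0// mulr_gt0.
Qed.

(** The quotient is an average of the rates with respect to geometric weights of
    ratio (m r)^(-s), which tends to 1. *)
Lemma critical_cvg (r : nat -> R) : (forall n, 0 < r n) ->
  m * r n @[n --> \oo] --> (1 : R) ->
  b (r n.+1) n `^ (- s) / a_seq m s r n.+1 @[n --> \oo] --> s * kappag * EW.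
Proof.
move=> r0 mr1.
have mrS : m * r n.+1 @[n --> \oo] --> (1 : R) by rewrite (cvg_shiftS (fun n => m * r n)).
have rm : r n.+1 @[n --> \oo] --> m^-1.
  rewrite -[m^-1]mulr1 (_ : (fun n => r n.+1) = fun n => m^-1 * (m * r n.+1)).
    by apply: cvgM => //; exact: cvg_cst.
  by apply/funext => n; rewrite mulrA mulVf// mul1r.
pose q n := (m * r n.+1) `^ (- s).
pose e n k := if k is k'.+1 then rate (r n.+1) k' else ginf `^ (- s).
rewrite (_ : (fun n => _ / _) = fun n =>
  (\sum_(0 <= k < n.+1) q n ^+ (n.+1 - k) * e n k) /
  (\sum_(0 <= k < n.+1) q n ^+ (n.+1 - k))); last first.
  by apply/funext => n; rewrite mean_value_powRN// a_seqE.
apply: weighted_average_cvg.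
- by move=> n; rewrite powR_gt0// mulr_gt0.
- have h1 : 1 `^ (- s) = 1 :> R by rewrite powR1.
  by rewrite -[X in _ --> X]h1; exact: powR_cvg ltr01 mrS.
- move=> eps e0.
  have [K hK] := rate_cvg e0.
  exists K.+1; near=> n.
  have [_ h] : 0 < r n.+1 /\ forall k, (K <= k)%N ->
      `|rate (r n.+1) k - s * kappag * EW| <= eps by near: n; exact: rm hK.
  by move=> [//|k] Kk; exact: h.
move=> K.
have mV0 : 0 < m^-1 by rewrite invr_gt0.
have low0 : 0 < m^-1 / 2 by rewrite divr_gt0.
pose C := 2 `^ s * b (m^-1 / 2) K `^ (- s).
have C0 : 0 <= C by rewrite mulr_ge0 ?powR_ge0.
(* (m r)^(-s) rate is at most the next power b^(-s), and b is bounded below at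
   heights up to K *)
exists (ginf `^ (- s) + C); near=> n; have rn0 := r0 n.+1.
have lowr : m^-1 / 2 <= r n.+1.
  near: n; apply: (cvgr_ge m^-1 rm); lra.
have mr2 : m * r n.+1 <= 2 by near: n; apply: (cvgr_le 1 mrS); rewrite ltr1n.
move=> [|k] kK /=; first by rewrite ger0_norm ?powR_ge0// lerDl.
have l0 : 0 <= loss (r n.+1) k.
  exact: (loss_ge0).
have l1 : loss (r n.+1) k < 1.
  exact: (loss_lt1).
have /andP[lo _] := powRN_1B_bounds s_gt0 l0 l1.
have rate0 : 0 <= rate (r n.+1) k.
  rewrite mulr_ge0 ?powR_ge0//; apply: le_trans lo.
  by rewrite mulr_ge0// ltW.
rewrite ger0_norm// ler_wpDl ?powR_ge0//.
have mr0 : 0 < m * r n.+1 by exact: mulr_gt0.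
apply: (@le_trans _ _ ((m * r n.+1) `^ s * b (r n.+1) k.+1 `^ (- s))).
  rewrite (mean_value_loss)//.
  have l1' : 0 <= 1 - loss (r n.+1) k by rewrite subr_ge0 ltW.
  rewrite -mulrA (powRM _ (ltW mr0) (mulr_ge0 l1' (ltW (b_gt0 k rn0)))).
  rewrite (powRM _ l1' (ltW (b_gt0 k rn0))).
  rewrite mulrA -powRD; last by rewrite (gt_eqF mr0) implybT.
  rewrite subrr powRr0 mul1r /rate mulrBr mulr1 [X in _ <= X]mulrC.
  by rewrite gerBl powR_ge0.
apply: ler_pM; [exact: powR_ge0|exact: powR_ge0| |].
  by apply: powR_le; [exact: ltW|exact: ltW|exact: mr2].
apply: powRN_le; [exact: ltW|exact: b_gt0|].
apply: (@le_trans _ _ (b (r n.+1) K)).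
  exact: (mean_value_incr K (ltW low0) lowr).
exact: (mean_value_decr (ltW rn0) (ltnW kK)).
Unshelve. all: by end_near. Qed.

Lemma critical_equiv (r : nat -> R) : (forall n, 0 < r n) ->
  m * r n @[n --> \oo] --> (1 : R) ->
  b (r n.+1) n / ((s * kappag * EW) `^ (- s^-1) *
    a_seq m s r n.+1 `^ (- s^-1)) @[n --> \oo] --> (1 : R).
Proof.
move=> r0 mr1; pose A := s * kappag * EW; rewrite -/A.
have A0 : 0 < A.
  rewrite !mulr_gt0//; apply: lt_le_trans ltr01 _.
  exact: (limit_moment_ge1 N_GW mE m_gt1 p_gt1 Zs).
have a0 n := a_seq_gt0 n r0.
have h : (b (r n.+1) n `^ (- s) / a_seq m s r n.+1) / A @[n --> \oo] --> (1 : R).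
  rewrite -[X in _ --> X](divff (lt0r_neq0 A0)).
  by apply: cvgM; [exact: critical_cvg|exact: cvg_cst].
have h1 : 1 `^ (- s^-1) = 1 :> R by rewrite powR1.
rewrite -[X in _ --> X]h1.
rewrite (_ : (fun n => _ / _) = fun n =>
  (b (r n.+1) n `^ (- s) / a_seq m s r n.+1 / A) `^ (- s^-1)).
  exact: powR_cvg ltr01 h.
apply/funext => n; apply/esym.
have b0 := b_gt0 n (r0 n.+1).
move: (a0 n) A0 b0 => {h}; move: (a_seq _ _ _ _) A (b _ _) => a A y apos Apos ypos.
rewrite -[(_ / a) / A]mulrA powRM ?powR_ge0//; last first.
  by rewrite mulr_ge0 ?invr_ge0 ?ltW.
rewrite -powRrM mulrNN divff ?gt_eqF// powRr1 ?(ltW ypos)//; congr (_ * _).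
rewrite -invfM powRV ?mulr_ge0 ?(ltW apos) ?(ltW Apos)//.
by rewrite powRM ?(ltW apos) ?(ltW Apos)// mulrC.
Qed.

(** * The subcritical case *)

(** The mean value is monotone in r, and at most homogeneous of degree k + 1. *)
Lemma mean_value_continuous r0 k : 0 < r0 -> b r k @[r --> r0] --> b r0 k.
Proof.
move=> r00; apply/cvgrPdist_le => eps e0.
have b0 := b_gt0 k r00.
have h : (r / r0) ^+ k.+1 @[r --> r0] --> (1 : R).
  have h1 : 1 ^+ k.+1 = 1 :> R by rewrite expr1n.
  have h2 : r0 / r0 = 1 by rewrite divff ?gt_eqF.
  rewrite -[X in _ --> X]h1 -[X in X ^+ _]h2.
  by apply: exprn_cvg; apply: cvgM; [exact: cvg_id|exact: cvg_cst].
have eb : 0 < eps / b r0 k by rewrite divr_gt0.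
near=> r.
have rpos : 0 < r by near: r; exact: lt_nbhsr.
have : `|1 - (r / r0) ^+ k.+1| <= eps / b r0 k.
  by near: r; move/cvgrPdist_le : h; apply.
rewrite ler_pdivlMr// -{1}(gtr0_norm b0) -normrM; apply: le_trans.
rewrite mulrBl mul1r; have [rr0|r0r] := leP r r0.
  have l1 : 1 <= r0 / r by rewrite ler_pdivlMr// mul1r.
  have up := mean_value_incr k (ltW rpos) rr0.
  have := mean_value_scale k l1 (ltW rpos).
  rewrite divfK ?gt_eqF// -[r0 / r]invf_div exprVn => sc.
  have p0 : 0 < (r / r0) ^+ k.+1 by rewrite exprn_gt0// divr_gt0.
  have {}sc : (r / r0) ^+ k.+1 * b r0 k <= b r k.
    by rewrite mulrC -ler_pdivlMr// mulrC.
  by rewrite !ger0_norm ?subr_ge0//; [lra|exact: le_trans sc up].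
have l1 : 1 <= r / r0 by rewrite ler_pdivlMr// mul1r ltW.
have up := mean_value_incr k (ltW r00) (ltW r0r).
have := mean_value_scale k l1 (ltW r00); rewrite divfK ?gt_eqF// => sc.
by rewrite !ler0_norm ?subr_le0//; [lra|exact: le_trans up sc].
Unshelve. all: by end_near. Qed.

(** If g x were x, the mean value would be ginf (m r)^(k+1); the quotient only
    records the losses. *)
Definition scaled_mean r k : R := b r k / (m * r) ^+ k.+1.

Lemma scaled_mean_gt0 r k : 0 < r -> 0 < scaled_mean r k.
Proof. by move=> r0; rewrite divr_gt0 ?b_gt0// exprn_gt0// mulr_gt0. Qed.

Lemma scaled_mean0 r : 0 < r -> scaled_mean r 0 = ginf.
Proof.
move=> r0; rewrite /scaled_mean expr1.
rewrite (mean_value0 (ltW r0)).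
by rewrite mulrAC divff ?mul1r// gt_eqF// mulr_gt0.
Qed.

Lemma scaled_meanS r k : 0 < r ->
  scaled_mean r k.+1 = (1 - loss r k) * scaled_mean r k.
Proof.
move=> r0; have mr0 : m * r != 0 by rewrite gt_eqF// mulr_gt0.
rewrite /scaled_mean
  (mean_value_loss)//.
have := expf_neq0 k.+1 mr0; rewrite [_ ^+ k.+2]exprS.
by move: (m * r) mr0 (_ ^+ k.+1) => x x0 y y0; field; rewrite x0 y0.
Qed.

Lemma scaled_mean_decr r k l : 0 < r -> (k <= l)%N ->
  scaled_mean r l <= scaled_mean r k.
Proof.
move=> r0; elim: l => [|l IH]; first by rewrite leqn0 => /eqP ->.
rewrite leq_eqVlt => /predU1P[->//|/IH]; apply: le_trans.
rewrite scaled_meanS// ler_piMl ?(ltW (scaled_mean_gt0 l r0))// gerBl.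
exact: (loss_ge0).
Qed.

Lemma scaled_mean_is_cvg r : 0 < r -> cvgn (scaled_mean r).
Proof.
move=> r0; apply: nonincreasing_is_cvgn.
  by move=> k l; exact: scaled_mean_decr.
by exists 0 => _ [k _ <-]; rewrite ltW// scaled_mean_gt0.
Qed.

Lemma scaled_mean_continuous r0 k : 0 < r0 ->
  scaled_mean r k @[r --> r0] --> scaled_mean r0 k.
Proof.
move=> r00; apply: cvgM; first exact: mean_value_continuous.
apply: cvgV; first by rewrite expf_neq0// gt_eqF// mulr_gt0.
by apply: exprn_cvg; apply: cvgM; [exact: cvg_cst|exact: cvg_id].
Qed.

(** Bound on the sum of the losses from generation k on, when m r <= rho. *)
Definition loss_tail (rho : R) k : R :=
  kappa1 / s * EW * ginf `^ s * (rho `^ s) ^+ k.+1 / (1 - rho `^ s).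

Let C_ge0 : 0 <= kappa1 / s * EW * ginf `^ s.
Proof. by rewrite !mulr_ge0 ?powR_ge0 ?invr_ge0 ?(ltW kappa1_gt0) ?(ltW s_gt0). Qed.

Lemma powR_lt1 (rho : R) : 0 <= rho -> rho < 1 -> rho `^ s < 1.
Proof.
move=> r0 r1; have h1 : 1 `^ s = 1 :> R by rewrite powR1.
by rewrite -[ltRHS]h1; apply: gt0_ltr_powR; rewrite ?nnegrE.
Qed.

Lemma loss_tail_ge0 rho k : 0 <= rho -> rho < 1 -> 0 <= loss_tail rho k.
Proof.
move=> r0 r1; have sg1 := powR_lt1 r0 r1.
by rewrite divr_ge0 ?subr_ge0 ?(ltW sg1)// mulr_ge0// exprn_ge0// powR_ge0.
Qed.

(** The mean value is at most ginf (m r)^(k+1), and the loss is of order its power s. *)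
Lemma loss_geometric rho r k : 0 < r -> m * r <= rho ->
  loss r k <= kappa1 / s * EW * ginf `^ s * (rho `^ s) ^+ k.+1.
Proof.
move=> r0 mr; have mr0 : 0 < m * r by exact: mulr_gt0.
apply: le_trans (loss_le k r0) _.
rewrite -[leRHS]mulrA ler_wpM2l//.
  by rewrite !mulr_ge0 ?invr_ge0 ?(ltW kappa1_gt0) ?(ltW s_gt0).
have rho0 : 0 <= rho := le_trans (ltW mr0) mr.
rewrite powRX//.
rewrite -powRM ?exprn_ge0 ?(ltW ginf_gt0)//.
apply: powR_le; [exact: ltW|exact: ltW (b_gt0 k r0)|].
have -> : b r k = scaled_mean r k * (m * r) ^+ k.+1.
  by rewrite /scaled_mean divfK// expf_neq0// gt_eqF.
apply: ler_pM; rewrite ?exprn_ge0 ?(ltW mr0) ?(ltW (scaled_mean_gt0 k r0))//.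
  by rewrite -(scaled_mean0 r0) scaled_mean_decr.
by rewrite lerXn2r// nnegrE ltW.
Qed.

Lemma scaled_mean_tail rho r k n : rho < 1 -> 0 < r -> m * r <= rho ->
  (k <= n)%N -> scaled_mean r k * (1 - loss_tail rho k) <= scaled_mean r n.
Proof.
move=> rho1 r0 mr kn; have rho0 : 0 <= rho by rewrite (le_trans _ mr)// mulr_ge0 ?ltW.
have sg0 : 0 <= rho `^ s by exact: powR_ge0.
have sg1 : rho `^ s < 1 by exact: powR_lt1.
have c0 j := scaled_mean_gt0 j r0.
pose C := kappa1 / s * EW * ginf `^ s.
(* the tail telescopes: its decrements bound the losses *)
have tailS j : loss_tail rho j - loss_tail rho j.+1 = C * (rho `^ s) ^+ j.+1.
  rewrite /loss_tail -/C [_ ^+ j.+2]exprS; field; rewrite ?gt_eqF//; lra.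
suff h : scaled_mean r k * (1 - (loss_tail rho k - loss_tail rho n)) <= scaled_mean r n.
  by apply: le_trans h; rewrite ler_pM2l// lerD2l lerN2 gerBl loss_tail_ge0.
elim: n kn => [|n IH].
  by rewrite leqn0 => /eqP ->; rewrite subrr subr0 mulr1.
rewrite leq_eqVlt => /predU1P[->|kn]; first by rewrite subrr subr0 mulr1.
have := IH kn; rewrite scaled_meanS// mulrBl mul1r => {}IH.
have : loss r n * scaled_mean r n <= C * (rho `^ s) ^+ n.+1 * scaled_mean r k.
  apply: ler_pM; [|exact: ltW|exact: loss_geometric|exact: scaled_mean_decr].
  exact: (loss_ge0).
by rewrite -tailS; lra.
Qed.

Lemma loss_tail_cvg0 rho : 0 < rho -> rho < 1 -> loss_tail rho k @[k --> \oo] --> (0 : R).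
Proof.
move=> rho0 rho1; have sg1 : rho `^ s < 1 by exact: powR_lt1 (ltW rho0) rho1.
pose c := kappa1 / s * EW * ginf `^ s * rho `^ s / (1 - rho `^ s).
rewrite (_ : loss_tail rho = fun k => c * (rho `^ s) ^+ k); last first.
  by apply/funext => k; rewrite /loss_tail /c exprS mulrA [RHS]mulrAC.
rewrite -[X in _ --> X](mulr0 c); apply: cvgM; first exact: cvg_cst.
by apply: cvg_expr; rewrite ger0_norm ?powR_ge0.
Qed.

Definition scaled_limit (theta : R) : R := limn (scaled_mean (theta / m)).

Lemma scaled_limit_le theta k : 0 < theta ->
  scaled_limit theta <= scaled_mean (theta / m) k.
Proof.
move=> t0; have r0 : 0 < theta / m by rewrite divr_gt0.
apply: nonincreasing_cvgn_ge (scaled_mean_is_cvg r0) k.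
by move=> k l; exact: scaled_mean_decr.
Qed.

Lemma scaled_limit_gt0 theta : 0 < theta -> theta < 1 -> 0 < scaled_limit theta.
Proof.
move=> t0 t1; have r0 : 0 < theta / m by rewrite divr_gt0.
have mr : m * (theta / m) <= theta by rewrite mulrCA divff// mulr1.
have [k _ hk] := cvgr_lt 0 (loss_tail_cvg0 t0 t1) _ ltr01.
have tk : loss_tail theta k < 1 by apply: (hk k) => /=.
apply: (@lt_le_trans _ _ (scaled_mean (theta / m) k * (1 - loss_tail theta k))).
  by rewrite mulr_gt0 ?scaled_mean_gt0// subr_gt0.
apply: limr_ge; first exact: scaled_mean_is_cvg.
by exists k => // n kn; exact: scaled_mean_tail.
Qed.

(** Both bounds are read off a fixed height k, where the scaled mean is continuous
    in r: it decreases from height k on, and by at most the tail of the losses,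
    which is uniform in r. *)
Lemma scaled_mean_diag_cvg (theta : R) (r : nat -> R) : 0 < theta -> theta < 1 ->
  (forall n, 0 < r n) -> r n @[n --> \oo] --> theta / m ->
  scaled_mean (r n) n @[n --> \oo] --> scaled_limit theta.
Proof.
move=> t0 t1 rpos rt; apply/cvgrPdist_le => eps e0.
have th0 : 0 < theta / m by rewrite divr_gt0.
pose rho := (1 + theta) / 2.
have rho0 : 0 < rho by rewrite /rho; lra.
have rho1 : rho < 1 by rewrite /rho; lra.
have trho : theta < rho by rewrite /rho; lra.
have e2 : 0 < eps / 2 by rewrite divr_gt0.
have e3 : 0 < eps / 2 / (2 * ginf) by rewrite divr_gt0// mulr_gt0.
have [k1 _ hk1] := cvgr_le 0 (loss_tail_cvg0 rho0 rho1) _ e3.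
have cl : scaled_mean (theta / m) k @[k --> \oo] --> scaled_limit theta.
  exact: scaled_mean_is_cvg.
have lk : scaled_limit theta < scaled_limit theta + eps / 2 by rewrite ltrDl.
have [k2 _ hk2] := cvgr_le (scaled_limit theta) cl _ lk.
pose k := maxn k1 k2.
have tk : loss_tail rho k <= eps / 2 / (2 * ginf) by apply: hk1; rewrite /= leq_maxl.
have ck : scaled_mean (theta / m) k <= scaled_limit theta + eps / 2.
  by apply: hk2; rewrite /= leq_maxr.
have ck' := scaled_limit_le k t0.
have cr : scaled_mean (r n) k @[n --> \oo] --> scaled_mean (theta / m) k.
  apply: (cvg_comp _ (fun x => scaled_mean x k) rt).
  exact: scaled_mean_continuous.
have e4 : 0 < eps / 4 by rewrite divr_gt0.
near=> n.
have mr : m * r n <= rho.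
  rewrite mulrC -ler_pdivlMr//; near: n; apply: (cvgr_le _ rt).
  by rewrite ltr_pM2r// invr_gt0.
have dk : `|scaled_mean (theta / m) k - scaled_mean (r n) k| <= eps / 4.
  by near: n; move/cvgrPdist_le : cr; apply.
have kn : (k <= n)%N by near: n; exists k.
have up := scaled_mean_decr (rpos n) kn.
have lo := scaled_mean_tail rho1 (rpos n) mr kn.
have rn0 := rpos n.
have cg : scaled_mean (r n) k * loss_tail rho k <= ginf * (eps / 2 / (2 * ginf)).
  apply: ler_pM => //; rewrite ?(ltW (scaled_mean_gt0 k rn0))//.
    exact: loss_tail_ge0 (ltW rho0) rho1.
  by rewrite -(scaled_mean0 rn0) scaled_mean_decr.
have cgE : ginf * (eps / 2 / (2 * ginf)) = eps / 4 by field; rewrite gt_eqF.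
rewrite mulrBr mulr1 in lo; rewrite cgE in cg.
move: dk; rewrite !ler_norml => /andP[d1 d2].
by apply/andP; split; lra.
Unshelve. all: by end_near. Qed.

(** The geometric sum, with its largest term factored out. *)
Lemma a_seq_subcritical (r : nat -> R) n : (forall n, 0 < r n) ->
  m * r n.+1 < 1 ->
  a_seq m s r n.+1 `^ (- s^-1) = (m * r n.+1) ^+ n.+1 *
  ((1 - ((m * r n.+1) `^ s) ^+ n.+1) / (1 - (m * r n.+1) `^ s)) `^ (- s^-1).
Proof.
move=> r0 mr1; have mr0 : 0 < m * r n.+1 by exact: mulr_gt0.
rewrite a_seqE//; move: (m * r n.+1) mr0 mr1 => x x0 x1.
have z0 : 0 < x `^ s by exact: powR_gt0.
have z1 : x `^ s < 1 by exact: powR_lt1 (ltW x0) x1.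
have -> : \sum_(0 <= k < n.+1) (x `^ (- s)) ^+ (n.+1 - k) =
    (x ^+ n.+1) `^ (- s) * \sum_(0 <= k < n.+1) (x `^ s) ^+ k.
  rewrite mulr_sumr; apply: eq_big_nat => k /andP[_ kn].
  rewrite powRN exprVn exprB ?unitfE ?gt_eqF//; last exact: ltnW.
  rewrite invf_div mulrC powRN; congr (_^-1 * _).
  by rewrite powRX// ltW.
have S : \sum_(0 <= k < n.+1) (x `^ s) ^+ k = (1 - (x `^ s) ^+ n.+1) / (1 - x `^ s).
  have := subrX1 (x `^ s) n.+1; rewrite big_mkord -[LHS]opprB => /eqP.
  rewrite eqr_oppLR -mulNr opprB => /eqP ->.
  by rewrite mulrAC divff ?mul1r// gt_eqF// subr_gt0.
rewrite S powRM ?powR_ge0//; last first.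
  rewrite divr_ge0 ?subr_ge0 ?(ltW z1)// exprn_ile1 ?(ltW z1)//; exact: ltW.
by rewrite -powRrM mulrNN divff ?gt_eqF// powRr1// exprn_ge0// ltW.
Qed.

(** The second factor comes from the sum a_n, divided by its largest term. *)
Definition subcritical_constant (theta : R) : R :=
  scaled_limit theta * (1 - theta `^ s) `^ (- s^-1).

Lemma subcritical_constant_gt0 theta : 0 < theta -> theta < 1 ->
  0 < subcritical_constant theta.
Proof.
move=> t0 t1; rewrite mulr_gt0 ?scaled_limit_gt0// powR_gt0// subr_gt0.
exact: powR_lt1 (ltW t0) t1.
Qed.

Lemma subcritical_equiv (theta : R) (r : nat -> R) : 0 < theta -> theta < 1 ->
  (forall n, 0 < r n) -> m * r n @[n --> \oo] --> theta ->
  b (r n.+1) n / (subcritical_constant theta *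
    a_seq m s r n.+1 `^ (- s^-1)) @[n --> \oo] --> (1 : R).
Proof.
move=> t0 t1 r0 mr; have t0' := ltW t0.
have mrS : m * r n.+1 @[n --> \oo] --> theta by rewrite (cvg_shiftS (fun n => m * r n)).
have rt : r n.+1 @[n --> \oo] --> theta / m.
  rewrite (_ : (fun n => r n.+1) = fun n => m * r n.+1 / m).
    by apply: cvgM => //; exact: cvg_cst.
  by apply/funext => n; rewrite mulrAC divff// mul1r.
have zt : (m * r n.+1) `^ s @[n --> \oo] --> theta `^ s by exact: powR_cvg t0 mrS.
have th1 : theta `^ s < 1 by exact: powR_lt1.
have d0 : 0 < 1 - theta `^ s by rewrite subr_gt0.
have ct : scaled_mean (r n.+1) n @[n --> \oo] --> scaled_limit theta.
  exact: scaled_mean_diag_cvg t0 t1 (fun n => r0 n.+1) rt.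
have cl0 := scaled_limit_gt0 t0 t1.
pose rho := (1 + theta) / 2.
have rho0 : 0 < rho by rewrite /rho; lra.
have rho1 : rho < 1 by rewrite /rho; lra.
have trho : theta < rho by rewrite /rho; lra.
have zn0 : ((m * r n.+1) `^ s) ^+ n.+1 @[n --> \oo] --> (0 : R).
  have h : (rho `^ s) ^+ n.+1 @[n --> \oo] --> (0 : R).
    rewrite (cvg_shiftS (fun n => (rho `^ s) ^+ n)).
    by apply: cvg_expr; rewrite ger0_norm ?powR_ge0// powR_lt1// ltW.
  apply: (squeeze_cvgr _ (cvg_cst 0) h); near=> n.
  have mr0 : 0 <= m * r n.+1 by rewrite mulr_ge0 ?(ltW m_gt0)// ltW.
  rewrite exprn_ge0 ?powR_ge0//= lerXn2r// ?nnegrE ?powR_ge0//.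
  apply: powR_le => //; first exact: ltW.
  by near: n; exact: (cvgr_le theta mrS).
have St : (1 - ((m * r n.+1) `^ s) ^+ n.+1) / (1 - (m * r n.+1) `^ s)
    @[n --> \oo] --> (1 - theta `^ s)^-1.
  have E : (1 - 0) / (1 - theta `^ s) = (1 - theta `^ s)^-1 by rewrite subr0 mul1r.
  rewrite -[X in _ --> X]E.
  apply: cvgM; first by apply: cvgB => //; exact: cvg_cst.
  apply: cvgV; first by rewrite gt_eqF.
  by apply: cvgB => //; exact: cvg_cst.
have dV : 0 < (1 - theta `^ s)^-1 by rewrite invr_gt0.
have Spow : ((1 - ((m * r n.+1) `^ s) ^+ n.+1) / (1 - (m * r n.+1) `^ s)) `^ (- s^-1)
    @[n --> \oo] --> ((1 - theta `^ s) `^ (- s^-1))^-1.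
  by rewrite -powRV ?(ltW d0)//; exact: powR_cvg dV St.
have K0 := subcritical_constant_gt0 t0 t1.
have lim1 : scaled_limit theta / (subcritical_constant theta *
    ((1 - theta `^ s) `^ (- s^-1))^-1) = 1.
  have : 0 < (1 - theta `^ s) `^ (- s^-1) by exact: powR_gt0.
  rewrite /subcritical_constant; move: (_ `^ (- s^-1)) => y y0.
  by field; rewrite !gt_eqF.
have h : scaled_mean (r n.+1) n / (subcritical_constant theta *
  ((1 - ((m * r n.+1) `^ s) ^+ n.+1) / (1 - (m * r n.+1) `^ s)) `^ (- s^-1))
  @[n --> \oo] --> (1 : R).
  rewrite -[X in _ --> X]lim1; apply: cvgM.
    exact: ct.
  apply: cvgV; first by rewrite mulf_neq0 ?gt_eqF// invr_gt0 powR_gt0.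
  by apply: cvgM Spow; exact: cvg_cst.
apply: cvg_trans h; apply: near_eq_cvg; near=> n.
have rn0 := r0 n.+1.
have mr0 : 0 < m * r n.+1 by exact: mulr_gt0.
rewrite a_seq_subcritical//; last by near: n; exact: (cvgr_lt theta mrS).
by rewrite mulrCA /scaled_mean -mulrA -invfM.
Unshelve. all: by end_near. Qed.

End ConductanceRecursion.

(** * The recursion on trees *)

Section TreeRecursion.
Context {R : realType}.

(** The offspring number is at least 1 almost surely, and at least 2 with positive
    probability. *)
Lemma offspring_mean_gt1 (mu : probability nat R) (m : R) :
  mu [set 0%N] = 0%E -> (mu [set 1%N] < 1)%E -> offspring_mean mu = m%:E -> 1 < m.
Proof.
move=> mu0 mu1 mE; rewrite -lte_fin -mE.
pose A := ~` [set 0%N]; pose B := ~` [set 1%N] `&` A.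
have mA : measurable A by [].
have mB : measurable B by [].
have muA : mu A = 1%E.
  by rewrite probability_setC// mu0 sube0.
have muB : (0 < mu B)%E.
  rewrite lt_neqAle measure_ge0 andbT; apply/eqP => B0.
  have : (mu A <= mu B + mu [set 1%N])%E.
    apply: le_trans (measureU2 _ _ _) => //; apply: le_measure; rewrite ?inE//.
    move=> k Ak; have [->|k1] := pselect (k = 1%N); [by right|by left].
  by rewrite muA -B0 add0e leNgt mu1.
have lt1 : (1 < mu A + mu B)%E by rewrite muA lteDl// fin_numE.
apply: (lt_le_trans lt1).
have <- : (\int[mu]_k ((\1_A k)%:E + (\1_B k)%:E) = mu A + mu B)%E.
  rewrite ge0_integralD//; first by rewrite !integral_indic// !setIT.
apply: ge0_le_integral => //.
  by move=> k _; rewrite lee_fin addr_ge0.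
move=> k _; rewrite -EFinD lee_fin !indicE -natrD ler_nat.
have h0 : (0%N \in A) = false by apply: memNset => /(_ erefl).
have h0' : (0%N \in B) = false by apply: memNset => -[_ /(_ erefl)].
have h1 : (1%N \in B) = false by apply: memNset => -[/(_ erefl)].
by case: k => [|[|k]]; [rewrite h0 h0'|rewrite h1 addn0; case: (_ \in _)|
  case: (_ \in _); case: (_ \in _)].
Qed.

Lemma cvg_sup_pinfty (g : R -> R) M : (forall x y, 0 <= x -> x <= y -> g x <= g y) ->
  (forall x, 0 <= x -> g x <= M) ->
  cvg (g x @[x --> +oo]) /\ forall x, 0 <= x -> g x <= lim (g x @[x --> +oo]).
Proof.
move=> gm gM; pose f x := g (Num.max x 0).
(* g is arbitrary on the negative half-line *)
have f_nd : {homo f : x y / x <= y}.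
  move=> x y xy; apply: gm; first by rewrite le_max lexx orbT.
  by rewrite ge_max !le_max xy lexx orbT.
have f_ub : has_ubound (range f).
  by exists M => _ [x _ <-]; apply: gM; rewrite le_max lexx orbT.
have gf : g x @[x --> +oo] --> sup (range f).
  apply: cvg_trans (nondecreasing_cvgr f_nd f_ub); apply: near_eq_cvg.
  exists 0; split=> // x x0; rewrite /f; congr g.
  by rewrite max_l// ltW.
split; first by apply/cvg_ex; exists (sup (range f)).
move=> x x0; rewrite (cvg_lim _ gf)//; apply: ub_le_sup => //.
by exists x => //; rewrite /f; congr g; rewrite max_l.
Qed.

Lemma tree_rec_value (d : measure_display) (Omega : measurableType d)
    (P : probability Omega R) (N : seq nat -> {RV P >-> nat}) (g : R -> R)
    (ginf r : R) k u w : ginf = lim (g x @[x --> +oo]) ->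
  tree_rec N g r w k.+1 u = (@value _ _ _ _ N g ginf r k u w)%:E.
Proof.
move=> ginfE; elim: k u => [|k IH] u.
  rewrite /= /value /child_sum /children big_map; congr ((_ * _)%:E).
  by rewrite /index_iota subn0; apply: eq_bigr => i _; rewrite /= -ginfE.
rewrite [LHS]/= /value /child_sum /children big_map; congr ((_ * _)%:E).
rewrite /index_iota subn0; apply: eq_bigr => i _.
exact: (congr1 (extend_to_infty g) (IH (rcons u i))).
Qed.

(** The shift avoids the index 0, where the tree is reduced to its root and the
    value is infinite. *)
Lemma asymp_equivS (x : nat -> \bar R) (x' y : nat -> R) :
  (forall n, x n.+1 = (x' n)%:E) -> (forall n, y n.+1 != 0) ->
  x' n / y n.+1 @[n --> \oo] --> (1 : R) -> asymp_equiv x y.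
Proof.
move=> xE y0 h; rewrite /asymp_equiv.
rewrite -(cvg_shiftS (fun n => x n / (y n)%:E)%E)/=.
rewrite (_ : (fun n => _ / _)%E = fun n => (x' n / y n.+1)%:E).
  by apply: cvg_EFin => //; exact: nearW.
by apply/funext => n; rewrite xE inver (negbTE (y0 n)).
Qed.

End TreeRecursion.

Theorem proposition1p9 (R : realType)
  (mu : probability nat R)
  (mu0 : mu [set 0%N] = 0%E) (mu1 : (mu [set 1%N] < 1)%E)
  (m : R) (mE : offspring_mean mu = m%:E)
  (d : measure_display) (Omega : measurableType d) (P : probability Omega R)
  (N : seq nat -> {RV P >-> nat}) (N_GW : galton_watson mu N)
  (s : R) (s_gt0 : 0 < s) (Zs : (offspring_moment mu (s + 1) < +oo)%E)
  (g : R -> R) (g_ge0 : forall x, 0 <= x -> 0 <= g x)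
  (g_concave : concave_on_nonneg g)
  (g_bounded : exists M, forall x, 0 <= x -> g x <= M)
  (kappa1 kappa2 : R) (kappa1_gt0 : 0 < kappa1) (kappa2_gt0 : 0 < kappa2)
  (g_bounds : forall x, 0 < x ->
    x / (1 + kappa1 * x `^ s) `^ (s^-1) <= g x <=
    x / (1 + kappa2 * x `^ s) `^ (s^-1))
  (kappag : R) (kappag_gt0 : 0 < kappag)
  (kappagE : (x `^ (s + 1))^-1 * (x - g x) @[x --> 0^'+] --> kappag) :
  exists alpha : R -> R,
    (forall (theta : R) (r : nat -> R),
       0 < theta <= 1 ->
       (forall n, 0 < r n) ->
       m * r n @[n --> \oo] --> theta ->
       asymp_equiv (fun n => \int[P]_w B N g r n [::] w)%E
                   (fun n => alpha theta * a_seq m s r n `^ (- s^-1))) /\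
    alpha 1 =
      (s * kappag * fine 'E_P[fun w => martingale_limit N m w `^ (s + 1)])
        `^ (- s^-1).
Proof.
have m_gt1 : 1 < m := offspring_mean_gt1 mu0 mu1 mE.
have [M gM] := g_bounded.
have gmono := g_mono g_ge0 g_concave.
have [_ g_le_ginf] := cvg_sup_pinfty gmono gM.
pose ginf := lim (g x @[x --> +oo]).
have ginf_gt0 : 0 < ginf.
  apply: lt_le_trans (g_le_ginf 1 ler01).
  exact: (g_gt0 kappa1_gt0 g_bounds ltr01).
pose b := @mean_value _ _ _ P N g ginf.
pose EW := fine 'E_P[fun w => martingale_limit N m w `^ (s + 1)].
pose alpha1 := (s * kappag * EW) `^ (- s^-1).
have EW_ge1 : 1 <= EW.
  rewrite /EW unlock; apply: (limit_moment_ge1 N_GW mE m_gt1 _ Zs).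
  by rewrite ltrDr.
pose alpha (theta : R) := if theta == 1 then alpha1
  else @subcritical_constant _ _ _ P N m s g ginf theta.
exists alpha; split; last by rewrite /alpha eqxx.
move=> theta r /andP[t0 t1] r0 mr.
have EB n : (\int[P]_w B N g r n.+1 [::] w)%E = (b (r n.+1) n)%:E.
  rewrite -(mean_valueE N_GW mE m_gt1 g_ge0 ginf_gt0 g_le_ginf n [::] (ltW (r0 n.+1))).
  by apply: eq_integral => w _; rewrite /B subn0; apply: tree_rec_value.
have a0 n : 0 < a_seq m s r n.+1.
  exact: (a_seq_gt0 m_gt1).
have alpha_gt0 : 0 < alpha theta.
  rewrite /alpha; case: eqP => [_|/eqP tn1].
    by rewrite powR_gt0// !mulr_gt0// (lt_le_trans ltr01).
  have t_lt1 : theta < 1 by rewrite lt_neqAle tn1.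
  exact: (subcritical_constant_gt0 N_GW mE m_gt1 s_gt0 Zs g_ge0 g_concave
    kappa1_gt0 kappa2_gt0 g_bounds ginf_gt0 g_le_ginf t0 t_lt1).
apply: (asymp_equivS EB).
  by move=> n; rewrite gt_eqF// mulr_gt0// powR_gt0.
rewrite /alpha; case: eqP => [tE|/eqP tn1].
  rewrite tE in mr; rewrite /alpha1 /EW unlock.
  exact: (critical_equiv N_GW mE m_gt1 s_gt0 Zs g_ge0 g_concave
    kappa1_gt0 kappa2_gt0 g_bounds ginf_gt0 g_le_ginf kappag_gt0 kappagE r0 mr).
have t_lt1 : theta < 1 by rewrite lt_neqAle tn1.
exact: (subcritical_equiv N_GW mE m_gt1 s_gt0 Zs g_ge0 g_concave
  kappa1_gt0 kappa2_gt0 g_bounds ginf_gt0 g_le_ginf t0 t_lt1 r0 mr).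
Qed.
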